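(* Let $K\ge 0$, and let $\alpha,\beta,N$ be real numbers with $0<\alpha<\frac16$, $\beta>0$, $N>0$ and $3\alpha+\beta<N-1$. Let $\rho_0\in L^1(\mathbb{T})$ with $\rho_0\ge 0$ and $u_0\in L^\infty(\mathbb{T})$. Let $(\rho_0^\epsilon,u_0^\epsilon)_{0<\epsilon<1}$ be a family in $\mathcal{C}(\mathbb{T})^2$ such that $\rho_0^\epsilon(x)\ge\epsilon$ for all $x$, and $\|\rho_0-\rho_0^\epsilon\|_{L^1(\mathbb{T})}\to 0$, $\|u_0-u_0^\epsilon\|_\infty\to 0$ when $\epsilon\to 0$. For each $\epsilon$ consider the following system of ODEs in $\mathcal{C}(\mathbb{T})$ for the unknowns $t\mapsto \rho(\cdot,t,\epsilon)$ and $t\mapsto(\rho u)(\cdot,t,\epsilon)$: $$\frac{d}{dt}\rho(x,t,\epsilon)=\frac1\epsilon\big[(\rho u^+)(x-\epsilon,t,\epsilon)-(\rho|u|)(x,t,\epsilon)+(\rho u^-)(x+\epsilon,t,\epsilon)\big]+\epsilon^\beta,$$ $$\frac{d}{dt}(\rho u)(x,t,\epsilon)=\frac1\epsilon\big[(\rho u u^+)(x-\epsilon,t,\epsilon)-(\rho u|u|)(x,t,\epsilon)+(\rho u u^-)(x+\epsilon,t,\epsilon)\big]-\rho(x,t,\epsilon)\frac{\partial}{\partial x}\Phi(x,t,\epsilon),$$ where $$u(x,t,\epsilon)=\frac{(\rho u)(x,t,\epsilon)}{\rho(x,t,\epsilon)},\qquad \Phi(x,t,\epsilon)=K\big[\log(\rho(\cdot,t,\epsilon)+\epsilon^N)*\phi_{\epsilon^\alpha}\big](x),$$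 with initial conditions $\rho(\cdot,0,\epsilon)=\rho_0^\epsilon$, $(\rho u)(\cdot,0,\epsilon)=\rho_0^\epsilon u_0^\epsilon$. Then the solution of this system (which exists, is unique, has $\rho>0$, and is defined for all $t\in[0,+\infty[$ and $x\in\mathbb{T}$) provides a weak asymptotic solution, global in time $t\in[0,+\infty[$ and in space $x\in\mathbb{T}$, of the 1-D isothermal gas equations $$\partial_t\rho+\partial_x(\rho u)=0,\qquad \partial_t(\rho u)+\partial_x(\rho u^2)+\rho\,\partial_x\Phi=0,\qquad \Phi=K\log\rho .$$
   Context: $\mathbb{T}=\mathbb{R}/(2\pi\mathbb{Z})$; functions on $\mathbb{T}$ are identified with $2\pi$-periodic functions on $\mathbb{R}$, and $\mathcal{C}(\mathbb{T})$ is the Banach space of continuous functions on $\mathbb{T}$ with the sup norm $\|\cdot\|_\infty$. For real $u$: $u^+=\max(u,0)$, $u^-=\max(-u,0)$, so $u=u^+-u^-$ and $|u|=u^++u^-$. Products such as $\rho u^\pm$, $\rho u|u|$ are evaluated at the indicated point. A function $\phi\in\mathcal{C}_c^\infty(\mathbb{R})$ is fixed with $\phi\ge 0$, $\phi(-x)=\phi(x)$ for all $x$, $\int\phi(x)\,dx=1$; for $\mu>0$, $\phi_\mu(x)=\frac1\mu\phi(\frac x\mu)$; $*$ denotes convolution on $\mathbb{R}$. A solution of the system of ODEs is a continuously differentiable map $t\mapsto(\rho(\cdot,t,\epsilon),(\rho u)(\cdot,t,\epsilon))\in\mathcal{C}(\mathbb{T})^2$ (one-sided derivative at $t=0$) with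 $\rho>0$ that satisfies the equations. The family $(\rho,\rho u,\Phi)(\cdot,\cdot,\epsilon)$ is a weak asymptotic solution of the isothermal gas equations (strong derivative in $t$, weak derivative in $x$) if for every $t>0$ and every $\psi\in\mathcal{C}_c^\infty(\mathbb{R})$, as $\epsilon\to 0$ (integrals over $\mathbb{R}$), $$\int\frac{d}{dt}\rho(x,t,\epsilon)\psi(x)dx-\int(\rho u)(x,t,\epsilon)\psi'(x)dx\to 0,$$ $$\int\frac{d}{dt}(\rho u)(x,t,\epsilon)\psi(x)dx-\int(\rho u^2)(x,t,\epsilon)\psi'(x)dx+\int\rho(x,t,\epsilon)\frac{\partial}{\partial x}\Phi(x,t,\epsilon)\psi(x)dx\to 0,$$ $$\int\Phi(x,t,\epsilon)\psi(x)dx-\int K\log[\rho(x,t,\epsilon)]\psi(x)dx\to 0 .$$ *)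

(* Defs.v *)
From HB Require Import structures.
From mathcomp Require Export all_boot all_order all_algebra.
From mathcomp Require Export all_classical all_reals all_analysis.

Set Implicit Arguments.
Unset Strict Implicit.
Unset Printing Implicit Defensive.

Export Order.TTheory GRing.Theory Num.Theory.
Export numFieldNormedType.Exports.

Local Open Scope classical_set_scope.
Local Open Scope ring_scope.

(* Functions on the torus R/(2 pi Z) are 2pi-periodic functions on R, with
   measure theory on the period [0, 2 pi]; sup norms over the torus are sup norms
   over R. *)

Definition period {R : realType} : R := 2 * pi.

Definition continuous_torus {R : realType} (f : R -> R) : Prop :=
  continuous f /\ periodic f period.

Definition L1_torus {R : realType} (f : R -> R) : Prop :=
  periodic f period /\
  (@lebesgue_measure R).-integrable `[0, period] (EFin \o f).

Definition L1norm_torus {R : realType} (f : R -> R) : \bar R :=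
  (\int[@lebesgue_measure R]_(x in `[0%R, period]) `|(f x)%:E|)%E.

Definition Linfty_torus {R : realType} (f : R -> R) : Prop :=
  periodic f period /\ f \in Lfun (@lebesgue_measure R) +oo%E.

(* The essential supremum over R of a periodic function is the one over a
   period. *)
Definition Linftynorm_torus {R : realType} (f : R -> R) : \bar R :=
  Lnorm (@lebesgue_measure R) +oo%E (EFin \o f).

Definition Cc_infty {R : realType} (f : R -> R) : Prop :=
  (forall (n : nat) (x : R), derivable (derive1n n f) x 1) /\
  compact (closure [set x | f x != 0]).

Definition convolution {R : realType} (f g : R -> R) (x : R) : R :=
  \int[@lebesgue_measure R]_y (f y * g (x - y)).

Definition mollifier {R : realType} (phi : R -> R) (mu : R) (x : R) : R :=
  mu^-1 * phi (x / mu).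

(* In the sequel a state is a pair (rho, m), where m stands for the unknown
   "rho u". *)

Definition velocity {R : realType} (rho m : R -> R) (x : R) : R := m x / rho x.

(* [u^\+] and [u^\-] are the pointwise positive and negative parts, both
   nonnegative. *)
Definition upwind {R : realType} (eps : R) (g u : R -> R) (x : R) : R :=
  eps^-1 * ((g (x - eps) * u^\+ (x - eps)) - g x * `|u x|
            + g (x + eps) * u^\- (x + eps)).

Definition potential {R : realType} (K alpha N : R) (phi : R -> R) (eps : R)
    (rho : R -> R) (x : R) : R :=
  K * convolution (fun y => ln (rho y + eps `^ N))
        (mollifier phi (eps `^ alpha)) x.

Definition time_interval {R : realType} (T : \bar R) : set R :=
  [set t | 0 <= t /\ (t%:E < T)%E].

(* t |-> f t is a continuously differentiable map from I to the Banach space of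
   continuous functions on the torus, with derivative df; at an end point of I
   that belongs to I the derivative is one-sided. *)
Definition C1_map {R : realType} (I : set R) (f df : R -> R -> R) : Prop :=
  [/\ forall t, I t -> continuous_torus (f t) /\ continuous_torus (df t),
      forall t, I t ->
        {uniform, (fun s x => (s - t)^-1 * (f s x - f t x)) @ within I t^'
          --> df t}
    & forall t, I t -> {uniform, df @ within I (nbhs t) --> df t}].

(* Solution on [0, T[; the global solutions are those with T = +oo. *)
Definition solution {R : realType} (K alpha beta N : R) (phi : R -> R) (eps : R)
    (rho_init u_init : R -> R) (T : \bar R) (rho m : R -> R -> R) : Prop :=
  [/\ exists drho dm : R -> R -> R,
        [/\ C1_map (time_interval T) rho drho,
            C1_map (time_interval T) m dm
          & forall t, time_interval T t -> forall x,
              drho t x =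
                upwind eps (rho t) (velocity (rho t) (m t)) x + eps `^ beta
              /\ dm t x =
                upwind eps (m t) (velocity (rho t) (m t)) x
                - rho t x * derive1 (potential K alpha N phi eps (rho t)) x],
      forall t, time_interval T t -> forall x, 0 < rho t x
    & time_interval T 0 -> forall x,
        rho 0 x = rho_init x /\ m 0 x = rho_init x * u_init x].

(* The families are indexed by eps, then t, then x; only small eps > 0 matter. *)
Definition weak_asymptotic_solution {R : realType} (K : R)
    (rho m Phi : R -> R -> R -> R) : Prop :=
  forall (t : R) (psi : R -> R), 0 < t -> Cc_infty psi ->
  [/\ (\int[@lebesgue_measure R]_x (derive1 (fun s => rho eps s x) t * psi x)
       - \int[@lebesgue_measure R]_x (m eps t x * derive1 psi x))
        @[eps --> 0^'+] --> (0 : R),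
      (\int[@lebesgue_measure R]_x (derive1 (fun s => m eps s x) t * psi x)
       - \int[@lebesgue_measure R]_x
           (rho eps t x * velocity (rho eps t) (m eps t) x ^+ 2 * derive1 psi x)
       + \int[@lebesgue_measure R]_x
           (rho eps t x * derive1 (Phi eps t) x * psi x))
        @[eps --> 0^'+] --> (0 : R)
    & (\int[@lebesgue_measure R]_x (Phi eps t x * psi x)
       - \int[@lebesgue_measure R]_x (K * ln (rho eps t x) * psi x))
        @[eps --> 0^'+] --> (0 : R)].

(* Main.v *)
(* For fixed eps the system is an ordinary differential equation whose right-hand side becomes
   bounded and globally Lipschitz once the state is truncated to the cone 0 <= rho <= b,
   |m| <= U rho; Picard iteration in sup norms weighted by exp (lambda t) solves the truncated
   equation for all times.  The truncation is never reached on [0, tau] when U and b are large.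
   Indeed the total mass grows by 2 pi eps^beta per unit of time, so it controls
   the integral of |log (rho + eps^N)|, up to the lower bound N log eps of the logarithm, and the
   force d Phi / dx is bounded by G = O(eps^(-3 alpha)).  The upwind scheme satisfies a maximum
   principle, whence |u| <= |u0| + G t = O(eps^(-3 alpha)), and each point loses mass at a rate at
   most |u| rho / eps while gaining eps^beta, whence rho >= c eps^(1 + beta + 3 alpha).

   Testing the scheme against psi and moving the shifts onto psi leaves Taylor remainders: the
   errors are O(eps |u|) = O(eps^(1 - 3 alpha)) in the continuity equation, next to the source
   eps^beta, and O(eps u^2) = O(eps^(1 - 6 alpha)) in the momentum equation, where the force terms
   cancel.  For the state law, the mollification costs O(eps^alpha) times the integral of
   |log (rho + eps^N)|, which is O(eps^(- alpha / 2)), and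
   log (rho + eps^N) - log rho <= eps^N / rho = O(eps^(N - 1 - beta - 3 alpha)). *)

Require Import Defs.
From mathcomp Require Import ring lra.

Set Implicit Arguments.
Unset Strict Implicit.
Unset Printing Implicit Defensive.

Local Open Scope classical_set_scope.
Local Open Scope ring_scope.

(** * Primitives, the mean value theorem and a positivity lemma *)

Section Calculus.
Context {R : realType}.
Local Notation mu := (@lebesgue_measure R).
Implicit Types (f g h : R -> R) (a b c x t : R).

(** The estimates look circular: the force bound needs the mass, the velocity bound needs the force,
    the density bounds need the velocity, and the truncation levels must be fixed beforehand. The
    circle opens because positivity and the mass identity hold for the truncated system at any
    levels, and because a flux truncated to the cone is at most [U] times the positive part of the
    density, whatever [b] is. So the levels are fixed in the order mass, force, [U], then [b]. All
    comparisons, uniqueness included, are instances of one lemma, [positivity], on families of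
    scalar functions of time: it asks only how fast a member can decrease while all members are at
    least [- C]. No minimum over the torus is followed in time; points, signs and components are
    mere indices. The upper density bound is exponential in [1 / eps] and serves existence and
    uniqueness alone. Uniformly in [eps] the density is controlled from above by its mass only, so
    the consistency errors are bounded through the integral of the density over a period. *)

Lemma continuous_integrable f a b : continuous f ->
  mu.-integrable `[a, b] (EFin \o f).
Proof.
move=> cf; apply: continuous_compact_integrable; first exact: segment_compact.
exact: continuous_subspaceT.
Qed.

Lemma RintegralC f a b c : continuous f -> a <= b -> b <= c ->
  \int[mu]_(x in `[a, c]) f x =
  \int[mu]_(x in `[a, b]) f x + \int[mu]_(x in `[b, c]) f x.
Proof.
move=> cf ab bc.
have := @Rintegral_itvB R f (BLeft a) (BRight c) b (continuous_integrable a c cf).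
rewrite !bnd_simp => /(_ ab bc).
rewrite Rintegral_itv_obnd_cbnd; last first.
  apply: integrableS (continuous_integrable a c cf) => //.
  by apply: subset_itv; rewrite bnd_simp.
by move=> <-; rewrite addrC subrK.
Qed.

(** Integral identities below are proved by differentiating primitives. An integral over [[a, b]]
    with [b < a] is over the empty set and is not signed, hence the definition of [F] by cases and
    the restriction [a <= b]. *)
Lemma ex_primitive f : continuous f -> exists F : R -> R,
  (forall x, is_derive x 1 F (f x)) /\
  (forall a b, a <= b -> \int[mu]_(x in `[a, b]) f x = F b - F a).
Proof.
move=> cf.
pose F x := if 0 <= x then \int[mu]_(t in `[0, x]) f t
            else - \int[mu]_(t in `[x, 0]) f t.
have dF x : is_derive x 1 F (f x).
  (* A base point to the left of both [x] and [0]: near [x], [F] is the integral from [c] minus a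
     constant, in both cases of its definition. *)
  pose c := Num.min x 0 - 1.
  have c0 : c <= 0 by rewrite /c; have := ge_min 0 x 0; rewrite lexx orbT; lra.
  have cx : c < x by rewrite /c; have := ge_min x x 0; rewrite lexx; lra.
  have [dG G'] : derivable (fun y => \int[mu]_(t in `[c, y]) f t) x 1 /\
      (fun y => \int[mu]_(t in `[c, y]) f t)^`()%classic x = f x.
    apply: (@continuous_FTC1_closed R f c x (x + 1)) => //.
    - by rewrite ltrDl.
    - exact: continuous_integrable.
    - exact: cf.
  have H : is_derive x 1 (fun y => \int[mu]_(t in `[c, y]) f t - \int[mu]_(t in `[c, 0]) f t) (f x).
    have dG' : is_derive x 1 (fun y => \int[mu]_(t in `[c, y]) f t) (f x).
      by rewrite -G' derive1E; apply: DeriveDef.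
    rewrite -[f x]subr0.
    exact: (is_deriveB dG' (is_derive_cst (\int[mu]_(t in `[c, 0]) f t) x 1)).
  apply: near_eq_is_derive H.
  near=> y.
  have cy : c <= y by apply: ltW; near: y; exact: lt_nbhsr.
  rewrite /F; case: ifPn => y0.
    by rewrite (@RintegralC f c 0 y cf c0 y0) addrAC subrr add0r.
  have y0' : y <= 0 by rewrite leNgt; apply: contra y0; exact: ltW.
  by rewrite (@RintegralC f c y 0 cf cy y0') opprD addrA subrr add0r.
exists F; split=> // a b; rewrite le_eqVlt => /orP[/eqP->|ab].
  by rewrite subrr set_itv1 Rintegral_set1.
have dF' x : derivable F x 1 by case: (dF x).
have cF : continuous F by move=> x; apply: differentiable_continuous; apply/derivable1_diffP.
rewrite /Rintegral (@continuous_FTC2 R f F a b) //.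
- exact: continuous_subspaceT.
- split.
  + by move=> x _.
  + by apply: cvg_at_right_filter; exact: cF.
  + by apply: cvg_at_left_filter; exact: cF.
- by move=> x _; rewrite derive1E; case: (dF x).
Unshelve. all: by end_near.
Qed.

Lemma continuous_of_is_derive f g : (forall x, is_derive x 1 f (g x)) -> continuous f.
Proof.
move=> df x; apply: differentiable_continuous; apply/derivable1_diffP.
by case: (df x).
Qed.

(** The regularity that the mean value theorem asks for; nothing is required of the derivative at
    [0], where the solutions have only a one-sided derivative in time. *)
Definition diff_on h (dh : R -> R) t :=
  {within `[0, t], continuous h} /\
  forall s, 0 < s < t -> is_derive s 1 h (dh s).

Lemma diff_on_MVT h dh t : 0 < t -> diff_on h dh t ->
  exists2 c, 0 < c < t & h t - h 0 = dh c * t.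
Proof.
move=> t0 [ch dh'].
have [c ct e] : exists2 c, c \in `]0, t[ & h t - h 0 = dh c * (t - 0).
  by apply: MVT => // s; rewrite in_itv /= => /dh'.
by exists c; [move: ct; rewrite in_itv | rewrite e subr0].
Qed.

Lemma diff_on_sub h dh t s : s <= t -> diff_on h dh t -> diff_on h dh s.
Proof.
move=> st [ch dh']; split.
  apply: continuous_subspaceW ch => x /=; rewrite !in_itv /= => /andP[-> /le_trans]; exact.
by move=> r /andP[r0 rs]; apply: dh'; rewrite r0 (lt_le_trans rs).
Qed.

Lemma diff_onD h dh k dk t : diff_on h dh t -> diff_on k dk t ->
  diff_on (h \+ k) (dh \+ dk) t.
Proof.
move=> [ch dh'] [ck dk']; split; last first.
  by move=> s st; apply: is_deriveD; [exact: dh'|exact: dk'].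
by move=> x; apply: cvgD; [exact: ch|exact: ck].
Qed.

Lemma diff_onM h dh k dk t : diff_on h dh t -> diff_on k dk t ->
  diff_on (h \* k) (fun s => h s * dk s + k s * dh s) t.
Proof.
move=> [ch dh'] [ck dk']; split; last first.
  move=> s st; apply: is_deriveM; [exact: dh'|exact: dk'].
by move=> x; apply: cvgM; [exact: ch|exact: ck].
Qed.

Lemma diff_on_all h dh t : (forall x, is_derive x 1 h (dh x)) -> diff_on h dh t.
Proof.
move=> dh'; split=> // ; apply: continuous_subspaceT.
exact: continuous_of_is_derive dh'.
Qed.

Lemma diff_on_cst c t : diff_on (fun=> c) (fun=> 0) t.
Proof. apply: diff_on_all => x; exact: is_derive_cst. Qed.

Lemma diff_onZ h dh c t : diff_on h dh t ->
  diff_on (fun s => c * h s) (fun s => c * dh s) t.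
Proof.
move=> H; have := diff_onM (diff_on_cst c t) H.
by congr (diff_on _ _ _); apply/funext => s; rewrite mulr0 addr0.
Qed.

Lemma is_derive_expRM c x : is_derive x 1 (fun s => expR (c * s)) (c * expR (c * x)).
Proof.
have dc : is_derive x 1 (fun s => c * s) c.
  by rewrite -[X in is_derive _ _ _ X]mulr1; exact: is_deriveZ.
rewrite mulrC; exact: (@is_derive1_comp R expR (fun s => c * s) x _ _ (is_derive_expR _) dc).
Qed.

Lemma diff_on_expR c t : diff_on (fun s => expR (c * s)) (fun s => c * expR (c * s)) t.
Proof. apply: diff_on_all => x; exact: is_derive_expRM. Qed.

Lemma diff_on_ge0 h dh t : 0 <= t -> diff_on h dh t -> 0 <= h 0 ->
  (forall s, 0 < s < t -> 0 <= dh s) -> 0 <= h t.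
Proof.
rewrite le_eqVlt => /orP[/eqP<- //|t0] hd h0 dh0.
have [c ct e] := diff_on_MVT t0 hd.
by rewrite -[h t](subrK (h 0)) e addr_ge0 // mulr_ge0 ?dh0 // ltW.
Qed.

Lemma small_geometric (C e : R) : 0 < e -> exists n, C * 2^-1 ^+ n < e.
Proof.
move=> e0; exists (Num.truncn (`|C| / e)).+1.
set n := (Num.truncn _).+1.
have nC : `|C| < e * n%:R by rewrite mulrC -ltr_pdivrMr // truncnS_gt.
have n2 : n%:R <= 2 ^+ n :> R by rewrite -natrX ler_nat ltnW // ltn_expl.
rewrite exprVn ltr_pdivrMr ?exprn_gt0 //.
by rewrite (le_lt_trans (ler_norm _)) // (lt_le_trans nC) // ler_pM2l.
Qed.

(* The bound [- C0 2^-n e^(lambda s)] improves by a factor 2 at each step: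
   [e^(A s) z] has derivative at least [- B C0 2^-n e^((lambda + A) s)], and
   [B / (lambda + A) <= 1 / 2]. *)
Lemma positivity (X : Type) (z dz : R -> X -> R) (t1 A B C0 : R) :
  0 <= A -> 0 <= B -> 0 <= C0 ->
  (forall x : X, diff_on (z^~ x) (dz^~ x) t1) ->
  (forall (s : R) (x : X), 0 <= s <= t1 -> - C0 <= z s x) ->
  (forall x : X, 0 <= z 0 x) ->
  (forall s C : R, 0 < s < t1 -> 0 <= C -> (forall y, - C <= z s y) ->
     forall x : X, - A * z s x - B * C <= dz s x) ->
  forall (s : R) (x : X), 0 <= s <= t1 -> 0 <= z s x.
Proof.
move=> A0 B0 C00 zd zC z0 dzC.
pose l := 2 * B + 1.
have l0 : 0 < l by rewrite /l; lra.
have key n : forall (s : R) (x : X), 0 <= s <= t1 -> - (C0 * 2^-1 ^+ n * expR (l * s)) <= z s x.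
  elim: n => [|n IH] s x /andP[s0 st].
    rewrite expr0 mulr1 (le_trans _ (zC s x _)) ?s0 // lerN2 ler_peMr //.
    by rewrite -expR0 ler_expR mulr_ge0 // ltW.
  pose D := C0 * 2^-1 ^+ n.
  have D0 : 0 <= D by rewrite mulr_ge0 // exprn_ge0.
  pose h s := expR (A * s) * z s x + B * D / (l + A) * expR ((l + A) * s).
  have lA : 0 < l + A by lra.
  have E1 r : 0 < expR (A * r) by exact: expR_gt0.
  have E2 r : 0 < expR (l * r) by exact: expR_gt0.
  have EE r : expR ((l + A) * r) = expR (l * r) * expR (A * r) by rewrite mulrDl expRD.
  suff : 0 <= h s.
    rewrite /h EE mulrA [X in _ + X]mulrC -mulrDr pmulr_rge0 // => H.
    have q2 : B * D / (l + A) <= D * 2^-1.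
      rewrite ler_pdivrMr // -mulrA [B * D]mulrC ler_wpM2l // /l; lra.
    have q3 := ler_wpM2r (ltW (E2 s)) q2.
    have -> : C0 * 2^-1 ^+ n.+1 = D / 2 by rewrite /D exprSr mulrA.
    lra.
  have hd := diff_on_sub st (diff_onD (diff_onM (diff_on_expR A t1) (zd x))
    (diff_onZ (B * D / (l + A)) (diff_on_expR (l + A) t1))).
  apply: (diff_on_ge0 s0 hd).
    rewrite /= !mulr0 expR0 mul1r mulr1 addr_ge0 // ?divr_ge0 ?mulr_ge0 //; exact: ltW.
  move=> r /andP[r0 rs] /=.
  have rt : 0 < r < t1 by rewrite r0 (lt_le_trans rs st).
  have rt' : 0 <= r <= t1 by case/andP: rt => /ltW -> /ltW ->.
  have H := dzC r _ rt (mulr_ge0 D0 (ltW (E2 r))) (fun y => IH r y rt') x.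
  rewrite EE.
  have -> : B * D / (l + A) * ((l + A) * (expR (l * r) * expR (A * r))) =
            expR (A * r) * (B * (D * expR (l * r))) by field; lra.
  have -> : expR (A * r) * dz r x + z r x * (A * expR (A * r)) +
      expR (A * r) * (B * (D * expR (l * r))) =
    expR (A * r) * (dz r x + A * z r x + B * (D * expR (l * r))) by ring.
  by apply: mulr_ge0; [exact: ltW|lra].
move=> s x st; rewrite leNgt; apply/negP => zs.
have zs' : 0 < - z s x by rewrite oppr_gt0.
have [n] := small_geometric (C0 * expR (l * s)) zs'.
by rewrite mulrAC => Hn; have := key n s x st; lra.
Qed.

End Calculus.

(** * Continuously differentiable maps into the continuous functions on the torus *)

Section C1.
Context {R : realType}.
Implicit Types (I : set R) (f df : R -> R -> R) (t s x e d : R).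

Lemma unif_cvgP (F : set_system (R -> R)) (g : R -> R) : Filter F ->
  {uniform, F --> g} <->
  (forall e, 0 < e -> F [set h | forall x, `|h x - g x| <= e]).
Proof.
move=> FF; split.
  move=> H e e0; apply: (H [set h | forall x, `|h x - g x| <= e]).
  apply/uniform_nbhs.
  exists [set xy | `|xy.1 - xy.2| < e]; split.
    by rewrite -entourage_ballE; exists e => // -[a b].
  by move=> h Eh x; rewrite distrC ltW //; exact: Eh.
move=> H P /uniform_nbhs [E [+ EP]]; rewrite -entourage_ballE => -[e /= e0 eE].
have e2 : 0 < e / 2 by rewrite divr_gt0.
apply: filterS (H _ e2) => h he; apply: EP => y _; apply: eE => /=.
by rewrite /ball /= distrC (le_lt_trans (he y)) // ltr_pdivrMr // ltr_pMr // ltr1n.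
Qed.

Lemma within_nearP I t (P : R -> Prop) :
  (\forall s \near within I (nbhs t), P s) <->
  (exists2 d : R, 0 < d & forall s, I s -> `|s - t| < d -> P s).
Proof.
split.
  move=> /nbhs_ballP[d /= d0 H]; exists d => // s Is st.
  by apply: H => //; rewrite /ball /= distrC.
move=> [d d0 H]; apply/nbhs_ballP; exists d => // s /= st Is.
by apply: H => //; rewrite distrC.
Qed.

Lemma dwithin_nearP I t (P : R -> Prop) :
  (\forall s \near within I t^', P s) <->
  (exists2 d : R, 0 < d & forall s, I s -> s != t -> `|s - t| < d -> P s).
Proof.
split.
  move=> /nbhs_ballP[d /= d0 H]; exists d => // s Is st1 st.
  by apply: H => //; rewrite /ball /= distrC.
move=> [d d0 H]; apply/nbhs_ballP; exists d => // s /= st st1 Is.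
by apply: H => //; rewrite distrC.
Qed.

(** Clearing the denominator [s - t] makes the estimate trivial at [s = t], so the punctured filter
    disappears; later arguments use this form. *)
Lemma C1_mapP I f df : C1_map I f df <->
  [/\ forall t, I t -> continuous_torus (f t) /\ continuous_torus (df t),
      forall t, I t -> forall e, 0 < e -> exists2 d : R, 0 < d & forall s, I s -> `|s - t| < d ->
        forall x, `|f s x - f t x - (s - t) * df t x| <= e * `|s - t|
    & forall t, I t -> forall e, 0 < e -> exists2 d : R, 0 < d & forall s, I s -> `|s - t| < d ->
        forall x, `|df s x - df t x| <= e].
Proof.
split=> -[H1 H2 H3]; split=> // t It.
- move=> e e0; have /unif_cvgP/(_ e e0)/dwithin_nearP[d d0 H] := H2 t It.
  exists d => // s Is; have [->|st] := eqVneq s t.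
    by move=> _ x; rewrite !subrr mul0r subrr normr0 mulr0.
  move=> /(H s Is st) + x => /(_ x) /=.
  have st0 : s - t != 0 by rewrite subr_eq0.
  have -> : f s x - f t x - (s - t) * df t x =
            ((s - t)^-1 * (f s x - f t x) - df t x) * (s - t).
    by field.
  by move=> h; rewrite normrM ler_wpM2r.
- move=> e e0; have /unif_cvgP/(_ e e0)/within_nearP[d d0 H] := H3 t It.
  by exists d.
- apply/unif_cvgP => e e0; apply/dwithin_nearP.
  have [d d0 H] := H2 t It e e0; exists d => // s Is st sd x /=.
  have st0 : s - t != 0 by rewrite subr_eq0.
  have := H s Is sd x.
  have -> : f s x - f t x - (s - t) * df t x =
            ((s - t)^-1 * (f s x - f t x) - df t x) * (s - t).
    by field.
  by rewrite normrM ler_pM2r // normr_gt0.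
- apply/unif_cvgP => e e0; apply/within_nearP.
  by have [d d0 H] := H3 t It e e0; exists d.
Qed.

Lemma period_gt0 : 0 < period :> R.
Proof. by rewrite /period mulr_gt0 // pi_gt0. Qed.

Lemma periodic_reduce x : exists2 y, 0 <= y <= period &
  forall g : R -> R, periodic g period -> g x = g y.
Proof.
have P0 := period_gt0.
pose n := Num.floor (x / period); exists (x - period * n%:~R).
  have /andP[h1 h2] := floor_itv (x / period).
  rewrite -/n in h1 h2; rewrite ler_pdivlMr // in h1.
  rewrite ltr_pdivrMr // intrD mulrDl mul1r in h2.
  by rewrite [period * _]mulrC; lra.
move=> g pg; case: n => k.
  by rewrite -(periodicn pg k (x - _)) mulr_natr subrK.
by rewrite NegzE rmorphN /= mulrN opprK mulr_natr (periodicn pg).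
Qed.

Lemma continuous_torus_max (g : R -> R) : continuous_torus g ->
  exists y, forall x, g x <= g y.
Proof.
move=> [cg pg].
have [c _ cP] := EVT_max (ltW period_gt0) (continuous_subspaceT cg).
exists c => x; have [y yP ->] := periodic_reduce x; last by [].
by apply: cP; rewrite in_itv.
Qed.

Lemma continuous_torusN (g : R -> R) : continuous_torus g -> continuous_torus (fun x => - g x).
Proof. by move=> [cg pg]; split=> [x|x]; [apply: cvgN; exact: cg|rewrite pg]. Qed.

Lemma continuous_torus_bounded (g : R -> R) : continuous_torus g ->
  exists2 C, 0 <= C & forall x, `|g x| <= C.
Proof.
move=> gC; have [y yP] := continuous_torus_max gC.
have [z zP] := continuous_torus_max (continuous_torusN gC).
exists (`|g y| + `|g z|) => [|x]; first by rewrite addr_ge0.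
have := yP x; have := zP x; have := ler_norm (g y); have := ler_norm (- g z).
by rewrite normrN ler_norml => *; apply/andP; split; have := normr_ge0 (g z); have := normr_ge0 (g y); lra.
Qed.

(** Compactness of [[0, t1]]: local constants are merged into one because [P s] only gets weaker as
    its constant grows. *)
Lemma segment_uniform (P : R -> R -> Prop) (t1 : R) :
  (forall s C C', C <= C' -> P s C -> P s C') ->
  (forall t, 0 <= t <= t1 -> exists2 d : R, 0 < d & exists C, forall s,
     0 <= s <= t1 -> `|s - t| < d -> P s C) ->
  exists C, forall s, 0 <= s <= t1 -> P s C.
Proof.
move=> mono loc.
have /compact_near_coveringP H := @segment_compact R 0 t1.
have := H R +oo%R (fun C s => 0 <= s <= t1 -> P s C) _.
case.
  move=> t; rewrite /= in_itv /= => /loc[d d0 [C HC]].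
  near=> s C' => /= st1; apply: (mono s C C'); last first.
    apply: HC => //; rewrite distrC; near: s; exact: (nbhsx_ballx t d d0).
  by near: C'; apply: nbhs_pinfty_ge; exact: num_real.
(* The property holds eventually at [+oo], that is, strictly beyond [C]. *)
move=> C [_ HC]; exists (C + 1) => s st.
by apply: (HC (C + 1)) => //=; rewrite ?ltrDl // in_itv.
Unshelve. all: by end_near.
Qed.

Lemma C1_continuous I f df : C1_map I f df -> forall t, I t -> forall e, 0 < e ->
  exists2 d : R, 0 < d & forall s, I s -> `|s - t| < d -> forall x, `|f s x - f t x| <= e.
Proof.
move=> /C1_mapP[H1 H2 _] t It e e0.
have [d d0 H] := H2 t It 1 ltr01.
have [C C0 HC] := continuous_torus_bounded (proj2 (H1 t It)).
have C1 : 0 < C + 1 by lra.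
exists (Num.min d (e / (C + 1))) => [|s Is]; first by rewrite lt_min d0 divr_gt0.
rewrite lt_min => /andP[sd]; rewrite ltr_pdivlMr // => se x.
have := H s Is sd x; rewrite mul1r => h.
rewrite -[f s x - f t x](subrK ((s - t) * df t x)) (le_trans (ler_normD _ _)) //.
rewrite normrM (le_trans _ (ltW se)) // mulrDr mulr1 addrC lerD //.
by rewrite ler_wpM2l.
Qed.

Lemma C1_bounded T f df t1 : C1_map (time_interval T) f df -> (t1%:E < T)%E ->
  exists2 C, 0 <= C & forall s, 0 <= s <= t1 -> forall x, `|f s x| <= C.
Proof.
move=> fC t1T.
have [C HC] : exists C, forall s, 0 <= s <= t1 -> forall x, `|f s x| <= C.
  apply: segment_uniform => [s C C' CC' H x|t tt1].
    exact: le_trans (H x) CC'.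
  have tI s : 0 <= s <= t1 -> time_interval T s.
    by case/andP => s0 st; split=> //; apply: le_lt_trans t1T; rewrite lee_fin.
  have [d d0 H] := C1_continuous fC (tI t tt1) ltr01.
  case/C1_mapP: fC => /(_ t (tI t tt1))[/continuous_torus_bounded[C C0 HC] _] _ _.
  exists d => //; exists (C + 1) => s st sd x.
  rewrite -[f s x](subrK (f t x)) (le_trans (ler_normD _ _)) // addrC lerD //.
  exact: H (tI s st) sd x.
exists `|C| => // s st x; exact: le_trans (HC s st x) (ler_norm _).
Qed.

Lemma C1_gt0 T f df t1 : C1_map (time_interval T) f df -> (t1%:E < T)%E ->
  (forall s, time_interval T s -> forall x, 0 < f s x) ->
  exists2 c, 0 < c & forall s, 0 <= s <= t1 -> forall x, c <= f s x.
Proof.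
move=> fC t1T f0.
(* Written as [expR (- C)], the lower bound is positive and gets weaker as [C] grows, as
   [segment_uniform] requires. *)
have [C HC] : exists C, forall s, 0 <= s <= t1 -> forall x, expR (- C) <= f s x.
  apply: segment_uniform => [s C C' CC' H x|t tt1].
    by apply: le_trans (H x); rewrite ler_expR lerN2.
  have tI s : 0 <= s <= t1 -> time_interval T s.
    by case/andP => s0 st; split=> //; apply: le_lt_trans t1T; rewrite lee_fin.
  have [z Hz] : exists z, forall x, f t z <= f t x.
    case/C1_mapP: (fC) => /(_ t (tI t tt1))[/continuous_torusN/continuous_torus_max[z Hz] _] _ _.
    by exists z => x; have := Hz x; rewrite lerN2.
  have z0 := f0 t (tI t tt1) z.
  have z2 : 0 < f t z / 2 by rewrite divr_gt0.
  have [d d0 H] := C1_continuous fC (tI t tt1) z2.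
  exists d => //; exists (- ln (f t z / 2)) => s st sd x.
  rewrite opprK lnK ?posrE //.
  have := H s (tI s st) sd x; rewrite ler_norml => /andP[+ _].
  have := Hz x; lra.
by exists (expR (- C)) => //; exact: expR_gt0.
Qed.

Lemma is_derive_eps (h : R -> R) t l :
  (forall e, 0 < e -> exists2 d : R, 0 < d & forall s, `|s - t| < d ->
    `|h s - h t - (s - t) * l| <= e * `|s - t|) -> is_derive t 1 h l.
Proof.
move=> H.
have L : s^-1 *: (h (s *: 1 + t) - h t) @[s --> (0:R)^'] --> (l : R).
  apply/cvgrPdist_le => e e0; have [d d0 Hd] := H e e0.
  near=> s.
  have s0 : s != 0 by near: s; exact: nbhs_dnbhs_neq.
  have sd : `|s| < d by near: s; apply: dnbhs0_lt.
  have := Hd (s *: 1 + t); rewrite addrK /= [s *: _]mulr1 => /(_ sd).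
  have -> : h (s + t) - h t - s * l = - s * (l - s^-1 * (h (s + t) - h t)) by field.
  by rewrite normrM normrN [e * _]mulrC ler_pM2l ?normr_gt0.
split; first by apply/cvg_ex; exists l.
exact: cvg_lim L.
Unshelve. all: by end_near.
Qed.

Lemma C1_is_derive T f df t x : C1_map (time_interval T) f df -> 0 < t -> (t%:E < T)%E ->
  is_derive t 1 (f^~ x) (df t x).
Proof.
move=> fC t0 tT; apply: is_derive_eps => e e0.
have tI : time_interval T t by split=> //; exact: ltW.
have [_ H _] := (C1_mapP _ _ _).1 fC; have {H}[d d0 H] := H t tI e e0.
have [d' d'0 Hd'] : exists2 d', 0 < d' & forall s : R, `|s - t| < d' -> (s%:E < T)%E.
  case: T tT {fC tI H} => [r| |] //.
    rewrite lte_fin => tr; exists (r - t) => [|s]; first by rewrite subr_gt0.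
    by move=> /(le_lt_trans (ler_norm _)); rewrite ltrD2r lte_fin.
  by move=> _; exists 1 => // s _; rewrite ltry.
(* The radius keeps [s] inside [[0, T[], so the estimate within the interval becomes a two-sided
   derivative. *)
exists (Num.min (Num.min d d') t) => [|s]; first by rewrite !lt_min d0 d'0.
rewrite !lt_min => /andP[/andP[sd sd'] st]; apply: H => //; split; last exact: Hd'.
by move: st; rewrite distrC => /(le_lt_trans (ler_norm _)) ?; lra.
Qed.

Lemma C1_diff_on T f df t1 x : C1_map (time_interval T) f df -> (t1%:E < T)%E ->
  diff_on (f^~ x) (df^~ x) t1.
Proof.
move=> fC t1T.
have tI s : 0 <= s <= t1 -> time_interval T s.
  by case/andP => s0 st; split=> //; apply: le_lt_trans t1T; rewrite lee_fin.
split.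
  apply/subspace_continuousP => t; rewrite /= in_itv /= => tt1.
  apply/cvgrPdist_le => e e0; have [d d0 H] := C1_continuous fC (tI t tt1) e0.
  apply/within_nearP; exists d => // s; rewrite /= in_itv /= => st sd.
  by rewrite distrC; exact: H (tI s st) sd x.
move=> t /andP[t0 tt1]; apply: C1_is_derive fC _ _ => //.
by apply: lt_trans t1T; rewrite lte_fin.
Qed.

End C1.

(** * Integrals of continuous functions *)

Section Integrals.
Context {R : realType}.
Local Notation mu := (@lebesgue_measure R).
Implicit Types (f g h F : R -> R) (a b c x t A : R).

Lemma intE F f a b : (forall x, is_derive x 1 F (f x)) -> continuous f -> a <= b ->
  \int[mu]_(x in `[a, b]) f x = F b - F a.
Proof.
move=> dF cf ab; have [G [dG ->//]] := ex_primitive cf.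
have H x : is_derive x (1 : R) (G - F) 0.
  by rewrite -(subrr (f x)); exact: (is_deriveB (dG x) (dF x)).
have := is_derive_0_is_cst a b H; rewrite /= !fctE; lra.
Qed.

Lemma int_le f g a b : continuous f -> continuous g ->
  (forall x, a <= x <= b -> f x <= g x) ->
  \int[mu]_(x in `[a, b]) f x <= \int[mu]_(x in `[a, b]) g x.
Proof.
move=> cf cg fg; by apply: le_Rintegral => //; exact: continuous_integrable.
Qed.

Lemma int_cst c a b : a <= b -> \int[mu]_(x in `[a, b]) (fun=> c) x = c * (b - a).
Proof.
move=> ab; rewrite Rintegral_cst //= lebesgue_measure_itv /= lte_fin.
by case: ltrgtP ab => [ab _|//|-> _]; rewrite ?subrr // EFinN -EFinD.
Qed.

Lemma int_norm_le f C a b : a <= b -> continuous f ->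
  (forall x, a <= x <= b -> `|f x| <= C) ->
  `|\int[mu]_(x in `[a, b]) f x| <= C * (b - a).
Proof.
move=> ab cf fC; rewrite -int_cst // ler_norml; apply/andP; split.
  rewrite int_cst // -mulNr -int_cst //; apply: int_le => //; first by move=> ?; exact: cvg_cst.
  by move=> x /fC; rewrite ler_norml => /andP[].
apply: int_le => //; first by move=> ?; exact: cvg_cst.
by move=> x /fC; rewrite ler_norml => /andP[].
Qed.

Lemma int_norm f a b : continuous f ->
  `|\int[mu]_(x in `[a, b]) f x| <= \int[mu]_(x in `[a, b]) `|f x|.
Proof. by move=> cf; apply: le_normr_Rintegral => //; exact: continuous_integrable. Qed.

Lemma int_ge0 f a b : (forall x, 0 <= f x) -> 0 <= \int[mu]_(x in `[a, b]) f x.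
Proof. by move=> f0; apply: Rintegral_ge0. Qed.

Lemma intD f g a b : continuous f -> continuous g ->
  \int[mu]_(x in `[a, b]) (f x + g x) =
  \int[mu]_(x in `[a, b]) f x + \int[mu]_(x in `[a, b]) g x.
Proof. by move=> cf cg; apply: RintegralD => //; exact: continuous_integrable. Qed.

Lemma intB f g a b : continuous f -> continuous g ->
  \int[mu]_(x in `[a, b]) (f x - g x) =
  \int[mu]_(x in `[a, b]) f x - \int[mu]_(x in `[a, b]) g x.
Proof. by move=> cf cg; apply: RintegralB => //; exact: continuous_integrable. Qed.

Lemma intZ c f a b : continuous f ->
  \int[mu]_(x in `[a, b]) (c * f x) = c * \int[mu]_(x in `[a, b]) f x.
Proof. by move=> cf; apply: RintegralZl => //; exact: continuous_integrable. Qed.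

Lemma continuous_shift f c : continuous f -> continuous (fun x => f (x + c)).
Proof.
move=> cf x; apply: (@continuous_comp _ _ _ (fun x => x + c) f); last exact: cf.
by apply: cvgD; [exact: cvg_id|exact: cvg_cst].
Qed.

Lemma is_derive_shift F f c : (forall x, is_derive x 1 F (f x)) ->
  forall x, is_derive x 1 (fun y => F (y + c)) (f (x + c)).
Proof.
move=> dF x; rewrite -[f _]mulr1.
apply: (@is_derive1_comp R F (fun y => y + c)) => //.
rewrite -[X in is_derive _ _ _ X]addr0.
by apply: is_deriveD.
Qed.

Lemma int_shift f a b c : continuous f -> a <= b ->
  \int[mu]_(x in `[a, b]) f (x + c) = \int[mu]_(x in `[a + c, b + c]) f x.
Proof.
move=> cf ab; have [F [dF FE]] := ex_primitive cf.
rewrite (intE (is_derive_shift c dF)) //; last exact: continuous_shift.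
by rewrite FE // lerD2r.
Qed.

(** The difference [F (a + period) - F a] has derivative [0] in [a], by periodicity of [f]. *)
Lemma periodic_primitive f F : periodic f period -> (forall x, is_derive x 1 F (f x)) ->
  forall a, F (a + period) - F a = F period - F 0.
Proof.
move=> pf dF a.
have H x : is_derive x (1 : R) ((fun y => F (y + period)) - F) 0.
  rewrite -(subrr (f (x + period))); apply: (is_deriveB (is_derive_shift period dF x)).
  by rewrite pf; exact: dF.
by have := is_derive_0_is_cst a 0 H; rewrite /= !fctE add0r.
Qed.

Lemma int_periodic_shift f c : continuous_torus f ->
  \int[mu]_(x in `[0, period]) f (x + c) = \int[mu]_(x in `[0, period]) f x.
Proof.
move=> [cf pf]; have P0 := ltW (@period_gt0 R); rewrite int_shift //.
have [F [dF FE]] := ex_primitive cf.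
rewrite !FE //; last by rewrite lerD2r.
by rewrite add0r [period + c]addrC (periodic_primitive pf dF).
Qed.

Lemma int_periods f (n : nat) : continuous_torus f ->
  \int[mu]_(x in `[- (period * n%:R), period * n%:R]) f x =
  (2 * n%:R) * \int[mu]_(x in `[0, period]) f x.
Proof.
move=> [cf pf]; have P0 := ltW (@period_gt0 R).
have [F [dF FE]] := ex_primitive cf.
have P1 := periodic_primitive pf dF.
have nP : 0 <= period * n%:R :> R by rewrite mulr_ge0.
rewrite !FE //; last lra.
elim: n {nP} => [|n IH]; first by rewrite !mulr0 oppr0 mul0r subrr.
rewrite -natr1 mulrDr mulr1.
have := P1 (period * n%:R); have := P1 (- (period * n%:R) - period).
rewrite subrK opprD; nra.
Qed.

(** Bridge between test functions on the line and the mass over one period: a window of half-width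
    [A] lies within finitely many periods on either side of [0]. *)
Lemma int_window f A : continuous_torus f -> (forall x, 0 <= f x) ->
  \int[mu]_(x in `[- A, A]) f x <=
  (2 * (Num.truncn (A / period)).+1%:R) * \int[mu]_(x in `[0, period]) f x.
Proof.
move=> fC f0; have P0 := @period_gt0 R; have [A0|A0] := ltP A 0.
  rewrite set_itv_ge; last by rewrite bnd_simp -ltNge; lra.
  by rewrite Rintegral_set0 !mulr_ge0 // int_ge0.
set n := (Num.truncn _).+1.
have An : A <= period * n%:R by rewrite mulrC -ler_pdivrMr // ltW // truncnS_gt.
rewrite -int_periods //.
have [cf _] := fC.
rewrite (@RintegralC _ _ (- (period * n%:R)) (- A)) //; try lra.
rewrite [X in _ <= _ + X](@RintegralC _ _ (- A) A) //; try lra.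
by have := int_ge0 (- (period * n%:R)) (- A) f0; have := int_ge0 A (period * n%:R) f0; lra.
Qed.

Lemma intT f a b : (forall x, ~~ (a <= x <= b) -> f x = 0) ->
  \int[mu]_x f x = \int[mu]_(x in `[a, b]) f x.
Proof.
move=> f0; rewrite [RHS]Rintegral_mkcond; apply: eq_Rintegral => x _.
rewrite patchE; case: ifPn => // /negP; rewrite inE /= in_itv /= => /negP; exact: f0.
Qed.

Lemma intT_shift f a b c : a <= b -> continuous f -> (forall x, ~~ (a <= x <= b) -> f x = 0) ->
  \int[mu]_x f (x + c) = \int[mu]_x f x.
Proof.
move=> ab cf f0; rewrite (intT f0) (@intT _ (a - c) (b - c)); last first.
  by move=> x xab; apply: f0; rewrite -lerBlDr -[x + c <= b]lerBrDr.
by rewrite int_shift ?subrK // lerD2r.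
Qed.

End Integrals.

(** * The total mass as a function of time *)

Section Mass.
Context {R : realType}.
Local Notation mu := (@lebesgue_measure R).

(** The integral is encoded as a map constant in [x], so that this scalar function of time inherits
    the lemmas on [C1_map]. *)
Lemma C1_int T (f df : R -> R -> R) : C1_map (time_interval T) f df ->
  C1_map (time_interval T) (fun t _ => \int[mu]_(x in `[0, period]) f t x)
    (fun t _ => \int[mu]_(x in `[0, period]) df t x).
Proof.
move=> /C1_mapP[H1 H2 H3]; apply/C1_mapP; have P0 := @period_gt0 R.
have cc (c : R) : continuous_torus (fun _ : R => c) by split=> // ?; exact: cvg_cst.
split=> // t It e e0.
- have [d d0 H] := H2 t It (e / period) (divr_gt0 e0 P0).
  exists d => // s Is sd _.
  have [[c1 _] _] := H1 s Is; have [[c2 _] [c3 _]] := H1 t It.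
  have c4 : continuous (fun x => (s - t) * df t x) by move=> x; apply: cvgM; [exact: cvg_cst|exact: c3].
  rewrite -intZ // -!intB //; last by move=> x; apply: cvgB; [exact: c1|exact: c2].
  apply: (le_trans (int_norm_le (C := e / period * `|s - t|) (ltW P0) _ _)).
  + by move=> x; apply: cvgB; [apply: cvgB; [exact: c1|exact: c2]|exact: c4].
  + by move=> x _; exact: H.
  + by rewrite subr0 mulrAC mulfVK // gt_eqF.
- have [d d0 H] := H3 t It (e / period) (divr_gt0 e0 P0).
  exists d => // s Is sd _.
  have [_ [c1 _]] := H1 s Is; have [_ [c2 _]] := H1 t It.
  rewrite -!intB //.
  apply: (le_trans (int_norm_le (C := e / period) (ltW P0) _ _)).
  + by move=> x; apply: cvgB; [exact: c1|exact: c2].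
  + by move=> x _; exact: H.
  + by rewrite subr0 mulfVK // gt_eqF.
Qed.

End Mass.

(** * Test functions *)

Section TestFun.
Context {R : realType}.
Local Notation mu := (@lebesgue_measure R).
Implicit Types (f g : R -> R) (a b c h x y t A C : R).

Lemma lip_of_derive f g C : (forall x, is_derive x 1 f (g x)) ->
  (forall x, `|g x| <= C) -> forall x y, `|f x - f y| <= C * `|x - y|.
Proof.
move=> df gC; have cf := continuous_of_is_derive df.
have H x y : x <= y -> `|f x - f y| <= C * `|x - y|.
  move=> xy; have [c _ e] := MVT_segment xy (fun z _ => df z) (continuous_subspaceT cf).
  by rewrite distrC e normrM [`|x - y|]distrC ler_wpM2r.
move=> x y; have [xy|xy] := leP x y; first exact: H.
by rewrite distrC [`|x - y|]distrC; exact: H (ltW xy).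
Qed.

Lemma bounded_cc f A : continuous f -> (forall x, A < `|x| -> f x = 0) ->
  exists2 C : R, 0 <= C & forall x, `|f x| <= C.
Proof.
move=> cf f0.
have cnf : continuous (fun x => `|f x|) by move=> x; apply: cvg_norm; exact: cf.
have AA : - `|A| <= `|A| by have := normr_ge0 A; lra.
have [c _ cP] := EVT_max AA (continuous_subspaceT cnf).
exists `|f c| => // x.
have [xA|xA] := leP `|x| `|A|; first by apply: cP; rewrite in_itv /= -ler_norml.
by rewrite f0 ?normr0 // (le_lt_trans (ler_norm _)).
Qed.

(** The function [y => f y - y * f' x] has derivative at most [C * |h|] between [x] and [x + h]. A
    Lipschitz bound on [f'] suffices, so this also covers time primitives that have no second
    derivative. *)
Lemma taylor_of_lip (f f' : R -> R) (C x h : R) : (forall x : R, is_derive x 1 f (f' x)) ->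
  (forall y, `|y - x| <= `|h| -> `|f' y - f' x| <= C * `|y - x|) -> 0 <= C ->
  `|f (x + h) - f x - h * f' x| <= C * h ^+ 2.
Proof.
move=> df l1 C0.
have dk (z : R) : is_derive z 1 (fun y => f y - y * f' x) (f' z - f' x).
  apply: (is_deriveB (df z)).
  have -> : (fun y => y * f' x) = f' x \*: (@id R).
    by apply/funext => y; rewrite mulrC.
  by rewrite -[X in is_derive _ _ _ X]mulr1; exact: is_deriveZ.
have key (a b : R) : a <= b -> (forall z : R, a <= z <= b -> `|z - x| <= `|h|) ->
    `|(f b - b * f' x) - (f a - a * f' x)| <= C * `|h| * (b - a).
  move=> ab zab; have [z + ->] := MVT_segment ab (fun z _ => dk z) (continuous_subspaceT (continuous_of_is_derive dk)).
  rewrite in_itv /= => /zab zh; rewrite normrM [`|b - a|]ger0_norm ?subr_ge0 // ler_wpM2r ?subr_ge0 //.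
  by apply: le_trans (l1 z zh) _; rewrite ler_wpM2l.
have [h0|h0] := leP 0 h.
  rewrite (_ : f (x + h) - f x - _ = (f (x + h) - (x + h) * f' x) - (f x - x * f' x)); last ring.
  apply: (le_trans (key x (x + h) _ _)); first by rewrite lerDl.
    by move=> z /andP[z1 z2]; rewrite !ger0_norm ?subr_ge0 //; lra.
  by rewrite [x + h]addrC addrK ger0_norm // -mulrA -expr2.
rewrite (_ : f (x + h) - f x - _ = - ((f x - x * f' x) - (f (x + h) - (x + h) * f' x))); last ring.
rewrite normrN; apply: (le_trans (key (x + h) x _ _)); first lra.
  by move=> z /andP[z1 z2]; rewrite !ler0_norm ?subr_le0 //; lra.
by rewrite opprD addrA subrr add0r ltr0_norm // -mulrA mulrNN -expr2.
Qed.

(** One radius and one constant carry all that is used of a test function: bounds, Lipschitz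
    constants, Taylor remainder. Being explicit, they let the cost of rescaling to a mollifier be
    tracked. *)
Record test_fun f (f' : R -> R) A C : Prop := TestFun {
  tf_A : 0 < A;
  tf_C : 0 <= C;
  tf_der : forall x, is_derive x 1 f (f' x);
  tf_cont : continuous f;
  tf_cont' : continuous f';
  tf_supp : forall x, A < `|x| -> f x = 0;
  tf_supp' : forall x, A < `|x| -> f' x = 0;
  tf_bd : forall x, `|f x| <= C;
  tf_bd' : forall x, `|f' x| <= C;
  tf_lip : forall x y, `|f x - f y| <= C * `|x - y|;
  tf_lip' : forall x y, `|f' x - f' y| <= C * `|x - y|;
  tf_taylor : forall x h, `|f (x + h) - f x - h * f' x| <= C * h ^+ 2 }.

Lemma derive0_supp f f' A : (forall x, is_derive x 1 f (f' x)) ->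
  (forall x, A < `|x| -> f x = 0) -> forall x, A < `|x| -> f' x = 0.
Proof.
move=> df f0 x xA.
have H : is_derive x 1 f 0.
  apply: near_eq_is_derive (is_derive_cst (0 : R) x 1); near=> y.
  rewrite f0 //; near: y.
  by apply: (cvgr_gt `|x|) => //; exact: norm_continuous.
by have := df x; case: H => _ <-; case=> _ ->.
Unshelve. all: by end_near.
Qed.

Lemma Cc_infty_test_fun f : Cc_infty f -> exists A C, test_fun f (derive1 f) A C.
Proof.
move=> [df /compact_bounded[M [_ HM]]].
have d n x : is_derive x 1 (derive1n n f) (derive1n n.+1 f x).
  by rewrite derive1nS derive1E; apply: DeriveDef => //; exact: df.
pose A : R := `|M| + 1.
have A0 : 0 < A by rewrite ltr_pwDr.
have s0 x : A < `|x| -> f x = 0.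
  move=> Ax; apply/eqP; apply: contraTT (Ax) => fx0; rewrite -leNgt.
  apply: (HM A); last by apply: subset_closure.
  by rewrite /A (le_lt_trans (ler_norm _)) // ltrDl.
have s1 := derive0_supp (d 0%N) s0.
have s2 := derive0_supp (d 1%N) s1.
have c n := continuous_of_is_derive (d n).
have [C0 C00 H0] := bounded_cc (c 0%N) s0.
have [C1 C10 H1] := bounded_cc (c 1%N) s1.
have [C2 C20 H2] := bounded_cc (c 2%N) s2.
pose C : R := C0 + C1 + C2.
have CC : [/\ 0 <= C, C0 <= C, C1 <= C & C2 <= C] by rewrite /C; split; lra.
case: CC => Cge0 CC0 CC1 CC2.
have l0 := lip_of_derive (d 0%N) (fun x => le_trans (H1 x) CC1).
have l1 := lip_of_derive (d 1%N) (fun x => le_trans (H2 x) CC2).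
exists A, C; split => //; first exact: (d 0%N); first exact: (c 0%N).
- exact: (c 1%N).
- by move=> x; exact: le_trans (H0 x) CC0.
- by move=> x; exact: le_trans (H1 x) CC1.
by move=> x h; apply: (taylor_of_lip (d 0%N)) => // y _; exact: l1.
Qed.

End TestFun.

(** * Convolution and the potential *)

Section Convolution.
Context {R : realType}.
Local Notation mu := (@lebesgue_measure R).
Implicit Types (f g k : R -> R) (a b c h x y t A C : R).

Lemma cont_refl f x : continuous f -> continuous (fun y => f (x - y)).
Proof.
move=> cf y; apply: (@continuous_comp _ _ _ (fun y => x - y) f); last exact: cf.
by apply: cvgB; [exact: cvg_cst|exact: cvg_id].
Qed.

Lemma cont_mul f g : continuous f -> continuous g -> continuous (fun x => f x * g x).
Proof. by move=> cf cg x; apply: cvgM; [exact: cf|exact: cg]. Qed.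

Lemma cont_sub f g : continuous f -> continuous g -> continuous (fun x => f x - g x).
Proof. by move=> cf cg x; apply: cvgB; [exact: cf|exact: cg]. Qed.

Lemma cont_add f g : continuous f -> continuous g -> continuous (fun x => f x + g x).
Proof. by move=> cf cg x; apply: cvgD; [exact: cf|exact: cg]. Qed.

Lemma cont_norm f : continuous f -> continuous (fun x => `|f x|).
Proof. by move=> cf x; apply: cvg_norm; exact: cf. Qed.

Lemma cont_cst c : continuous (fun _ : R => c).
Proof. by move=> x; exact: cvg_cst. Qed.

Lemma conv_window g f A x a b : (forall y, A < `|y| -> f y = 0) ->
  a <= x - A -> x + A <= b ->
  convolution g f x = \int[mu]_(y in `[a, b]) (g y * f (x - y)).
Proof.
move=> f0 ax xb; rewrite /convolution; apply: intT => y yab.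
rewrite f0 ?mulr0 //; apply: contraR yab; rewrite -leNgt ler_norml => /andP[h1 h2].
by apply/andP; split; lra.
Qed.

Section fixed.
Variables (f f' : R -> R) (A C : R) (fT : test_fun f f' A C).
Let A0 := tf_A fT.
Let C0 := tf_C fT.

(** The Taylor remainder of [f] is uniform in [y], so the first-order expansion of the convolution
    has an error [O((s - x)^2)] times the integral of [|g|]. The radius [A + 1] gives one window for
    all [s] at distance less than [1] from [x]. *)
Lemma conv_derive g x : continuous g ->
  is_derive x 1 (convolution g f) (convolution g f' x).
Proof.
move=> cg; apply: is_derive_eps => e e0.
pose I := \int[mu]_(y in `[x - (A + 1), x + (A + 1)]) `|g y|.
have I0 : 0 <= I by apply: int_ge0.
have CI : 0 < C * I + 1 by rewrite ltr_wpDl // mulr_ge0.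
exists (Num.min 1 (e / (C * I + 1))) => [|s]; first by rewrite lt_min ltr01 divr_gt0.
rewrite lt_min => /andP[sx1 sxe].
have [s1 s2] : - 1 < s - x /\ s - x < 1 by apply/andP; rewrite -ltr_norml.
rewrite !(conv_window (a := x - (A + 1)) (b := x + (A + 1)) g (tf_supp fT)); try lra.
rewrite (conv_window (a := x - (A + 1)) (b := x + (A + 1)) g (tf_supp' fT)); try lra.
have cf := tf_cont fT; have cf' := tf_cont' fT.
have cM u k : continuous k -> continuous (fun y => g y * k (u - y)).
  by move=> ck; apply: cont_mul => //; exact: cont_refl.
rewrite -intZ -?intB //; try by [apply: cM|apply: cont_sub; apply: cM|
   apply: cont_mul; [exact: cont_cst|exact: cM]].
have cD : continuous (fun y => g y * f (s - y) - g y * f (x - y) - (s - x) * (g y * f' (x - y))).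
  apply: cont_sub; first by apply: cont_sub; exact: cM.
  by apply: cont_mul; [exact: cont_cst|exact: cM].
apply: (le_trans (int_norm _ _ cD)).
apply: (@le_trans _ _ (\int[mu]_(y in `[x - (A + 1), x + (A + 1)]) (C * (s - x) ^+ 2 * `|g y|))).
  apply: int_le; first exact: cont_norm.
    by apply: cont_mul; [exact: cont_cst|exact: cont_norm].
  move=> y _.
  rewrite (_ : _ - _ - _ = (f ((x - y) + (s - x)) - f (x - y) - (s - x) * f' (x - y)) * g y).
    by rewrite normrM ler_wpM2r //; exact: (tf_taylor fT).
  by rewrite (_ : x - y + (s - x) = s - y); ring.
rewrite intZ; last exact: cont_norm.
rewrite -/I -(real_normK (num_real (s - x))) expr2.
rewrite ltr_pdivlMr // in sxe.
rewrite (_ : _ * I = C * I * `|s - x| * `|s - x|); last ring.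
rewrite ler_wpM2r //; apply: le_trans (ltW sxe); rewrite mulrC ler_wpM2l //; lra.
Qed.

End fixed.

Section bounded.
Variables (f : R -> R) (A C : R).
Hypotheses (A0 : 0 < A) (C0 : 0 <= C) (cf : continuous f)
  (f0 : forall x, A < `|x| -> f x = 0) (fC : forall x, `|f x| <= C).

Lemma conv_periodic g : continuous g -> periodic g period -> periodic (convolution g f) period.
Proof.
move=> cg pg x; rewrite /convolution.
rewrite -(@intT_shift R (fun y => g y * f (x + period - y)) (x + period - A) (x + period + A) period).
- by under eq_Rintegral do rewrite pg opprD addrACA subrr addr0 [x + - _]/(_ - _).
- by rewrite lerD2l (ge0_cp (ltW A0)).
- by apply: cont_mul => //; exact: cont_refl.
- move=> y yab; rewrite f0 ?mulr0 //; apply: contraR yab; rewrite -leNgt ler_norml => /andP[h1 h2].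
  by apply/andP; split; lra.
Qed.

Lemma conv_le g x : continuous g ->
  `|convolution g f x| <= C * \int[mu]_(y in `[x - A, x + A]) `|g y|.
Proof.
move=> cg; rewrite (conv_window (a := x - A) (b := x + A) g f0) //.
apply: le_trans (int_norm _ _ _) _.
  by apply: cont_mul => //; exact: cont_refl.
rewrite -intZ; last exact: cont_norm.
apply: int_le.
- by apply: cont_norm; apply: cont_mul => //; exact: cont_refl.
- by apply: cont_mul; [exact: cont_cst|exact: cont_norm].
by move=> y _; rewrite normrM mulrC ler_wpM2r.
Qed.

Lemma conv_lip g1 g2 c x : continuous g1 -> continuous g2 ->
  (forall y, `|g1 y - g2 y| <= c) ->
  `|convolution g1 f x - convolution g2 f x| <= C * (c * (A + A)).
Proof.
move=> c1 c2 g12.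
have -> : convolution g1 f x - convolution g2 f x = convolution (fun y => g1 y - g2 y) f x.
  rewrite !(conv_window (a := x - A) (b := x + A) _ f0) // -intB.
  - by apply: eq_Rintegral => y _; rewrite mulrBl.
  - by apply: cont_mul => //; exact: cont_refl.
  - by apply: cont_mul => //; exact: cont_refl.
apply: le_trans (conv_le _ (cont_sub c1 c2)) _; rewrite ler_wpM2l //.
apply: (@le_trans _ _ (\int[mu]_(y in `[x - A, x + A]) (fun=> c) y)).
  apply: int_le; [exact: cont_norm (cont_sub c1 c2)|exact: cont_cst|].
  by move=> y _.
rewrite int_cst; last by have := A0; lra.
by rewrite (_ : x + A - (x - A) = A + A) //; ring.
Qed.

Lemma conv_continuous g : (forall x y, `|f x - f y| <= C * `|x - y|) ->
  continuous g -> continuous (convolution g f).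
Proof.
move=> lf cg x; have a0 := A0; apply/cvgrPdist_le => e e0.
pose I := \int[mu]_(y in `[x - (A + 1), x + (A + 1)]) `|g y|.
have I0 : 0 <= I by apply: int_ge0.
have CI : 0 < C * I + 1 by rewrite ltr_wpDl // mulr_ge0.
have m0 : 0 < Num.min 1 (e / (C * I + 1)) by rewrite lt_min ltr01 divr_gt0.
near=> s.
have : `|x - s| < Num.min 1 (e / (C * I + 1)).
  by near: s; exact: (nbhsx_ballx x _ m0).
rewrite lt_min => /andP[sx1 sxe].
have [s1 s2] : - 1 < x - s /\ x - s < 1 by apply/andP; rewrite -ltr_norml.
rewrite !(conv_window (a := x - (A + 1)) (b := x + (A + 1)) g f0); try lra.
have cM u : continuous (fun y => g y * f (u - y)).
  by apply: cont_mul => //; exact: cont_refl.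
rewrite -intB; try exact: cM.
apply: le_trans (int_norm _ _ (cont_sub (cM x) (cM s))) _.
apply: (@le_trans _ _ (\int[mu]_(y in `[x - (A + 1), x + (A + 1)]) (C * `|x - s| * `|g y|))).
  apply: int_le; first exact: cont_norm (cont_sub (cM x) (cM s)).
    by apply: cont_mul; [exact: cont_cst|exact: cont_norm].
  move=> y _; rewrite -mulrBr normrM mulrC ler_wpM2r //.
  by apply: le_trans (lf _ _) _; rewrite (_ : x - y - (s - y) = x - s) //; ring.
rewrite intZ; last exact: cont_norm.
rewrite -/I; rewrite ltr_pdivlMr // in sxe.
rewrite mulrAC; have := normr_ge0 (x - s); nra.
Unshelve. all: by end_near.
Qed.

End bounded.
End Convolution.

(** * Logarithm, mollifier and bounds on the force *)

Section Potential.
Context {R : realType}.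
Local Notation mu := (@lebesgue_measure R).
Implicit Types (f g rho : R -> R) (a b c d h x y t eps : R).

(** [ln u - ln v = ln (1 + (u - v) / v)] is at most [(u - v) / v], and [v] is at least [d]. *)
Lemma ln_lip d a b : 0 < d -> d <= a -> d <= b -> `|ln a - ln b| <= `|a - b| / d.
Proof.
move=> d0.
have key u v : d <= u -> d <= v -> ln u - ln v <= `|u - v| / d.
  move=> du dv; have u0 : 0 < u by lra.
  have v0 : 0 < v by lra.
  rewrite -ln_div ?posrE //.
  have -> : u / v = 1 + (u - v) / v by field; lra.
  apply: le_trans (le_ln1Dx _) _.
    rewrite (_ : (u - v) / v = u / v - 1); last by field; lra.
    have : 0 < u / v by rewrite divr_gt0.
    lra.
  apply: (@le_trans _ _ (`|u - v| / v)); first by rewrite ler_pM2r ?invr_gt0 // ler_norm.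
  by rewrite ler_wpM2l // lef_pV2 ?posrE.
move=> da db; rewrite ler_norml; apply/andP; split; last exact: key.
by have := key b a db da; rewrite distrC; lra.
Qed.

Lemma powR_le1 eps p : 0 < eps < 1 -> 0 <= p -> eps `^ p <= 1.
Proof.
move=> /andP[e0 e1] p0; rewrite -(powRr0 eps); apply: ger_powR => //.
by rewrite e0 ltW.
Qed.

Lemma powR_ge1 eps p : 0 < eps < 1 -> 0 <= p -> 1 <= eps `^ (- p).
Proof.
move=> e01 p0; rewrite powRN invf_ge1 ?powR_gt0 //; last by case/andP: e01.
exact: powR_le1.
Qed.

Definition log_density (N eps : R) rho y := ln (rho y + eps `^ N).

Lemma log_density_torus N eps rho : 0 < eps -> continuous_torus rho -> (forall x, 0 <= rho x) ->
  continuous_torus (log_density N eps rho).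
Proof.
move=> e0 [cr pr] r0; split; last by move=> x; rewrite /log_density pr.
move=> x; apply: (@continuous_comp _ _ _ (fun x => rho x + eps `^ N) (@ln R)).
  by apply: cont_add => //; exact: cont_cst.
by apply: continuous_ln; rewrite ltr_wpDl // powR_gt0.
Qed.

(* [- ln eps = p^-1 ln (eps^-p) <= p^-1 eps^-p]. *)
Lemma log_density_bound N eps rho p x : 0 < eps < 1 -> 0 < N -> 0 < p -> 0 <= rho x ->
  `|log_density N eps rho x| <= rho x + (1 + N / p) * eps `^ (- p).
Proof.
move=> e01 N0 p0 r0; have /andP[e0 e1] := e01.
have eN : 0 < eps `^ N by rewrite powR_gt0.
have eN1 := powR_le1 e01 (ltW N0); have ep1 := powR_ge1 e01 (ltW p0).
have Np : 0 <= N / p by rewrite divr_ge0 // ltW.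
rewrite ler_norml /log_density; apply/andP; split; last first.
  rewrite -[rho x + eps `^ N](subrK 1) [_ - 1 + 1]addrC.
  by apply: le_trans (le_ln1Dx _) _; nra.
apply: (@le_trans _ _ (ln (eps `^ N))); last by rewrite ler_ln ?posrE ?ltr_wpDl // lerDr.
have : ln (eps `^ (- p)) <= eps `^ (- p).
  rewrite -[X in ln X](subrK 1) [_ - 1 + 1]addrC.
  by apply: le_trans (le_ln1Dx _) _; lra.
rewrite !ln_powR => H.
have -> : N * ln eps = - (N / p * (- p * ln eps)) by field; lra.
have := ler_wpM2l Np H; nra.
Qed.

Variables (phi : R -> R) (A C : R) (fT : test_fun phi (derive1 phi) A C).

Definition dmollifier m x := m^-1 ^+ 2 * derive1 phi (x / m).

Lemma mollifier_supp m x : 0 < m -> A * m < `|x| -> mollifier phi m x = 0 /\ dmollifier m x = 0.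
Proof.
move=> m0 Ax; have xA : A < `|x / m| by rewrite normrM normfV (gtr0_norm m0) ltr_pdivlMr.
by rewrite /mollifier /dmollifier (tf_supp fT) ?(tf_supp' fT) ?mulr0.
Qed.

Lemma is_derive_mollifier m x : 0 < m -> is_derive x 1 (mollifier phi m) (dmollifier m x).
Proof.
move=> m0; rewrite /mollifier /dmollifier expr2 -mulrA.
apply: is_deriveZ; rewrite mulrC.
apply: (@is_derive1_comp R phi (fun x => x / m)); first exact: (tf_der fT).
have -> : (fun x => x / m) = m^-1 \*: (@id R) by apply/funext => y; rewrite mulrC.
by rewrite -[X in is_derive _ _ _ X]mulr1; exact: is_deriveZ.
Qed.

Lemma dmollifier_bound m x : 0 < m -> `|dmollifier m x| <= m^-1 ^+ 2 * C.
Proof.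
move=> m0; have i0 : 0 <= m^-1 ^+ 2 by rewrite exprn_ge0 // invr_ge0 ltW.
by rewrite normrM ger0_norm // ler_wpM2l //; exact: (tf_bd' fT).
Qed.

Lemma continuous_scale (f : R -> R) c d : continuous f -> continuous (fun x => c * f (x / d)).
Proof.
move=> cf; apply: cont_mul; first exact: cont_cst.
move=> x; apply: (@continuous_comp _ _ _ (fun x => x / d) f); last exact: cf.
by apply: cvgM; [exact: cvg_id|exact: cvg_cst].
Qed.

(** The prefactor and each derivative cost a factor [m^-1]; as [m <= 1], the [m^-3] of the
    second-order quantities dominates all. The radius [A] is crude, since the support shrinks with
    [m], but independent of [m]. *)
Lemma mollifier_test m : 0 < m <= 1 ->
  test_fun (mollifier phi m) (dmollifier m) A (m^-1 ^+ 3 * C).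
Proof.
move=> /andP[m0 m1]; have A0 := tf_A fT; have C0 := tf_C fT.
have i1 : 1 <= m^-1 by rewrite invf_ge1.
have i0 : 0 <= m^-1 by lra.
have i12 : m^-1 <= m^-1 ^+ 3 by rewrite -{1}(expr1 m^-1) ler_weXn2l.
have i23 : m^-1 ^+ 2 <= m^-1 ^+ 3 by rewrite ler_weXn2l.
have i3 : 0 <= m^-1 ^+ 3 by rewrite exprn_ge0.
have i2 : 0 <= m^-1 ^+ 2 by rewrite exprn_ge0.
have nm : `|m^-1| = m^-1 by rewrite ger0_norm.
have AA x : A < `|x| -> A * m < `|x|.
  by apply: le_lt_trans; rewrite ler_piMr // ltW.
split=> //.
- by rewrite mulr_ge0.
- by move=> x; exact: is_derive_mollifier.
- by apply: continuous_scale; exact: (tf_cont fT).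
- by apply: continuous_scale; exact: (tf_cont' fT).
- by move=> x /AA /(mollifier_supp m0)[].
- by move=> x /AA /(mollifier_supp m0)[].
- move=> x; rewrite normrM nm; apply: ler_pM => //; exact: (tf_bd fT).
- move=> x; apply: le_trans (dmollifier_bound _ m0) _; exact: ler_wpM2r.
- move=> x y; rewrite -mulrBr normrM nm.
  apply: (@le_trans _ _ (m^-1 * (C * `|x / m - y / m|))).
    by rewrite ler_wpM2l //; exact: (tf_lip fT).
  rewrite -mulrBl normrM nm (_ : _ * (C * _) = m^-1 ^+ 2 * C * `|x - y|); last ring.
  by rewrite ler_wpM2r // ler_wpM2r.
- move=> x y; rewrite -mulrBr normrM ger0_norm //.
  apply: (@le_trans _ _ (m^-1 ^+ 2 * (C * `|x / m - y / m|))).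
    by rewrite ler_wpM2l //; exact: (tf_lip' fT).
  by rewrite -mulrBl normrM nm (_ : _ * (C * _) = m^-1 ^+ 3 * C * `|x - y|) //; ring.
- move=> x h.
  have -> : mollifier phi m (x + h) - mollifier phi m x - h * dmollifier m x =
     m^-1 * (phi (x / m + h / m) - phi (x / m) - h / m * derive1 phi (x / m)).
    by rewrite /mollifier /dmollifier [(x + h) / m]mulrDl; ring.
  rewrite normrM nm.
  apply: le_trans (ler_wpM2l i0 (tf_taylor fT _ _)) _.
  by rewrite (_ : _ * (C * _) = m^-1 ^+ 3 * C * h ^+ 2) //; ring.
Qed.

Variables (K alpha N : R).
Hypotheses (K0 : 0 <= K) (alpha0 : 0 < alpha) (N0 : 0 < N).

Definition dpotential eps rho x :=
  K * convolution (log_density N eps rho) (dmollifier (eps `^ alpha)) x.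

Lemma powR_alpha eps : 0 < eps < 1 -> 0 < eps `^ alpha <= 1.
Proof.
move=> e01; have /andP[e0 e1] := e01.
by rewrite powR_gt0 //= powR_le1 // ltW.
Qed.

Lemma is_derive_potential eps rho x : 0 < eps < 1 -> continuous_torus rho -> (forall x, 0 <= rho x) ->
  is_derive x 1 (potential K alpha N phi eps rho) (dpotential eps rho x).
Proof.
move=> e01 cr r0; have [cg _] := log_density_torus N (proj1 (andP e01)) cr r0.
by apply: is_deriveZ; exact: (conv_derive (mollifier_test (powR_alpha e01)) x cg).
Qed.

Lemma derive1_potential eps rho : 0 < eps < 1 -> continuous_torus rho -> (forall x, 0 <= rho x) ->
  derive1 (potential K alpha N phi eps rho) = dpotential eps rho.
Proof.
by move=> e01 cr r0; apply/funext => x; rewrite derive1E; case: (is_derive_potential x e01 cr r0).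
Qed.

Lemma dpotential_torus eps rho : 0 < eps < 1 -> continuous_torus rho -> (forall x, 0 <= rho x) ->
  continuous_torus (dpotential eps rho).
Proof.
move=> e01 cr r0; have [cg pg] := log_density_torus N (proj1 (andP e01)) cr r0.
have T := mollifier_test (powR_alpha e01); split.
  apply: cont_mul; first exact: cont_cst.
  exact: (conv_continuous (tf_A T) (tf_C T) (tf_cont' T) (tf_supp' T) (tf_lip' T)).
by move=> x; rewrite /dpotential (conv_periodic (tf_A T) (tf_cont' T) (tf_supp' T) cg pg).
Qed.

(** The floor [eps^N] under the logarithm makes it Lipschitz with constant [eps^(-N)]. That [L]
    blows up as [eps] tends to [0] is harmless: it serves Picard iteration and uniqueness at fixed
    [eps]. *)
Lemma dpotential_lip eps : 0 < eps < 1 -> exists2 L, 0 <= L &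
  forall r1 r2 c, continuous_torus r1 -> continuous_torus r2 ->
  (forall x, 0 <= r1 x) -> (forall x, 0 <= r2 x) -> 0 <= c -> (forall x, `|r1 x - r2 x| <= c) ->
  forall x, `|dpotential eps r1 x - dpotential eps r2 x| <= L * c.
Proof.
move=> e01; have e0 := proj1 (andP e01).
have T := mollifier_test (powR_alpha e01).
set D := _ * C in T.
have eN : 0 < eps `^ N by rewrite powR_gt0.
have k0 := K0; have A0 := tf_A T; have D0 := tf_C T.
exists (K * (D * (A + A) / eps `^ N)).
  rewrite mulr_ge0 // divr_ge0 ?(ltW eN) // mulr_ge0 //; lra.
move=> r1 r2 c c1 c2 r10 r20 c0 r12 x.
have [g1 _] := log_density_torus N e0 c1 r10.
have [g2 _] := log_density_torus N e0 c2 r20.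
rewrite /dpotential -mulrBr normrM (ger0_norm k0) -[leRHS]mulrA ler_wpM2l //.
have H y : `|log_density N eps r1 y - log_density N eps r2 y| <= c / eps `^ N.
  apply: le_trans (ln_lip eN _ _) _; rewrite ?lerDr //.
  by rewrite opprD addrACA subrr addr0 ler_wpM2r // invr_ge0 ltW.
apply: le_trans (conv_lip A0 D0 (tf_cont' T) (tf_supp' T) (tf_bd' T) x g1 g2 H) _.
by rewrite (_ : _ * (_ * _) = D * (A + A) / eps `^ N * c) //; ring.
Qed.

Lemma dpotential_bounded eps b : 0 < eps < 1 -> exists2 B, 0 <= B &
  forall rho, continuous_torus rho -> (forall x, 0 <= rho x <= b) ->
  forall x, `|dpotential eps rho x| <= B.
Proof.
move=> e01; have [L L0 HL] := dpotential_lip e01.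
have c0 : continuous_torus (fun _ : R => 0 : R) by split=> // ?; exact: cvg_cst.
have [B B0 HB] := continuous_torus_bounded (dpotential_torus e01 c0 (fun _ => lexx _)).
exists (L * `|b| + B) => [|rho cr rb x]; first by rewrite addr_ge0 // mulr_ge0.
rewrite -[dpotential eps rho x](subrK (dpotential eps (fun=> 0) x)).
apply: le_trans (ler_normD _ _) _; apply: lerD; last exact: HB.
apply: HL => // y; first by case/andP: (rb y).
case/andP: (rb y) => r0 rb'; rewrite subr0 ger0_norm //.
exact: le_trans rb' (ler_norm _).
Qed.

(** The derivative of the mollifier is [O(eps^(-2 alpha))], and the integral of the logarithm over a
    window is controlled by the mass plus [O(eps^(-p))]. With [p = alpha / 2] the total exponent
    [5 alpha / 2] stays below [3 alpha]. As [G] does not depend on [eps], the estimate survives the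
    limit. *)
Lemma dpotential_mass : exists2 G, 0 <= G &
  forall eps rho M, 0 < eps < 1 -> continuous_torus rho -> (forall x, 0 <= rho x) ->
  \int[mu]_(x in `[0, period]) rho x <= M ->
  forall x, `|dpotential eps rho x| <= G * (1 + M) * eps `^ (- (3 * alpha)).
Proof.
have k0 := K0; have A0 := tf_A fT; have C0 := tf_C fT; have n0 := N0; have a0 := alpha0.
pose n : R := 2 * (Num.truncn (A / period)).+1%:R.
pose p := alpha / 2; have p0 : 0 < p by rewrite divr_gt0.
pose q := 1 + N / p; have q0 : 0 <= q by rewrite addr_ge0 // divr_ge0 // ltW.
have n00 : 0 <= n by rewrite mulr_ge0.
exists (K * (C * (n + (q * (A + A))))).
  by rewrite !mulr_ge0 // addr_ge0 // mulr_ge0 //; lra.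
move=> eps rho M e01 cr r0 rM x.
have e0 := proj1 (andP e01); have m01 := powR_alpha e01.
set m := eps `^ alpha in m01; have /andP[m0 m1] := m01.
have T := mollifier_test m01.
have [cg _] := log_density_torus N e0 cr r0.
rewrite normrM (ger0_norm k0) -!mulrA ler_wpM2l //.
have D0 : 0 <= m^-1 ^+ 2 * C by rewrite mulr_ge0 // exprn_ge0 // invr_ge0 ltW.
have H := conv_le (tf_cont' T) (tf_supp' T) (fun y => dmollifier_bound y m0) x cg.
apply: (le_trans H) => {H}.
set E := eps `^ (- p).
have E1 : 1 <= E by apply: powR_ge1 => //; exact: ltW.
have c1 : continuous (fun y => rho (y + x)) by apply: continuous_shift; case: cr.
have c1T : continuous_torus (fun y => rho (y + x)).
  by split=> // y; rewrite addrAC; case: cr => _ ->.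
have M0 : 0 <= M by apply: le_trans rM; exact: int_ge0.
have I1 : \int[mu]_(y in `[x - A, x + A]) `|log_density N eps rho y| <= (n + q * (A + A)) * ((1 + M) * E).
  apply: (@le_trans _ _ (\int[mu]_(y in `[x - A, x + A]) (rho y + (fun=> q * E) y))).
    apply: int_le; first exact: cont_norm.
      by apply: cont_add; [case: cr|exact: cont_cst].
    by move=> y _; exact: log_density_bound.
  rewrite intD; [|by case: cr|exact: cont_cst].
  rewrite int_cst; last lra.
  rewrite (_ : x + A - (x - A) = A + A); last ring.
  have -> : \int[mu]_(y in `[x - A, x + A]) rho y = \int[mu]_(y in `[- A, A]) rho (y + x).
    rewrite int_shift; [|by case: cr|lra].
    by rewrite [- A + x]addrC [A + x]addrC.
  have := int_window A c1T (fun y => r0 _).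
  rewrite int_periodic_shift // -/n => h.
  have h2 : n * \int[mu]_(x0 in `[0, period]) rho x0 <= n * M by rewrite ler_wpM2l.
  have E2 : n * M <= n * ((1 + M) * E) by rewrite ler_wpM2l //; nra.
  have E3 : 0 <= q * (A + A) by rewrite mulr_ge0 //; lra.
  have E4 : q * (A + A) * E <= q * (A + A) * ((1 + M) * E) by rewrite ler_wpM2l //; nra.
  rewrite [leRHS]mulrDl; apply: lerD; first exact: le_trans h (le_trans h2 E2).
  by rewrite -mulrA [E * _]mulrC mulrA.
apply: le_trans (ler_wpM2l D0 I1) _.
have -> : m^-1 ^+ 2 * C * ((n + q * (A + A)) * ((1 + M) * E)) =
  C * ((n + q * (A + A)) * ((1 + M) * (m^-1 ^+ 2 * E))) by ring.
rewrite ler_wpM2l // ler_wpM2l //; first by rewrite addr_ge0 // mulr_ge0 //; lra.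
rewrite ler_wpM2l //; first lra.
rewrite /m /E -powRN -powR_mulrn ?powR_ge0 // -powRrM -powRD; last first.
  by apply/implyP => _; rewrite gt_eqF.
apply: ger_powR; last by rewrite /p; lra.
by case/andP: e01 => -> /ltW ->.
Qed.

End Potential.

(** * Global solutions of Lipschitz differential equations *)

Section Picard.
Context {R : realType}.
Local Notation mu := (@lebesgue_measure R).

Lemma maxr_lip (a b c : R) : `|Num.max a c - Num.max b c| <= `|a - b|.
Proof.
have := ler_norm (a - b); have := ler_norm (b - a); rewrite distrC ler_norml => h1 h2.
by rewrite /Num.max; case: ltrP => h3; case: ltrP => h4; apply/andP; split; lra.
Qed.

Lemma minr_lip (a b c : R) : `|Num.min a c - Num.min b c| <= `|a - b|.
Proof.
have := ler_norm (a - b); have := ler_norm (b - a); rewrite distrC ler_norml => h1 h2.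
by rewrite /Num.min; case: ltrP => h3; case: ltrP => h4; apply/andP; split; lra.
Qed.

(** The intervals of radius [2 * c * 2^-n] around [u n] are nested; the limit is the supremum of
    their left ends. The explicit rate makes pointwise limits uniform without a complete function
    space. *)
Lemma geometric_limit (u : nat -> R) (c : R) :
  (forall n, `|u n.+1 - u n| <= c * 2^-1 ^+ n) ->
  exists l : R, forall n, `|u n - l| <= 2 * c * 2^-1 ^+ n.
Proof.
move=> uc.
have c0 : 0 <= c by have := le_trans (normr_ge0 _) (uc 0%N); rewrite expr0 mulr1.
have h n : 2^-1 ^+ n.+1 = 2^-1 ^+ n / 2 :> R by rewrite exprSr.
have h0 n : 0 <= 2^-1 ^+ n :> R by rewrite exprn_ge0.
pose a n := u n - 2 * c * 2^-1 ^+ n; pose b n := u n + 2 * c * 2^-1 ^+ n.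
have step n : a n <= a n.+1 /\ b n.+1 <= b n.
  by have := uc n; rewrite ler_norml /a /b h => /andP[]; split; nra.
have am : {homo a : m n / (m <= n)%N >-> m <= n}.
  by apply: homo_leq => [//|x y z|n]; [exact: le_trans|case: (step n)].
have bm : {homo b : m n / (m <= n)%N >-> n <= m}.
  apply: (homo_leq (r := fun x y => y <= x)) => [//|x y z xy yz|n]; last by case: (step n).
  exact: le_trans yz xy.
have ab m n : a m <= b n.
  have aM k : a k <= b k by have := h0 k; rewrite /a /b; nra.
  by apply: le_trans (am _ _ (leq_maxl m n)) (le_trans (aM _) (bm _ _ (leq_maxr m n))).
exists (sup (range a)) => n.
have ha : has_sup (range a).
  by split; [exists (a 0%N); exists 0%N|exists (b 0%N) => _ [k _ <-]; exact: ab].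
have h1 : a n <= sup (range a) by apply: sup_upper_bound => //; exists n.
have h2 : sup (range a) <= b n by apply: ge_sup; [case: ha|move=> _ [k _ <-]; exact: ab].
by rewrite ler_norml; move: h1 h2; rewrite /a /b => h1 h2; apply/andP; split; lra.
Qed.

Lemma continuous_of_lip (f : R -> R) (C : R) :
  (forall x y, `|f x - f y| <= C * `|x - y|) -> continuous f.
Proof.
move=> fl x; apply/cvgrPdist_le => e e0.
have C0 : 0 < `|C| + 1 by rewrite ltr_wpDl.
near=> y; apply: le_trans (fl x y) _.
have : `|x - y| < e / (`|C| + 1).
  by near: y; apply: (nbhsx_ballx x (e / (`|C| + 1))); rewrite divr_gt0.
rewrite ltr_pdivlMr // mulrC; have := ler_norm C; have := normr_ge0 (x - y); nra.
Unshelve. all: by end_near.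
Qed.

Variables (I : Type) (S : (I -> R) -> Prop) (F : (I -> R) -> I -> R) (B L : R).
Hypotheses (B0 : 0 <= B) (L0 : 0 <= L).
Hypothesis SF : forall w, S w -> S (F w).
Hypothesis FB : forall w i, S w -> `|F w i| <= B.
Hypothesis FL : forall v w c, S v -> S w -> 0 <= c -> (forall i, `|v i - w i| <= c) ->
  forall i, `|F v i - F w i| <= L * c.
Hypothesis Slim : forall w, (forall e, 0 < e -> exists2 v, S v & forall i, `|v i - w i| <= e) -> S w.
Hypothesis Sint : forall (w : I -> R) (G : R -> I -> R) (C t : R), S w -> 0 <= t ->
  (forall s, S (G s)) -> (forall s s' i, `|G s i - G s' i| <= C * `|s - s'|) ->
  (forall s i, `|G s i| <= B) -> S (fun i => w i + \int[mu]_(s in `[0, t]) G s i).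

(** States are functions on an index set [I] satisfying [S]; [Slim] and [Sint] express that the
    state space is closed under uniform limits and under integration in time. The quadratic
    remainder, valid up to [t = 0], contains the one-sided derivative. *)
Theorem picard (w0 : I -> R) : S w0 -> exists w : R -> I -> R,
  [/\ w 0 = w0, forall t, 0 <= t -> S (w t) &
    forall s t, 0 <= s -> 0 <= t -> forall i, `|w s i - w t i| <= B * `|s - t| /\
      `|w s i - w t i - (s - t) * F (w t) i| <= L * B * (s - t) ^+ 2].
Proof.
move=> Sw0; have b0 := B0; have l0' := L0.
pose inv (w : R -> I -> R) := (forall t, 0 <= t -> S (w t)) /\
  (forall s t, 0 <= s -> 0 <= t -> forall i, `|w s i - w t i| <= B * `|s - t|).
(* Time is clamped at [0] so that the integrand is Lipschitz on the whole line and has a global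
   primitive. *)
pose G (w : R -> I -> R) (s : R) : I -> R := F (w (Num.max s 0)).
pose T (w : R -> I -> R) (t : R) (i : I) := w0 i + \int[mu]_(s in `[0, t]) G w s i.
have m0 (s : R) : 0 <= Num.max s 0 by rewrite le_max lexx orbT.
have mE (s : R) : 0 <= s -> Num.max s 0 = s by move=> s0; rewrite max_l.
have mlip (s t : R) : `|Num.max s 0 - Num.max t 0| <= `|s - t|. by exact: maxr_lip.
have GS w : inv w -> forall s, S (G w s) by move=> [wS _] s; exact: SF (wS _ (m0 s)).
have Glip w : inv w -> forall s s' i, `|G w s i - G w s' i| <= L * B * `|s - s'|.
  move=> [wS wl] s s' i; rewrite -mulrA; apply: FL; rewrite ?mulr_ge0 //; try exact: wS.
  move=> j; apply: le_trans (wl _ _ (m0 s) (m0 s') j) _; exact: ler_wpM2l.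
have GB w : inv w -> forall s i, `|G w s i| <= B by move=> [wS _] s i; exact: FB (wS _ (m0 s)).
have Gc w : inv w -> forall i, continuous (G w ^~ i).
  by move=> iw i; apply: (@continuous_of_lip _ (L * B)) => s t; exact: Glip.
have TP w : inv w -> forall i, exists2 P : R -> R, (forall s : R, is_derive s 1 P (G w s i)) &
    P 0 = 0 /\ (forall t, 0 <= t -> T w t i = w0 i + P t).
  move=> iw i; have [P [dP PE]] := ex_primitive (Gc w iw i).
  exists (fun s => P s - P 0); last by rewrite subrr; split=> // t t0; rewrite /T PE.
  move=> s; rewrite -[G w s i]subr0; exact: (is_deriveB (dP s) (is_derive_cst (P 0) s 1)).
have Tinv w : inv w -> inv (T w).
  move=> iw; split=> [t t0|s t s0 t0 i].
    by apply: (Sint Sw0 t0 (GS w iw) (Glip w iw)); exact: GB.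
  have [P dP [_ PE]] := TP w iw i.
  rewrite !PE // (_ : _ - _ = P s - P t); last ring.
  by apply: (lip_of_derive dP) => r; exact: GB.
(* Weight of the contraction: [L / l <= 1 / 2], so one iteration halves a bound of the form
   [D * expR (l * t)]. *)
pose l : R := 2 * L + 1; have l0 : 0 < l by rewrite /l; lra.
have ctr w v D : inv w -> inv v -> 0 <= D ->
   (forall t i, 0 <= t -> `|w t i - v t i| <= D * expR (l * t)) ->
   forall t i, 0 <= t -> `|T w t i - T v t i| <= D / 2 * expR (l * t).
  move=> iw iv D0 wv t i t0.
  have [P dP [P0 PE]] := TP w iw i; have [Q dQ [Q0 QE]] := TP v iv i.
  rewrite PE // QE // (_ : _ - _ = P t - Q t); last ring.
  have Gwv s : 0 <= s -> `|G w s i - G v s i| <= L * (D * expR (l * s)).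
    move=> s0; rewrite /G mE //; apply: FL; rewrite ?mulr_ge0 ?expR_ge0 //.
    - by case: iw => wS _; exact: wS.
    - by case: iv => vS _; exact: vS.
    by move=> j; exact: wv.
  have dE := diff_onZ (D / 2) (diff_on_expR l t).
  have dPQ := diff_onD (diff_on_all t dP) (diff_onZ (-1) (diff_on_all t dQ)).
  have dQP := diff_onD (diff_on_all t dQ) (diff_onZ (-1) (diff_on_all t dP)).
  have DL s : L * (D * expR (l * s)) <= D / 2 * (l * expR (l * s)).
    by have := mulr_ge0 D0 (expR_ge0 (l * s)); rewrite /l; lra.
  rewrite ler_norml; apply/andP; split.
    have := diff_on_ge0 t0 (diff_onD dE dPQ); rewrite /= P0 Q0 mulr0 expR0 => H.
    suff : 0 <= D / 2 * expR (l * t) + (P t + -1 * Q t) by lra.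
    apply: H => [|s /andP[s0 _]]; first lra.
    have := Gwv s (ltW s0); have := DL s; rewrite ler_norml => h1 /andP[h2 h3]; lra.
  have := diff_on_ge0 t0 (diff_onD dE dQP); rewrite /= P0 Q0 mulr0 expR0 => H.
  suff : 0 <= D / 2 * expR (l * t) + (Q t + -1 * P t) by lra.
  apply: H => [|s /andP[s0 _]]; first lra.
  have := Gwv s (ltW s0); have := DL s; rewrite ler_norml => h1 /andP[h2 h3]; lra.
pose W n := iter n T (fun _ => w0).
have WI n : inv (W n).
  elim: n => [|n IH]; last exact: Tinv.
  split=> // s t _ _ i; rewrite subrr normr0 mulr_ge0 //.
have hn n : 0 <= 2^-1 ^+ n :> R by rewrite exprn_ge0.
have WC n : forall t i, 0 <= t -> `|W n.+1 t i - W n t i| <= B * 2^-1 ^+ n * expR (l * t).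
  elim: n => [|n IH] t i t0.
    have [P dP [P0 PE]] := TP (W 0%N) (WI 0%N) i.
    rewrite expr0 mulr1 [W 1 t i]PE // /= addrAC subrr add0r.
    have := lip_of_derive dP (fun s => GB _ (WI 0%N) s i) t 0.
    rewrite P0 !subr0 => /le_trans; apply; rewrite ler_wpM2l // ger0_norm //.
    have := expR_ge1Dx (l * t); rewrite /l; nra.
  by rewrite exprSr mulrA; exact: (ctr _ _ _ (WI n.+1) (WI n) (mulr_ge0 b0 (hn n)) IH).
(* The value at negative times is arbitrary, here [0]: the iterates are controlled for [t >= 0]
   only. *)
have lim (p : R * I) : exists x, 0 <= p.1 -> forall n,
    `|W n p.1 p.2 - x| <= 2 * B * expR (l * p.1) * 2^-1 ^+ n.
  case: p => t i /=; have [t0|t0] := leP 0 t; last by exists 0.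
  have [|x Hx] := @geometric_limit (fun n => W n t i) (B * expR (l * t)).
    by move=> n; rewrite mulrAC; exact: WC.
  by exists x => _ n; rewrite -[2 * B * _]mulrA.
have [f fP] := choice lim.
pose w t i := f (t, i).
have wlim t i n : 0 <= t -> `|W n t i - w t i| <= 2 * B * expR (l * t) * 2^-1 ^+ n.
  by move=> t0; exact: (fP (t, i) t0 n).
have squeeze (a b c : R) : (forall n, a <= b + c * 2^-1 ^+ n) -> a <= b.
  move=> H; apply/ler_addgt0Pr => e e0; have [n Hn] := small_geometric c e0.
  by apply: le_trans (H n) _; rewrite lerD2l ltW.
have wI : inv w.
  split=> [t t0|s t s0 t0 i].
    apply: Slim => e e0; have [n Hn] := small_geometric (2 * B * expR (l * t)) e0.
    exists (W n t); first exact: (WI n).1.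
    by move=> i; apply: le_trans (wlim t i n t0) (ltW Hn).
  apply: (squeeze _ _ (2 * B * expR (l * s) + 2 * B * expR (l * t))) => n.
  have h1 := wlim s i n s0; have h2 := wlim t i n t0; have h3 := (WI n).2 s t s0 t0 i.
  rewrite mulrDl; rewrite distrC in h1.
  rewrite (_ : w s i - w t i = (W n s i - W n t i) + ((w s i - W n s i) + (W n t i - w t i))); last ring.
  apply: le_trans (ler_normD _ _) _; apply: lerD => //.
  by apply: le_trans (ler_normD _ _) _; apply: lerD.
have wT t i : 0 <= t -> w t i = T w t i.
  move=> t0; apply/eqP; rewrite -subr_eq0 -normr_le0.
  apply: (squeeze _ _ (2 * (2 * B * expR (l * t)))) => n; rewrite add0r.
  rewrite (_ : w t i - T w t i = (T (W n) t i - T w t i) - (W n.+1 t i - w t i)); last by rewrite /W /=; ring.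
  apply: le_trans (ler_normB _ _) _.
  have h1 := wlim t i n.+1 t0.
  have h2 : `|T (W n) t i - T w t i| <= 2 * B * 2^-1 ^+ n / 2 * expR (l * t).
    apply: (ctr _ _ _ (WI n) wI) => //; first by rewrite !mulr_ge0.
    by move=> s j s0; rewrite mulrAC; exact: wlim.
  have := mulr_ge0 (mulr_ge0 b0 (hn n)) (expR_ge0 (l * t)).
  rewrite exprSr in h1; lra.
exists w; split.
- apply/funext => i; rewrite wT // /T set_itv1 Rintegral_set1 addr0 //.
- exact: wI.1.
move=> s t s0 t0 i; split; first exact: wI.2.
have [P dP [_ PE]] := TP w wI i.
have -> : w s i - w t i = P s - P t by rewrite !wT // !PE //; ring.
have := @taylor_of_lip _ P _ (L * B) t (s - t) dP (fun y _ => Glip w wI y t i) (mulr_ge0 l0' b0).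
by rewrite [t + _]addrC subrK /G mE.
Qed.

End Picard.

(** * Upwind fluxes and truncation *)

Section Flux.
Context {R : realType}.
Implicit Types (b c e eps U V x y : R) (r m : R -> R).

(** Positive part, negative part and modulus all have this property, so the three fluxes of the
    scheme are estimated at once. *)
Definition lip1 (th : R -> R) := th 0 = 0 /\ forall v w, `|th v - th w| <= `|v - w|.

Lemma lip1_norm th v : lip1 th -> `|th v| <= `|v|.
Proof. by move=> [th0 thl]; have := thl v 0; rewrite th0 !subr0. Qed.

Lemma lip1_pos : lip1 (fun v => Num.max v 0).
Proof. by split=> [|v w]; [rewrite maxxx|exact: maxr_lip]. Qed.

Lemma lip1_neg : lip1 (fun v => Num.max (- v) 0).
Proof.
split=> [|v w]; first by rewrite oppr0 maxxx.
by apply: le_trans (maxr_lip _ _ _) _; rewrite -opprD normrN.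
Qed.

Lemma lip1_abs : lip1 (fun v => `|v|).
Proof. by split=> [|v w]; [rewrite normr0|exact: ler_dist_dist]. Qed.

Section pointwise.
Variables (U r1 m1 r2 m2 : R).
Hypotheses (U0 : 0 <= U) (r10 : 0 <= r1) (r20 : 0 <= r2)
  (m1U : `|m1| <= U * r1) (m2U : `|m2| <= U * r2).

(** Valid at vacuum too: for [r = 0] the cone forces [m = 0], and the quotient takes the default
    value [0]. *)
Lemma quot_bound (r m : R) : 0 <= r -> `|m| <= U * r -> `|m / r| <= U /\ m = r * (m / r).
Proof.
move=> r0 mU; have [rz|rnz] := eqVneq r 0.
  move: mU; rewrite rz mulr0 normr_le0 => /eqP ->; rewrite mul0r normr0 mul0r; split=> //.
have rp : 0 < r by rewrite lt_neqAle eq_sym rnz.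
split; last by field.
by rewrite normrM normfV (gtr0_norm rp) ler_pdivrMr.
Qed.

(** The velocity is not Lipschitz near vacuum, but its density-weighted difference is: with [v1],
    [v2] the quotients, [r2 * (v1 - v2) = (m1 - m2) - v1 * (r1 - r2)]. *)
Lemma quot_diff : r2 * `|m1 / r1 - m2 / r2| <= U * `|r1 - r2| + `|m1 - m2|.
Proof.
have [v1 e1] := quot_bound r10 m1U; have [v2 e2] := quot_bound r20 m2U.
rewrite -{1}(ger0_norm r20) -normrM.
rewrite (_ : r2 * _ = - (m1 / r1 * (r1 - r2)) + (m1 - m2)).
  rewrite (le_trans (ler_normD _ _)) // lerD2r normrN normrM ler_wpM2r //.
by rewrite {3}e1 {2}e2; ring.
Qed.

Lemma flux_rho_lip th : lip1 th ->
  `|r1 * th (m1 / r1) - r2 * th (m2 / r2)| <= 2 * U * `|r1 - r2| + `|m1 - m2|.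
Proof.
move=> th1; have [v1 e1] := quot_bound r10 m1U.
rewrite (_ : _ - _ = (r1 - r2) * th (m1 / r1) + r2 * (th (m1 / r1) - th (m2 / r2))); last ring.
apply: le_trans (ler_normD _ _) _; rewrite !normrM (ger0_norm r20).
have h1 : `|r1 - r2| * `|th (m1 / r1)| <= `|r1 - r2| * U.
  by rewrite ler_wpM2l //; exact: le_trans (lip1_norm _ th1) v1.
have h2 : r2 * `|th (m1 / r1) - th (m2 / r2)| <= r2 * `|m1 / r1 - m2 / r2|.
  by rewrite ler_wpM2l //; exact: th1.2.
have := quot_diff; lra.
Qed.

Lemma flux_m_lip th : lip1 th ->
  `|m1 * th (m1 / r1) - m2 * th (m2 / r2)| <= 2 * U * `|m1 - m2| + U ^+ 2 * `|r1 - r2|.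
Proof.
move=> th1; have [v1 e1] := quot_bound r10 m1U; have [v2 e2] := quot_bound r20 m2U.
rewrite (_ : _ - _ = (m1 - m2) * th (m1 / r1) + m2 * (th (m1 / r1) - th (m2 / r2))); last ring.
apply: le_trans (ler_normD _ _) _; rewrite !normrM.
have h1 : `|m1 - m2| * `|th (m1 / r1)| <= `|m1 - m2| * U.
  by rewrite ler_wpM2l //; exact: le_trans (lip1_norm _ th1) v1.
have h2 : `|m2| * `|th (m1 / r1) - th (m2 / r2)| <= `|m2| * `|m1 / r1 - m2 / r2|.
  by rewrite ler_wpM2l //; exact: th1.2.
have h3 : `|m2| * `|m1 / r1 - m2 / r2| <= U * (r2 * `|m1 / r1 - m2 / r2|).
  by rewrite mulrA ler_wpM2r.
have u0 := U0; have := ler_wpM2l u0 quot_diff; rewrite expr2; lra.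
Qed.

End pointwise.

Definition admissible b U r m := forall x, 0 <= r x <= b /\ `|m x| <= U * r x.

(** Yields continuity of the fluxes even where the density vanishes and the quotient [m / r] may
    jump: variations of [r] and [m] control those of the flux. *)
Lemma cont_lip_comp (f r m : R -> R) a b : continuous r -> continuous m ->
  (forall x y, `|f x - f y| <= a * `|r x - r y| + b * `|m x - m y|) -> continuous f.
Proof.
move=> cr cm H x; apply/cvgrPdist_le => e e0.
have a0 : 0 < `|a| + 1 by rewrite ltr_wpDl.
have b0 : 0 < `|b| + 1 by rewrite ltr_wpDl.
have ea : 0 < e / 2 / (`|a| + 1) by rewrite !divr_gt0.
have eb : 0 < e / 2 / (`|b| + 1) by rewrite !divr_gt0.
have /cvgrPdist_le/(_ _ ea) h1 := cr x.
have /cvgrPdist_le/(_ _ eb) h2 := cm x.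
near=> y; apply: le_trans (H x y) _.
have : `|r x - r y| <= e / 2 / (`|a| + 1) by near: y.
have : `|m x - m y| <= e / 2 / (`|b| + 1) by near: y.
rewrite !ler_pdivlMr // => k1 k2.
have := ler_norm a; have := ler_norm b; have := normr_ge0 (r x - r y); have := normr_ge0 (m x - m y); nra.
Unshelve. all: by end_near.
Qed.

Variables (eps : R).
Hypothesis (eps0 : 0 < eps).


(** Both equations transport their unknown by the same operator with the same velocity; the Boolean
    lets each flux estimate be proved once. *)
Definition sel (k : bool) (r m : R -> R) : R -> R := if k then r else m.

Lemma flux_lip k th b U r1 m1 r2 m2 x y : lip1 th -> 0 <= U ->
  admissible b U r1 m1 -> admissible b U r2 m2 ->
  `|sel k r1 m1 x * th (m1 x / r1 x) - sel k r2 m2 y * th (m2 y / r2 y)| <=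
  (2 * U + U ^+ 2) * `|r1 x - r2 y| + (2 * U + 1) * `|m1 x - m2 y|.
Proof.
move=> th1 U0 /(_ x)[/andP[r10 _] m1U] /(_ y)[/andP[r20 _] m2U].
have h1 := normr_ge0 (r1 x - r2 y); have h2 := normr_ge0 (m1 x - m2 y).
have u2 : 0 <= U ^+ 2 by rewrite exprn_ge0.
case: k => /=.
  by have := flux_rho_lip U0 r10 r20 m1U m2U th1; nra.
by have := flux_m_lip U0 r10 r20 m1U m2U th1; nra.
Qed.

Lemma flux_bound k th b U r m x : lip1 th -> 0 <= U -> 0 <= b -> admissible b U r m ->
  `|sel k r m x * th (m x / r x)| <= (1 + U) * (U * b).
Proof.
move=> th1 U0 b0 /(_ x)[/andP[r0 rb] mU].
have [v1 e1] := quot_bound U0 r0 mU.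
have ub : 0 <= U * b by rewrite mulr_ge0.
have mb : `|m x| <= U * b by apply: le_trans mU _; rewrite ler_wpM2l.
have tU := le_trans (lip1_norm (m x / r x) th1) v1.
have t0 := normr_ge0 (th (m x / r x)).
rewrite normrM mulrDl mul1r; case: k => /=.
  rewrite (ger0_norm r0) -[leLHS]addr0 lerD // ?mulr_ge0 // mulrC.
  exact: ler_pM.
by rewrite -[leLHS]add0r lerD // mulrC; exact: ler_pM.
Qed.

Lemma flux_continuous k th b U r m : lip1 th -> 0 <= U -> admissible b U r m ->
  continuous r -> continuous m -> continuous (fun x => sel k r m x * th (m x / r x)).
Proof.
move=> th1 U0 a cr cm; apply: cont_lip_comp cr cm _ => x y; exact: (flux_lip k x y th1 U0 a a).
Qed.

Lemma upwind_lip k b U r1 m1 r2 m2 c x : 0 <= U ->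
  admissible b U r1 m1 -> admissible b U r2 m2 ->
  (forall y, `|r1 y - r2 y| <= c) -> (forall y, `|m1 y - m2 y| <= c) ->
  `|upwind eps (sel k r1 m1) (velocity r1 m1) x - upwind eps (sel k r2 m2) (velocity r2 m2) x|
  <= 3 * eps^-1 * (4 * U + U ^+ 2 + 1) * c.
Proof.
move=> U0 a1 a2 rc mc.
have i0 : 0 <= eps^-1 by rewrite invr_ge0 ltW.
have H th y : lip1 th ->
   `|sel k r1 m1 y * th (m1 y / r1 y) - sel k r2 m2 y * th (m2 y / r2 y)| <= (4 * U + U ^+ 2 + 1) * c.
  move=> th1; apply: le_trans (flux_lip k y y th1 U0 a1 a2) _.
  have u2 : 0 <= U ^+ 2 by rewrite exprn_ge0.
  have := rc y; have := mc y; nra.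
have h1 := H _ (x - eps) lip1_pos; have h2 := H _ x lip1_abs; have h3 := H _ (x + eps) lip1_neg.
rewrite /upwind -mulrBr normrM (ger0_norm i0) [3 * _]mulrC -!mulrA ler_wpM2l //.
rewrite /velocity /funrpos /funrneg.
set a := _ * Num.max _ _ in h1 *; set a' := _ * Num.max _ _ in h1 *.
set d := _ * `|_| in h2 *; set d' := _ * `|_| in h2 *.
set g := _ * Num.max _ _ in h3 *; set g' := _ * Num.max _ _ in h3 *.
rewrite (_ : _ - _ = (a - a') - (d - d') + (g - g')); last ring.
apply: le_trans (ler_normD _ _) _; have := ler_normB (a - a') (d - d'); lra.
Qed.

Lemma upwind_bound k b U r m x : 0 <= U -> 0 <= b -> admissible b U r m ->
  `|upwind eps (sel k r m) (velocity r m) x| <= 3 * eps^-1 * ((1 + U) * (U * b)).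
Proof.
move=> U0 b0 a.
have i0 : 0 <= eps^-1 by rewrite invr_ge0 ltW.
have h1 := flux_bound k (x - eps) lip1_pos U0 b0 a.
have h2 := flux_bound k x lip1_abs U0 b0 a.
have h3 := flux_bound k (x + eps) lip1_neg U0 b0 a.
rewrite /upwind normrM (ger0_norm i0) [3 * _]mulrC -!mulrA ler_wpM2l //.
rewrite /velocity /funrpos /funrneg.
set p := _ * Num.max _ _ in h1 *; set d := _ * `|_| in h2 *; set g := _ * Num.max _ _ in h3 *.
apply: le_trans (ler_normD _ _) _; have := ler_normB p d; lra.
Qed.

Lemma upwind_torus k b U r m : 0 <= U -> admissible b U r m ->
  continuous_torus r -> continuous_torus m ->
  continuous_torus (upwind eps (sel k r m) (velocity r m)).
Proof.
move=> U0 a [cr pr] [cm pm]; split; last first.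
  move=> x; rewrite /upwind /velocity /funrpos /funrneg.
  rewrite [x + period - eps]addrAC [x + period + eps]addrAC.
  by case: k => /=; rewrite !pr !pm.
apply: cont_mul; first exact: cont_cst.
apply: cont_add; [apply: cont_sub|].
- exact: (@continuous_shift R (fun x => sel k r m x * (velocity r m)^\+ x) (- eps)
    (flux_continuous (k := k) lip1_pos U0 a cr cm)).
- exact: (flux_continuous (k := k) lip1_abs U0 a cr cm).
- exact: (@continuous_shift R (fun x => sel k r m x * (velocity r m)^\- x) eps
    (flux_continuous (k := k) lip1_neg U0 a cr cm)).
Qed.

End Flux.

Section Truncation.
Context {R : realType}.
Implicit Types (b c e eps U V x y : R) (r m : R -> R).

(* The momentum is truncated to the cone [|m| <= U r]: on this cone [m] and [m^2 / r] are globally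
   Lipschitz functions of the state, even where [r] vanishes (the quotient [m / r] is then [0 / 0 = 0]). *)
Definition trunc_rho b r x := Num.min (Num.max (r x) 0) b.

Definition trunc_m b U r m x :=
  Num.max (Num.min (m x) (U * trunc_rho b r x)) (- (U * trunc_rho b r x)).

Lemma trunc_admissible b U r m : 0 <= b -> 0 <= U ->
  admissible b U (trunc_rho b r) (trunc_m b U r m).
Proof.
move=> b0 U0 x.
have rb : 0 <= trunc_rho b r x <= b by rewrite /trunc_rho le_min ge_min le_max !lexx b0 !orbT.
split=> //; have /andP[r0 _] := rb.
have ur : 0 <= U * trunc_rho b r x by rewrite mulr_ge0.
rewrite /trunc_m ler_norml le_max ge_max ge_min !lexx !orbT /=; lra.
Qed.

Lemma trunc_rho_lip b r1 r2 x y : `|trunc_rho b r1 x - trunc_rho b r2 y| <= `|r1 x - r2 y|.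
Proof. exact: le_trans (minr_lip _ _ _) (maxr_lip _ _ _). Qed.

Lemma minr_lip2 (a b c d : R) : `|Num.min a b - Num.min c d| <= `|a - c| + `|b - d|.
Proof.
rewrite (_ : _ - _ = (Num.min a b - Num.min c b) + (Num.min b c - Num.min d c)).
  by apply: le_trans (ler_normD _ _) _; apply: lerD; exact: minr_lip.
by rewrite [Num.min b c]minC [Num.min d c]minC; ring.
Qed.

Lemma maxr_lip2 (a b c d : R) : `|Num.max a b - Num.max c d| <= `|a - c| + `|b - d|.
Proof.
rewrite (_ : _ - _ = (Num.max a b - Num.max c b) + (Num.max b c - Num.max d c)).
  by apply: le_trans (ler_normD _ _) _; apply: lerD; exact: maxr_lip.
by rewrite [Num.max b c]maxC [Num.max d c]maxC; ring.
Qed.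

Lemma trunc_m_lip b U r1 m1 r2 m2 x y : 0 <= U ->
  `|trunc_m b U r1 m1 x - trunc_m b U r2 m2 y| <= 2 * U * `|r1 x - r2 y| + 1 * `|m1 x - m2 y|.
Proof.
move=> U0; have h := trunc_rho_lip b r1 r2 x y.
apply: le_trans (maxr_lip2 _ _ _ _) _.
have h1 := minr_lip2 (m1 x) (U * trunc_rho b r1 x) (m2 y) (U * trunc_rho b r2 y).
have h2 : `|U * trunc_rho b r1 x - U * trunc_rho b r2 y| <= U * `|r1 x - r2 y|.
  by rewrite -mulrBr normrM ger0_norm // ler_wpM2l.
rewrite -opprD normrN; lra.
Qed.

Lemma trunc_rho_torus b r : continuous_torus r -> continuous_torus (trunc_rho b r).
Proof.
move=> [cr pr]; split; last by move=> x; rewrite /trunc_rho pr.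
apply: (@cont_lip_comp _ _ r r 1 0 cr cr) => x y; rewrite mul1r mul0r addr0; exact: trunc_rho_lip.
Qed.

Lemma trunc_m_torus b U r m : 0 <= U -> continuous_torus r -> continuous_torus m ->
  continuous_torus (trunc_m b U r m).
Proof.
move=> U0 [cr pr] [cm pm]; split; last by move=> x; rewrite /trunc_m /trunc_rho pr pm.
apply: (@cont_lip_comp _ _ r m (2 * U) 1 cr cm) => x y; exact: trunc_m_lip.
Qed.

Lemma trunc_rho_id b r x : 0 <= r x <= b -> trunc_rho b r x = r x.
Proof. by move=> /andP[r0 rb]; rewrite /trunc_rho max_l // min_l. Qed.

Lemma trunc_m_id b U r m x : 0 <= r x <= b -> `|m x| <= U * r x -> trunc_m b U r m x = m x.
Proof.
move=> rb; rewrite /trunc_m trunc_rho_id // ler_norml => /andP[h1 h2].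
by rewrite min_l // max_l.
Qed.

End Truncation.

(** * Global solutions of the truncated system *)

Section TruncatedSystem.
Context {R : realType}.
Local Notation mu := (@lebesgue_measure R).
Implicit Types (b c e eps U x y t s : R) (r m : R -> R).

(** Closedness of the state space under uniform limits, as required by [picard]. *)
Lemma torus_lim (g : R -> R) : (forall e, 0 < e -> exists2 h : R -> R, continuous_torus h &
  forall x, `|h x - g x| <= e) -> continuous_torus g.
Proof.
move=> H; split.
  move=> x; apply/cvgrPdist_le => e e0.
  have e3 : 0 < e / 3 by rewrite divr_gt0.
  have [h [ch _] hg] := H _ e3.
  have /cvgrPdist_le/(_ _ e3) h1 := ch x.
  near=> y.
  have h2 : `|h x - h y| <= e / 3 by near: y.
  have h3 := hg x; have h4 := hg y; rewrite distrC in h3.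
  rewrite (_ : g x - g y = (g x - h x) + (h x - h y) + (h y - g y)); last ring.
  apply: le_trans (ler_normD _ _) _; have := ler_normD (g x - h x) (h x - h y); lra.
move=> x; apply/eqP; rewrite -subr_eq0 -normr_le0; apply/ler_addgt0Pr => e e0; rewrite add0r.
have e2 : 0 < e / 2 by rewrite divr_gt0.
have [h [_ ph] hg] := H _ e2.
have h3 := hg (x + period); have h4 := hg x; rewrite distrC ph in h3.
rewrite (_ : g _ - g x = (g (x + period) - h x) + (h x - g x)); last ring.
apply: le_trans (ler_normD _ _) _; lra.
Unshelve. all: by end_near.
Qed.

Lemma torus_add (f g : R -> R) : continuous_torus f -> continuous_torus g ->
  continuous_torus (fun x => f x + g x).
Proof. by move=> [cf pf] [cg pg]; split=> [|x]; [exact: cont_add|rewrite pf pg]. Qed.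

Lemma torus_mul (f g : R -> R) : continuous_torus f -> continuous_torus g ->
  continuous_torus (fun x => f x * g x).
Proof. by move=> [cf pf] [cg pg]; split=> [|x]; [exact: cont_mul|rewrite pf pg]. Qed.

Lemma torus_cst (c : R) : continuous_torus (fun _ : R => c).
Proof. by split=> // ?; exact: cvg_cst. Qed.

Lemma torus_int (G : R -> R -> R) (C B t : R) : 0 <= t ->
  (forall s, continuous_torus (G s)) ->
  (forall s s' x, `|G s x - G s' x| <= C * `|s - s'|) ->
  (forall s x, `|G s x| <= B) ->
  continuous_torus (fun x => \int[mu]_(s in `[0, t]) G s x).
Proof.
move=> t0 GC Glip GB; split; last first.
  by move=> x; apply: eq_Rintegral => s _; case: (GC s) => _ ->.
have Gc x : continuous (G ^~ x) by apply: (@continuous_of_lip _ _ C) => s s'; exact: Glip.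
move=> x.
apply: (@continuity_under_integral R _ _ mu (fun x s => G s x) `[0, t]%classic _ (x - 1) (x + 1) _ _ (fun=> B)) => //.
- by move=> y _; exact: continuous_integrable.
- by apply: aeW => s _ y _; case: (GC s) => cG _; exact: cG.
- by apply: continuous_integrable; exact: cont_cst.
- by move=> y _; apply: aeW => s _; exact: GB.
- by rewrite inE /= in_itv /=; apply/andP; split; lra.
Qed.

Variables (phi : R -> R) (A C : R) (fT : test_fun phi (derive1 phi) A C).
Variables (K alpha N e : R).
Hypotheses (K0 : 0 <= K) (alpha0 : 0 < alpha).

(* [k] selects the equation: [true] for [rho], [false] for [m]; [e] stands for [eps^beta]. *)
Definition rhs eps (k : bool) r m x :=
  upwind eps (sel k r m) (velocity r m) x +
  (if k then e else - (r x * dpotential phi K alpha N eps r x)).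

Definition trunc_rhs b U eps (k : bool) r m := rhs eps k (trunc_rho b r) (trunc_m b U r m).

Section fixed_eps.
Variables (eps b U : R).
Hypotheses (eps01 : 0 < eps < 1) (b0 : 0 <= b) (U0 : 0 <= U).
Let eps0 : 0 < eps. Proof. by case/andP: eps01. Qed.

Lemma rhs_torus k r m : continuous_torus r -> continuous_torus m -> admissible b U r m ->
  continuous_torus (rhs eps k r m).
Proof.
move=> cr cm a; apply: torus_add; first exact: (upwind_torus (b := b) eps k U0 a cr cm).
case: k; first exact: torus_cst.
have r0 x : 0 <= r x by case: (a x) => /andP[].
exact: (continuous_torusN (torus_mul cr (dpotential_torus fT K N alpha0 eps01 cr r0))).
Qed.

Lemma trunc_rhs_torus k r m : continuous_torus r -> continuous_torus m ->
  continuous_torus (trunc_rhs b U eps k r m).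
Proof.
move=> cr cm; apply: rhs_torus; [exact: trunc_rho_torus|exact: trunc_m_torus|].
exact: trunc_admissible.
Qed.

Lemma trunc_rhs_bounded : exists2 B, 0 <= B & forall k r m x,
  continuous_torus r -> continuous_torus m -> `|trunc_rhs b U eps k r m x| <= B.
Proof.
have [P P0 HP] := dpotential_bounded fT N K0 alpha0 b eps01.
have [e0 bb uu] := And3 eps0 b0 U0.
pose B1 := 3 * eps^-1 * ((1 + U) * (U * b)).
have B10 : 0 <= B1.
  have ub : 0 <= U * b by rewrite mulr_ge0.
  have ie : 0 <= eps^-1 by rewrite invr_ge0 ltW.
  by rewrite /B1 !mulr_ge0 //; lra.
have bP : 0 <= b * P by rewrite mulr_ge0.
exists (B1 + (`|e| + b * P)); first by rewrite !addr_ge0.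
move=> k r m x cr cm; have a := @trunc_admissible _ b U r m b0 U0.
apply: le_trans (ler_normD _ _) _; apply: lerD; first exact: (upwind_bound e0 k x U0 b0 a).
case: k; first by rewrite lerDl.
have [/andP[r0 rb] _] := a x.
rewrite normrN normrM ger0_norm // -[leLHS]add0r lerD //; apply: ler_pM => //.
by apply: HP => [|y]; [exact: trunc_rho_torus|case: (a y)].
Qed.

Lemma trunc_rhs_lip : exists2 L, 0 <= L & forall r1 m1 r2 m2 c,
  continuous_torus r1 -> continuous_torus m1 -> continuous_torus r2 -> continuous_torus m2 ->
  0 <= c -> (forall y, `|r1 y - r2 y| <= c) -> (forall y, `|m1 y - m2 y| <= c) ->
  forall k x, `|trunc_rhs b U eps k r1 m1 x - trunc_rhs b U eps k r2 m2 x| <= L * c.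
Proof.
have [P P0 HP] := dpotential_bounded fT N K0 alpha0 b eps01.
have [L L0 HL] := dpotential_lip fT N K0 alpha0 eps01.
have [ee bb uu] := And3 eps0 b0 U0.
have u2 : 0 <= U ^+ 2 by rewrite exprn_ge0.
(* Lipschitz constant of the upwind operator on the cone times that of the truncation: the clamp on
   [m] moves with the density, whence the factor [2 * U + 1]. *)
pose D := 3 * eps^-1 * (4 * U + U ^+ 2 + 1) * (2 * U + 1).
have D0 : 0 <= D.
  have ie : 0 <= eps^-1 by rewrite invr_ge0 ltW.
  by rewrite /D !mulr_ge0 //; lra.
have bL : 0 <= b * L by rewrite mulr_ge0.
exists (D + (b * L + P)); first by rewrite !addr_ge0.
move=> r1 m1 r2 m2 c cr1 cm1 cr2 cm2 c0 rc mc k x.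
have a1 := @trunc_admissible _ b U r1 m1 b0 U0; have a2 := @trunc_admissible _ b U r2 m2 b0 U0.
have tr y : `|trunc_rho b r1 y - trunc_rho b r2 y| <= c by apply: le_trans (trunc_rho_lip _ _ _ _ _) (rc y).
have tm y : `|trunc_m b U r1 m1 y - trunc_m b U r2 m2 y| <= (2 * U + 1) * c.
  apply: le_trans (trunc_m_lip _ _ _ _ _ _ _ U0) _; have := rc y; have := mc y; nra.
have tr' y : `|trunc_rho b r1 y - trunc_rho b r2 y| <= (2 * U + 1) * c.
  apply: le_trans (tr y) _; nra.
rewrite /trunc_rhs /rhs opprD addrACA.
apply: le_trans (ler_normD _ _) _; rewrite mulrDl; apply: lerD.
  rewrite -mulrA; exact: (upwind_lip _ k _ U0 a1 a2 tr' tm).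
case: k; first by rewrite subrr normr0 mulr_ge0 // addr_ge0.
set r1' := trunc_rho b r1; set r2' := trunc_rho b r2.
set p1 := dpotential _ _ _ _ _ _ _; set p2 := dpotential _ _ _ _ _ _ _.
have [/andP[h1 h2] _] := a1 x.
have r1T := trunc_rho_torus b cr1; have r2T := trunc_rho_torus b cr2.
rewrite (_ : - _ - _ = - (r1' x * (p1 - p2)) - (r1' x - r2' x) * p2); last ring.
apply: le_trans (ler_normB _ _) _; rewrite normrN [`|_ * (p1 - p2)|]normrM [`|_ * p2|]normrM mulrDl; apply: lerD.
  rewrite ger0_norm // -mulrA; apply: ler_pM => //.
  by apply: HL => // y; [case: (a1 y) => /andP[]|case: (a2 y) => /andP[]].
rewrite mulrC; apply: ler_pM => //.
by apply: HP => // y; case: (a2 y).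
Qed.

Lemma truncated_solution r0 m0 : continuous_torus r0 -> continuous_torus m0 ->
  exists r m : R -> R -> R, [/\ r 0 = r0, m 0 = m0,
    C1_map (time_interval +oo%E) r (fun t => trunc_rhs b U eps true (r t) (m t)) &
    C1_map (time_interval +oo%E) m (fun t => trunc_rhs b U eps false (r t) (m t))].
Proof.
move=> cr0 cm0.
have [B B0 HB] := trunc_rhs_bounded; have [L L0 HL] := trunc_rhs_lip.
(* The pair of unknowns is one function on [bool * R], so [picard] sees the coupled system as a
   single equation. *)
pose st (k : bool) (w : bool * R -> R) x := w (k, x).
pose S (w : bool * R -> R) := forall k, continuous_torus (st k w).
pose F (w : bool * R -> R) (i : bool * R) := trunc_rhs b U eps i.1 (st true w) (st false w) i.2.
have SF w : S w -> S (F w) by move=> Sw k; exact: trunc_rhs_torus.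
have FB w i : S w -> `|F w i| <= B by move=> Sw; exact: HB.
have FL v w c : S v -> S w -> 0 <= c -> (forall i, `|v i - w i| <= c) ->
    forall i, `|F v i - F w i| <= L * c.
  by move=> Sv Sw c0 vw i; apply: HL => // y; exact: vw.
have Slim w : (forall d, 0 < d -> exists2 v, S v & forall i, `|v i - w i| <= d) -> S w.
  move=> H k; apply: torus_lim => d d0; have [v Sv vw] := H d d0.
  by exists (st k v) => // x; exact: vw.
have Sint (w : bool * R -> R) (G : R -> bool * R -> R) (D t : R) : S w -> 0 <= t ->
    (forall s, S (G s)) -> (forall s s' i, `|G s i - G s' i| <= D * `|s - s'|) ->
    (forall s i, `|G s i| <= B) -> S (fun i => w i + \int[mu]_(s in `[0, t]) G s i).
  move=> Sw t0 SG Gl GB k; apply: torus_add; first exact: Sw.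
  exact: (torus_int (C := D) (B := B) t0 (fun s => SG s k) (fun s s1 x => Gl s s1 (k, x)) (fun s x => GB s (k, x))).
pose w0 (i : bool * R) := if i.1 then r0 i.2 else m0 i.2.
have Sw0 : S w0 by case.
have [w [ww0 Sw wl]] := picard B0 L0 SF FB FL Slim Sint Sw0.
exists (fun t => st true (w t)), (fun t => st false (w t)); rewrite ww0.
have LB : 0 < L * B + 1 by rewrite ltr_wpDl // mulr_ge0.
suff H k : C1_map (time_interval +oo%E) (fun t => st k (w t))
    (fun t => trunc_rhs b U eps k (st true (w t)) (st false (w t))).
  by split=> //; exact: H.
apply/C1_mapP; split=> [t [t0 _]|t [t0 _] d d0|t [t0 _] d d0].
- by split; [exact: Sw|apply: trunc_rhs_torus; exact: Sw].
- exists (d / (L * B + 1)) => [|s [s0 _]]; first exact: divr_gt0.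
  rewrite ltr_pdivlMr // => sd x; have [_] := wl s t s0 t0 (k, x).
  move=> /le_trans; apply; rewrite -(real_normK (num_real (s - t))) expr2 mulrA ler_wpM2r //.
  by have := normr_ge0 (s - t); nra.
- exists (d / (L * B + 1)) => [|s [s0 _]]; first exact: divr_gt0.
  rewrite ltr_pdivlMr // => sd x.
  apply: (@le_trans _ _ (L * (B * `|s - t|))); last by have := normr_ge0 (s - t); nra.
  apply: HL; try exact: Sw; first by rewrite mulr_ge0.
  + by move=> y; case: (wl s t s0 t0 (true, y)).
  + by move=> y; case: (wl s t s0 t0 (false, y)).
Qed.

End fixed_eps.
End TruncatedSystem.

(** * A priori estimates *)

Section Apriori.
Context {R : realType}.
Local Notation mu := (@lebesgue_measure R).
Implicit Types (b c U x y t s : R) (r m : R -> R).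

Lemma pos_part_bounds (v U : R) : `|v| <= U -> 0 <= Num.max v 0 <= U /\ 0 <= Num.max (- v) 0 <= U.
Proof.
move=> h; rewrite !le_max !ge_max !lexx !orbT /=.
by move: h; rewrite ler_norml => /andP[h1 h2]; split; apply/andP; split; lra.
Qed.

Lemma pos_part_split (v : R) :
  `|v| = Num.max v 0 + Num.max (- v) 0 /\ v = Num.max v 0 - Num.max (- v) 0.
Proof.
have [v0|v0] := leP 0 v.
  rewrite max_r ?oppr_le0 // ger0_norm //; lra.
rewrite max_l ?oppr_ge0 ?(ltW v0) // ltr0_norm //; lra.
Qed.

(** As [|u| = u^+ + u^-], what leaves a point is exactly what its two neighbours receive;
    translation invariance of the integral over a period cancels everything. *)
Lemma int_upwind eps b U k r m : 0 <= U -> admissible b U r m ->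
  continuous_torus r -> continuous_torus m ->
  \int[mu]_(x in `[0, period]) upwind eps (sel k r m) (velocity r m) x = 0.
Proof.
move=> U0 a cr cm.
pose p x := sel k r m x * Num.max (m x / r x) 0.
pose q x := sel k r m x * Num.max (- (m x / r x)) 0.
have cs : continuous_torus (sel k r m) by case: (k).
have cp : continuous p by apply: (flux_continuous lip1_pos U0 a cr.1 cm.1).
have cq : continuous q by apply: (flux_continuous lip1_neg U0 a cr.1 cm.1).
have pT : continuous_torus p by split=> // x; rewrite /p cs.2 cr.2 cm.2.
have qT : continuous_torus q by split=> // x; rewrite /q cs.2 cr.2 cm.2.
have cp' := @continuous_shift R p (- eps) cp; have cq' := @continuous_shift R q eps cq.
transitivity (\int[mu]_(x in `[0, period]) (eps^-1 * (p (x - eps) - (p x + q x) + q (x + eps)))).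
  apply: eq_Rintegral => x _; rewrite /upwind /velocity /p /q /funrpos /funrneg.
  have [-> _] := pos_part_split (m x / r x); ring.
have cpq := cont_add cp cq.
have c1 := cont_sub cp' cpq.
rewrite intZ; last exact: (cont_add c1 cq').
rewrite (intD _ _ c1 cq') (intB _ _ cp' cpq) (intD _ _ cp cq).
by rewrite (int_periodic_shift (- eps) pT) (int_periodic_shift eps qT); ring.
Qed.

Variables (phi : R -> R).
Variables (K alpha N e eps b U : R).
Hypotheses (eps01 : 0 < eps < 1)
  (e01 : 0 < e <= 1) (b0 : 0 <= b) (U0 : 0 < U).
Variables (T : \bar R) (r m : R -> R -> R) (t1 : R).
Hypotheses (rC : C1_map (time_interval T) r
    (fun t => trunc_rhs phi K alpha N e b U eps true (r t) (m t)))
  (mC : C1_map (time_interval T) m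
    (fun t => trunc_rhs phi K alpha N e b U eps false (r t) (m t)))
  (t1T : (t1%:E < T)%E).

Let eps0 : 0 < eps. Proof. by case/andP: eps01. Qed.
Let tI s : 0 <= s <= t1 -> time_interval T s.
Proof. by case/andP => s0 st; split=> //; apply: le_lt_trans t1T; rewrite lee_fin. Qed.
Let U0' : 0 <= U. Proof. exact: ltW. Qed.

(** The bound does not involve [b]: density estimates depend on [U] only, so the cap [b] can be
    chosen after them. *)
Lemma trunc_flux s x (th : R -> R) : lip1 th ->
  `|trunc_rho b (r s) x * th (velocity (trunc_rho b (r s)) (trunc_m b U (r s) (m s)) x)|
    <= U * Num.max (r s x) 0.
Proof.
move=> th1; have [/andP[h1 h2] h3] := @trunc_admissible _ b U (r s) (m s) b0 U0' x.
have [v1 e1] := quot_bound U0' h1 h3.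
rewrite normrM ger0_norm // mulrC; apply: ler_pM => //.
  exact: le_trans (lip1_norm _ th1) v1.
by rewrite /trunc_rho ge_min lexx.
Qed.

(* [r - a] satisfies the hypotheses of [positivity]: outgoing fluxes are at most [U r / eps]. *)
Lemma apriori_lower a : (forall x, a <= r 0 x) -> 0 <= a -> U * a <= eps * e ->
  forall s x, 0 <= s <= t1 -> a <= r s x.
Proof.
move=> ra a0 Ua.
have [D D0 HD] := C1_bounded rC t1T.
pose z (s x : R) := r s x - a.
pose dz (s x : R) := trunc_rhs phi K alpha N e b U eps true (r s) (m s) x.
have ee := eps0; have u0 := U0; have i0 : 0 < eps^-1 by rewrite invr_gt0.
have A0 : 0 <= eps^-1 * U by rewrite mulr_ge0 // ltW.
(* At the level [a] the outflow is at most [U * a / eps], which the source [e] compensates. *)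
have Aa : eps^-1 * U * a <= e.
  by rewrite -mulrA mulrC ler_pdivrMr // [e * _]mulrC.
have zd x : diff_on (z ^~ x) (dz ^~ x) t1.
  have := diff_onD (C1_diff_on x rC t1T) (diff_on_cst (- a) t1).
  by congr diff_on; apply/funext => s; rewrite /= addr0.
suff H : forall s x, 0 <= s <= t1 -> 0 <= z s x by move=> s x /(H s x); rewrite subr_ge0.
apply: (positivity (A := eps^-1 * U) (B := eps^-1 * U) (C0 := D + a) A0 A0 _ zd).
- exact: addr_ge0.
- by move=> s x st; have := HD s st x; rewrite ler_norml /z => /andP[]; lra.
- by move=> x; rewrite /z subr_ge0.
move=> s c st c0 zc x; rewrite /dz /trunc_rhs /rhs /=.
have h1 := @trunc_flux s x _ lip1_abs; rewrite /= ger0_norm in h1; last first.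
  rewrite mulr_ge0 //; by have [/andP[] ] := @trunc_admissible _ b U (r s) (m s) b0 U0' x.
have h2 : Num.max (r s x) 0 <= z s x + a + c.
  have := zc x; rewrite ge_max /z => h; apply/andP; split; lra.
have tr0 y : 0 <= trunc_rho b (r s) y by have [/andP[] ] := @trunc_admissible _ b U (r s) (m s) b0 U0' y.
rewrite /upwind.
set f1 := _ * _^\+ _; set f2 := _ * `|_| in h1 *; set f3 := _ * _^\- _.
have f10 : 0 <= f1 by rewrite mulr_ge0 // le_max lexx orbT.
have f30 : 0 <= f3 by rewrite mulr_ge0 // le_max lexx orbT.
have h3 : f2 <= U * (z s x + a + c) by apply: le_trans h1 _; rewrite ler_pM2l.
have : eps^-1 * (- (U * (z s x + a + c))) <= eps^-1 * (f1 - f2 + f3) by rewrite ler_pM2l //; lra.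
lra.
Qed.

(** Inflow comes from two neighbours, each giving at most [U / eps] times the current bound, hence
    the rate [2 * (eps^-1 * U)]; the extra [1] in the exponent absorbs the source, as
    [e <= 1 <= B0]. *)
Lemma apriori_upper B0 : (forall x, r 0 x <= B0) -> 1 <= B0 ->
  forall s x, 0 <= s <= t1 -> r s x <= B0 * expR ((2 * (eps^-1 * U) + 1) * s).
Proof.
move=> rB B01.
have [D D0 HD] := C1_bounded rC t1T.
have ee := eps0; have u0 := U0; have i0 : 0 < eps^-1 by rewrite invr_gt0.
set a := eps^-1 * U; have a0 : 0 <= a by rewrite mulr_ge0 // ltW.
set l := 2 * a + 1; have l0 : 0 <= l by rewrite /l; lra.
pose z (s x : R) := B0 * expR (l * s) - r s x.
pose dz (s x : R) := B0 * (l * expR (l * s)) - trunc_rhs phi K alpha N e b U eps true (r s) (m s) x.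
have zd x : diff_on (z ^~ x) (dz ^~ x) t1.
  have := diff_onD (diff_onZ B0 (diff_on_expR l t1)) (diff_onZ (-1) (C1_diff_on x rC t1T)).
  by congr diff_on; apply/funext => s; rewrite /= mulN1r.
suff H : forall s x, 0 <= s <= t1 -> 0 <= z s x by move=> s x /(H s x); rewrite subr_ge0.
have B00 : 0 <= B0 by lra.
apply: (positivity (A := 0) (B := 2 * a) (C0 := D) _ _ D0 zd) => //; first lra.
- move=> s x st; have := HD s st x; rewrite ler_norml /z => /andP[_ h].
  have := mulr_ge0 B00 (expR_ge0 (l * s)); lra.
- by move=> x; rewrite /z mulr0 expR0 mulr1 subr_ge0.
move=> s c /andP[s0 st] c0 zc x; rewrite /dz /trunc_rhs /rhs /=.
set E := expR (l * s); have E1 : 1 <= E.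
  by rewrite -expR0 ler_expR mulr_ge0 // ltW.
have h1 := @trunc_flux s (x - eps) _ lip1_pos.
have h2 := @trunc_flux s (x + eps) _ lip1_neg.
have tr0 y : 0 <= trunc_rho b (r s) y by have [/andP[] ] := @trunc_admissible _ b U (r s) (m s) b0 U0' y.
have BE : 1 <= B0 * E by nra.
have h3 y : Num.max (r s y) 0 <= B0 * E + c.
  by have := zc y; rewrite ge_max /z -/E => h; apply/andP; split; lra.
rewrite /upwind; rewrite /= in h1 h2.
set f1 := _ * _^\+ _; set f2 := _ * `|_|; set f3 := _ * _^\- _.
have f20 : 0 <= f2 by rewrite mulr_ge0.
have g1 : f1 <= U * (B0 * E + c).
  by apply: le_trans (ler_norm _) (le_trans h1 _); rewrite ler_pM2l.
have g3 : f3 <= U * (B0 * E + c).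
  by apply: le_trans (ler_norm _) (le_trans h2 _); rewrite ler_pM2l.
have : eps^-1 * (f1 - f2 + f3) <= eps^-1 * (2 * (U * (B0 * E + c))) by rewrite ler_pM2l //; lra.
have -> : eps^-1 * (2 * (U * (B0 * E + c))) = 2 * a * (B0 * E + c) by rewrite /a; ring.
have /andP[_ e1] := e01.
rewrite /l; lra.
Qed.

(** The fluxes cancel over a period even when computed from the truncated state, so the mass has the
    constant derivative [period * e]. This holds before any bound on the solution is known, so the
    chain of estimates can start here. *)
Lemma apriori_mass s : 0 <= s <= t1 ->
  \int[mu]_(x in `[0, period]) r s x = \int[mu]_(x in `[0, period]) r 0 x + period * e * s.
Proof.
move=> /andP[s0 st]; move: s0; rewrite le_eqVlt => /orP[/eqP <-|s0]; first by rewrite mulr0 addr0.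
have st' : 0 <= s <= t1 by rewrite ltW.
have [c /andP[c0 cs] H] := diff_on_MVT s0 (diff_on_sub st (C1_diff_on 0 (C1_int rC) t1T)).
rewrite -[LHS](subrK (\int[mu]_(x in `[0, period]) r 0 x)) H addrC; congr (_ + _ * _).
have ct : 0 <= c <= t1 by rewrite ltW // (le_trans (ltW cs)).
have [cr cm] : continuous_torus (r c) /\ continuous_torus (m c).
  split; [have /C1_mapP[] := rC|have /C1_mapP[] := mC] => + _ _ => /(_ c (tI ct)); by case.
have ta := @trunc_admissible _ b U (r c) (m c) b0 U0'.
have crt := trunc_rho_torus b cr; have cmt := trunc_m_torus b U0' cr cm.
rewrite /trunc_rhs /rhs intD; [|exact: (upwind_torus eps true U0' ta crt cmt).1|exact: cont_cst].
rewrite int_cst; last exact: ltW period_gt0.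
by rewrite (int_upwind eps true U0' ta crt cmt) add0r subr0 mulrC.
Qed.

(** Truncated fluxes carry the clamped momentum [w'], while the comparison function contains [w].
    Since [V <= U], where clamping raises [V * u - w] that quantity is negative and stays at most
    [0]; where clamping lowers it, it stays nonnegative. The other sign is symmetric. *)
Lemma clamp_bounds (V w u : R) : 0 <= V <= U -> 0 <= u ->
  let w' := Num.max (Num.min w (U * u)) (- (U * u)) in
  forall c, 0 <= c -> (- c <= V * u - w -> - c <= V * u - w' <= V * u - w + c) /\
    (- c <= V * u + w -> - c <= V * u + w' <= V * u + w + c).
Proof.
move=> /andP[V0 VU] u0 w' c c0.
have h1 : 0 <= V * u by rewrite mulr_ge0.
have h2 : V * u <= U * u by rewrite ler_wpM2r.
by split=> h; rewrite /w'; (case: (leP w (U * u)) => h3;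
  [case: (leP w (- (U * u))) => h4|case: (leP (U * u) (- (U * u))) => h4]);
  apply/andP; split; lra.
Qed.

(* Both [(V0 + G s) r - m] and [(V0 + G s) r + m] are transported by the same upwind operator as
   [r], with a nonnegative source since the force is bounded by [G]; this is the maximum
   principle for the velocity, written without dividing by [r]. *)
Lemma apriori_momentum V0 G : 0 <= V0 -> 0 <= G -> V0 + G * t1 <= U ->
  (forall x, `|m 0 x| <= V0 * r 0 x) ->
  (forall s x, 0 <= s <= t1 -> 0 <= r s x <= b) ->
  (forall s x, 0 <= s <= t1 -> `|dpotential phi K alpha N eps (r s) x| <= G) ->
  forall s x, 0 <= s <= t1 -> `|m s x| <= (V0 + G * s) * r s x.
Proof.
move=> V00 G0 VU m0 rb PG.
have [D D0 HD] := C1_bounded rC t1T; have [D' D'0 HD'] := C1_bounded mC t1T.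
have ee := eps0; have u0 := U0; have i0 : 0 < eps^-1 by rewrite invr_gt0.
set a := eps^-1 * U; have a0 : 0 <= a by rewrite mulr_ge0 // ltW.
(* The sign turns the two-sided bound on [m] into one family for [positivity], indexed by
   [bool * R]. *)
pose sg (k : bool) : R := if k then 1 else -1.
pose dr s x := trunc_rhs phi K alpha N e b U eps true (r s) (m s) x.
pose dm s x := trunc_rhs phi K alpha N e b U eps false (r s) (m s) x.
pose z (s : R) (i : bool * R) := (V0 + G * s) * r s i.2 + - sg i.1 * m s i.2.
pose dz (s : R) (i : bool * R) := ((V0 + G * s) * dr s i.2 + r s i.2 * G) + - sg i.1 * dm s i.2.
have zd (i : bool * R) : diff_on (z ^~ i) (dz ^~ i) t1.
  have dV : diff_on (fun s => V0 + G * s) (fun=> G) t1.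
    apply: diff_on_all => s; rewrite -[X in is_derive _ _ _ X]add0r.
    apply: (is_deriveD (is_derive_cst V0 s 1)).
    by rewrite -[X in is_derive _ _ _ X]mulr1; exact: is_deriveZ.
  exact: diff_onD (diff_onM dV (C1_diff_on i.2 rC t1T)) (diff_onZ _ (C1_diff_on i.2 mC t1T)).
suff H : forall s i, 0 <= s <= t1 -> 0 <= z s i.
  move=> s x st; have := H s (true, x) st; have := H s (false, x) st.
  by rewrite /z /sg /= ler_norml => *; apply/andP; split; lra.
(* [A] comes from the outgoing flux; [B] collects the slack [c] of the outgoing and the two incoming
   fluxes. *)
apply: (positivity (A := a) (B := 3 * a) (C0 := D') a0 _ D'0 zd); first lra.
- move=> s [k x] st; rewrite /z /=; have := HD' s st x; rewrite ler_norml => /andP[h1 h2].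
  have /andP[h3 _] := rb s x st.
  have h4 : 0 <= (V0 + G * s) * r s x.
    by rewrite mulr_ge0 // addr_ge0 // mulr_ge0 //; case/andP: st.
  by rewrite /sg; case: k; lra.
- move=> [k x]; rewrite /z /= mulr0 addr0; have := m0 x; rewrite ler_norml => /andP[h1 h2].
  by rewrite /sg; case: k; lra.
move=> s c /andP[s0 st] c0 zc [k x].
have st1 : 0 <= s <= t1 by rewrite !ltW.
have rE : trunc_rho b (r s) = r s by apply/funext => y; rewrite trunc_rho_id // rb.
set V := V0 + G * s.
have VV : 0 <= V <= U.
  apply/andP; split; first by rewrite addr_ge0 // mulr_ge0 // ltW.
  by apply: le_trans VU; rewrite lerD2l ler_wpM2l // ltW.
pose w := trunc_m b U (r s) (m s).
pose zh y := V * r s y + - sg k * w y.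
have zhP y : - c <= zh y <= z s (k, y) + c.
  have /andP[h3 _] := rb s y st1; have := zc (k, y); rewrite /z /zh /= -/V => h.
  have [H1 H2] := @clamp_bounds V (m s y) (r s y) VV h3 c c0.
  rewrite /w /trunc_m rE.
  have [sE|sE] : sg k = 1 \/ sg k = -1 by rewrite /sg; case: (k); [left|right].
    by rewrite sE !mulN1r; apply: H1; rewrite sE in h; lra.
  by rewrite sE opprK !mul1r; apply: H2; rewrite sE in h; lra.
have ta := @trunc_admissible _ b U (r s) (m s) b0 U0'.
pose v y := w y / r s y.
have vU y : `|v y| <= U.
  have [/andP[h1 h2] h3] := ta y; rewrite rE in h1 h3.
  by have [] := quot_bound U0' h1 h3.
(* [upwind] is linear in the transported quantity and both equations share the velocity, so [V]
   times the first minus [sg k] times the second transports [zh]. The rest is nonnegative: the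
   source [V * e], and the growth [r * G] that dominates the force. *)
have -> : dz s (k, x) = eps^-1 * (Num.max (v (x - eps)) 0 * zh (x - eps) - `|v x| * zh x +
    Num.max (- v (x + eps)) 0 * zh (x + eps)) + V * e +
    (r s x * G + sg k * (r s x * dpotential phi K alpha N eps (r s) x)).
  rewrite /dz /dr /dm /trunc_rhs /rhs rE /upwind /velocity /funrpos /funrneg /= -/w -/V /zh /v.
  ring.
have rP : 0 <= r s x * G + sg k * (r s x * dpotential phi K alpha N eps (r s) x).
  have /andP[h1 _] := rb s x st1; have := PG s x st1; rewrite ler_norml => /andP[p1 p2].
  by rewrite /sg; case: (k); nra.
have Ve : 0 <= V * e by case/andP: VV => ? _; case/andP: e01 => ? _; rewrite mulr_ge0 // ltW.
have [/andP[f1 f1'] _] := pos_part_bounds (vU (x - eps)).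
have [_ /andP[f3 f3']] := pos_part_bounds (vU (x + eps)).
have /andP[g1 _] := zhP (x - eps); have /andP[g3 _] := zhP (x + eps).
have /andP[_ g2] := zhP x.
have k1 : - (U * c) <= Num.max (v (x - eps)) 0 * zh (x - eps) by nra.
have k3 : - (U * c) <= Num.max (- v (x + eps)) 0 * zh (x + eps) by nra.
have k2 : `|v x| * zh x <= U * (z s (k, x) + c).
  have zc' := zc (k, x); have n0 := normr_ge0 (v x); have nU := vU x.
  apply: (@le_trans _ _ (`|v x| * (z s (k, x) + c))); first by rewrite ler_wpM2l.
  by rewrite ler_wpM2r //; lra.
have : eps^-1 * (- (U * c) - U * (z s (k, x) + c) - U * c) <=
  eps^-1 * (Num.max (v (x - eps)) 0 * zh (x - eps) - `|v x| * zh x +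
    Num.max (- v (x + eps)) 0 * zh (x + eps)) by rewrite ler_pM2l //; lra.
rewrite /a; lra.
Qed.

End Apriori.

(** * Global existence and uniqueness *)

Section TrueSystem.
Context {R : realType}.
Local Notation mu := (@lebesgue_measure R).
Implicit Types (x y t s tau : R) (r m : R -> R -> R).

Lemma C1_map_eq (I J : set R) (f g df dg : R -> R -> R) : J `<=` I ->
  (forall t, J t -> f t = g t) -> (forall t, J t -> df t = dg t) ->
  C1_map I f df -> C1_map J g dg.
Proof.
move=> JI fg dfg /C1_mapP[H1 H2 H3]; apply/C1_mapP; split=> t Jt.
- by rewrite -fg // -dfg //; exact: H1 (JI _ Jt).
- move=> d d0; have [c c0 H] := H2 t (JI _ Jt) d d0; exists c => // s Js st x.
  by rewrite -!fg // -dfg //; exact: H (JI _ Js) st x.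
- move=> d d0; have [c c0 H] := H3 t (JI _ Jt) d d0; exists c => // s Js st x.
  by rewrite -!dfg //; exact: H (JI _ Js) st x.
Qed.

Lemma C1_map_local (f df : R -> R -> R) :
  (forall t, 0 <= t -> exists2 tau, t < tau & C1_map (time_interval tau%:E) f df) ->
  C1_map (time_interval +oo%E) f df.
Proof.
move=> H.
have H' t : 0 <= t -> exists2 tau, t < tau &
   time_interval tau%:E t /\ C1_map (time_interval tau%:E) f df.
  by move=> t0; have [tau tt C] := H t t0; exists tau => //; split=> //; split; rewrite ?lte_fin.
have tI t tau s : time_interval +oo%E s -> `|s - t| < tau - t -> time_interval tau%:E s.
  move=> [s0 _] /(le_lt_trans (ler_norm _)); rewrite ltrD2r => st.
  by split; rewrite ?lte_fin.
apply/C1_mapP; split=> t [t0 _]; have [tau tt [It /C1_mapP[H1 H2 H3]]] := H' t t0.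
- exact: H1.
- move=> d d0; have [c c0 Hc] := H2 t It d d0; exists (Num.min c (tau - t)).
    by rewrite lt_min c0 subr_gt0.
  by move=> s Is; rewrite lt_min => /andP[s1 /(tI _ _ _ Is) s2]; exact: Hc.
- move=> d d0; have [c c0 Hc] := H3 t It d d0; exists (Num.min c (tau - t)).
    by rewrite lt_min c0 subr_gt0.
  by move=> s Is; rewrite lt_min => /andP[s1 /(tI _ _ _ Is) s2]; exact: Hc.
Qed.

Variables (phi : R -> R) (A C : R) (fT : test_fun phi (derive1 phi) A C).
Variables (K alpha N e eps g : R).
Hypotheses (K0 : 0 <= K) (alpha0 : 0 < alpha) (eps01 : 0 < eps < 1)
  (e01 : 0 < e <= 1) (g0 : 0 <= g).
Hypothesis Pmass : forall rho M, continuous_torus rho -> (forall x, 0 <= rho x) ->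
  \int[mu]_(x in `[0, period]) rho x <= M ->
  forall x, `|dpotential phi K alpha N eps rho x| <= g * (1 + M).
Variables (r0 m0 : R -> R) (R0 V0 M0 : R).
Hypotheses (r0C : continuous_torus r0) (m0C : continuous_torus m0)
  (r0eps : forall x, eps <= r0 x) (r0R : forall x, r0 x <= R0) (R01 : 1 <= R0)
  (V00 : 0 <= V0) (m0V : forall x, `|m0 x| <= V0 * r0 x)
  (r0M : \int[mu]_(x in `[0, period]) r0 x <= M0).

Definition gas_solution T r m := [/\
  C1_map (time_interval T) r (fun t => rhs phi K alpha N e eps true (r t) (m t)),
  C1_map (time_interval T) m (fun t => rhs phi K alpha N e eps false (r t) (m t)) &
  r 0 = r0 /\ m 0 = m0 /\ forall t, time_interval T t -> forall x, 0 < r t x].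

(** The levels up to time [tau], each computed from earlier ones only: mass (using [e <= 1]),
    velocity (initial bound plus force times time), slope of the cone (the [+ 1] makes it positive),
    then cap and floor of the density. *)
Definition mass_bd tau := M0 + period * tau.
Definition vel_bd tau := V0 + g * (1 + mass_bd tau) * tau.
Definition tr_bd tau := vel_bd tau + 1.
Definition up_bd tau := R0 * expR ((2 * (eps^-1 * tr_bd tau) + 1) * tau).
Definition low_bd tau := Num.min eps (eps * e / tr_bd tau).

Lemma M0_ge0 : 0 <= M0.
Proof.
apply: le_trans r0M; apply: int_ge0 => x; apply: le_trans (r0eps x).
by case/andP: eps01 => /ltW.
Qed.

Lemma mass_bd_ge0 tau : 0 <= tau -> 0 <= mass_bd tau.
Proof. by move=> t0; rewrite addr_ge0 ?M0_ge0 // mulr_ge0 // ltW // period_gt0. Qed.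

Lemma vel_bd_ge0 tau : 0 <= tau -> 0 <= vel_bd tau.
Proof. by move=> t0; rewrite addr_ge0 // !mulr_ge0 // addr_ge0 // mass_bd_ge0. Qed.

Lemma tr_bd_gt0 tau : 0 <= tau -> 0 < tr_bd tau.
Proof. by move=> t0; rewrite ltr_wpDl // vel_bd_ge0. Qed.

Lemma up_bd_ge0 tau : 0 <= up_bd tau.
Proof. by rewrite mulr_ge0 ?expR_ge0 // (le_trans ler01). Qed.

Lemma low_bd_gt0 tau : 0 <= tau -> 0 < low_bd tau.
Proof.
move=> t0; case/andP: eps01 => ? _; case/andP: e01 => ? _.
by rewrite lt_min; apply/andP; split=> //; rewrite divr_gt0 ?tr_bd_gt0 // mulr_gt0.
Qed.

Lemma low_bd_le tau : 0 <= tau -> tr_bd tau * low_bd tau <= eps * e.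
Proof.
move=> t0; have U0 := tr_bd_gt0 t0.
by rewrite mulrC -ler_pdivlMr // ge_min lexx orbT.
Qed.

Section trunc.
Variables (b U t1 : R) (T : \bar R) (r m : R -> R -> R) (tau : R).
Hypotheses (b0 : 0 <= b) (tau0 : 0 <= tau) (UU : tr_bd tau <= U).
Hypotheses (rC : C1_map (time_interval T) r
    (fun t => trunc_rhs phi K alpha N e b U eps true (r t) (m t)))
  (mC : C1_map (time_interval T) m
    (fun t => trunc_rhs phi K alpha N e b U eps false (r t) (m t)))
  (t1T : (t1%:E < T)%E) (t1tau : t1 <= tau) (rr0 : r 0 = r0) (mm0 : m 0 = m0).
Let U0 : 0 < U. Proof. exact: lt_le_trans (tr_bd_gt0 tau0) UU. Qed.

Lemma trunc_pos s x : 0 <= s <= t1 -> 0 < r s x.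
Proof.
move=> st; have /andP[eps0 _] := eps01; have /andP[e0 _] := e01.
have a0 : 0 < Num.min eps (eps * e / U).
  by rewrite lt_min; apply/andP; split=> //; rewrite divr_gt0 // mulr_gt0.
apply: (lt_le_trans a0).
apply: (apriori_lower eps01 b0 U0 rC t1T) st => //.
- by move=> y; rewrite rr0; apply: le_trans (r0eps y); rewrite ge_min lexx.
- exact: ltW.
- by rewrite mulrC -ler_pdivlMr // ge_min lexx orbT.
Qed.

Lemma trunc_mass s : 0 <= s <= t1 -> \int[mu]_(x in `[0, period]) r s x <= mass_bd tau.
Proof.
move=> st; rewrite (apriori_mass b0 U0 rC mC t1T st) rr0; apply: lerD => //.
have P0 := ltW (@period_gt0 R); have /andP[e0 e1] := e01; case/andP: st => s0 st.
rewrite -mulrA ler_wpM2l //; have := le_trans st t1tau; nra.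
Qed.

(** Since the bound involves neither [b] nor [U], it serves to replace an unknown truncation slope
    above [tr_bd tau] by [tr_bd tau] itself. *)
Lemma trunc_momentum s x : (forall s x, 0 <= s <= t1 -> r s x <= b) ->
  0 <= s <= t1 -> `|m s x| <= vel_bd tau * r s x.
Proof.
move=> rb st; have gg := g0; have mm := mass_bd_ge0 tau0.
have G0 : 0 <= g * (1 + mass_bd tau) by rewrite mulr_ge0 // addr_ge0.
have /andP[s0 s1] := st.
apply: (@le_trans _ _ ((V0 + g * (1 + mass_bd tau) * s) * r s x)); last first.
  rewrite ler_wpM2r // ?(ltW (trunc_pos x st)) // lerD2l ler_wpM2l //.
  exact: le_trans s1 t1tau.
apply: (apriori_momentum eps01 e01 b0 U0 rC mC t1T V00 G0) => //.
- apply: le_trans UU; rewrite /tr_bd /vel_bd.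
  have : g * (1 + mass_bd tau) * t1 <= g * (1 + mass_bd tau) * tau by rewrite ler_wpM2l.
  lra.
- by move=> y; rewrite mm0 rr0.
- by move=> u y ut; rewrite ltW ?trunc_pos //= rb.
move=> u y ut; apply: Pmass; [|by move=> z; rewrite ltW // trunc_pos|exact: trunc_mass].
have /C1_mapP[+ _ _] := rC; move=> /(_ u); case=> //; case/andP: ut => u0 ut; split=> //.
by apply: le_lt_trans t1T; rewrite lee_fin.
Qed.

End trunc.

Lemma admissible_rhs b U r m s k : (forall x, 0 <= r s x <= b) -> (forall x, `|m s x| <= U * r s x) ->
  trunc_rhs phi K alpha N e b U eps k (r s) (m s) = rhs phi K alpha N e eps k (r s) (m s).
Proof.
move=> rb mU; rewrite /trunc_rhs.
have -> : trunc_rho b (r s) = r s by apply/funext => x; exact: trunc_rho_id.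
by have -> : trunc_m b U (r s) (m s) = m s by apply/funext => x; exact: trunc_m_id.
Qed.

Lemma gas_solution_trunc r m b U tau tau' : tau' <= tau -> gas_solution tau%:E r m ->
  (forall s, 0 <= s < tau' -> forall x, r s x <= b /\ `|m s x| <= U * r s x) ->
  C1_map (time_interval tau'%:E) r (fun t => trunc_rhs phi K alpha N e b U eps true (r t) (m t)) /\
  C1_map (time_interval tau'%:E) m (fun t => trunc_rhs phi K alpha N e b U eps false (r t) (m t)).
Proof.
move=> tt [rC mC [_ [_ rp]]] H.
have JI : time_interval tau'%:E `<=` time_interval tau%:E.
  by move=> s [s0]; rewrite lte_fin => st; split=> //; rewrite lte_fin (lt_le_trans st).
have E k s : time_interval tau'%:E s ->
    rhs phi K alpha N e eps k (r s) (m s) = trunc_rhs phi K alpha N e b U eps k (r s) (m s).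
  move=> Js; have /H sx : 0 <= s < tau' by case: Js => s0; rewrite lte_fin => ->; rewrite s0.
  rewrite admissible_rhs // => x; last by case: (sx x).
  by rewrite ltW ?rp //=; [case: (sx x)|exact: JI].
by split; [apply: C1_map_eq rC|apply: C1_map_eq mC] => // s Js; exact: E.
Qed.

(* A solution of the gas system is bounded on compact time intervals, hence solves some truncated
   system; its estimates then allow the truncation to be replaced by the explicit one. *)
Lemma gas_solution_bounds tau r m : gas_solution tau%:E r m ->
  forall s x, 0 <= s < tau -> [/\ low_bd tau <= r s x, r s x <= up_bd tau,
    `|m s x| <= vel_bd tau * r s x & \int[mu]_(x in `[0, period]) r s x <= mass_bd tau].
Proof.
move=> S s x /andP[s0 st]; have tau0 : 0 <= tau := ltW (le_lt_trans s0 st).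
have [rC mC [r00 [m00 rp]]] := S.
(* Compactness needs a closed interval inside [[0, tau[]: constants are taken on [[0, t3]], the
   truncated system holds on [[0, t3[], its estimates on [[0, t2]], and the second pass with the
   explicit slope on [[0, t2[], which still contains [s]. *)
pose t2 := (s + tau) / 2; pose t3 := (t2 + tau) / 2.
have [st2 t23 t3t] : [/\ s < t2, t2 < t3 & t3 < tau] by rewrite /t3 /t2; split; lra.
have t3T : (t3%:E < tau%:E)%E by rewrite lte_fin.
have [D D0 HD] := C1_bounded rC t3T; have [D' D'0 HD'] := C1_bounded mC t3T.
have [c c0 Hc] := C1_gt0 rC t3T rp.
(* [D' / c] bounds the velocity of this particular solution, since [|m| <= D'] and [c <= r]. *)
pose U := Num.max (tr_bd tau) (D' / c).
have UU : tr_bd tau <= U by rewrite le_max lexx.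
have st' : 0 <= s <= t2 by rewrite s0 ltW.
have rD u : 0 <= u < t3 -> forall y, r u y <= D /\ `|m u y| <= U * r u y.
  move=> /andP[u0 /ltW u3] y; have u03 : 0 <= u <= t3 by rewrite u0.
  split; first exact: le_trans (ler_norm _) (HD u u03 y).
  apply: le_trans (HD' u u03 y) _; apply: (@le_trans _ _ (D' / c * r u y)).
    by rewrite mulrAC ler_pdivlMr // ler_wpM2l // Hc.
  by rewrite ler_wpM2r // ?le_max ?lexx ?orbT // (le_trans (ltW c0)) // Hc.
have [rT mT] := gas_solution_trunc (ltW t3t) S rD.
have t2T : (t2%:E < t3%:E)%E by rewrite lte_fin.
have t2tau : t2 <= tau by lra.
have mV u y : 0 <= u <= t2 -> `|m u y| <= vel_bd tau * r u y.
  apply: (trunc_momentum D0 tau0 UU rT mT t2T t2tau r00 m00) => v z /andP[v0 v2].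
  by case: (rD v _ z) => //; rewrite v0 (le_lt_trans v2).
have mass := trunc_mass D0 tau0 UU rT mT t2T t2tau r00 st'.
have rp' u y : 0 <= u < t2 -> 0 <= r u y.
  move=> /andP[u0 u2]; rewrite ltW // rp //; split=> //; rewrite lte_fin; lra.
have rD2 u : 0 <= u < t2 -> forall y, r u y <= D /\ `|m u y| <= tr_bd tau * r u y.
  move=> u2 y; have /andP[u0 u2'] := u2.
  split; first by case: (rD u _ y) => //; rewrite u0 (lt_trans u2').
  apply: le_trans (mV u y _) _; first by rewrite u0 ltW.
  by rewrite ler_wpM2r ?rp' // /tr_bd lerDl.
have [rT' mT'] := gas_solution_trunc t2tau S rD2.
have sT : (s%:E < t2%:E)%E by rewrite lte_fin.
have U0 := tr_bd_gt0 tau0.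
have ss : 0 <= s <= s by rewrite s0 lexx.
split=> //; last exact: mV.
- apply: (apriori_lower eps01 D0 U0 rT' sT) ss; rewrite ?low_bd_le ?(ltW (low_bd_gt0 _)) //.
  by move=> y; rewrite r00; apply: le_trans (r0eps y); rewrite ge_min lexx.
- apply: le_trans (apriori_upper eps01 e01 D0 U0 rT' sT _ R01 x ss) _.
    by move=> y; rewrite r00.
  rewrite /up_bd ler_wpM2l // ?(le_trans ler01) // ler_expR ler_wpM2l ?(ltW st) //.
  have /andP[p0 _] := eps01.
  by rewrite addr_ge0 // mulr_ge0 // mulr_ge0 // ?invr_ge0 ltW.
Qed.

Lemma gas_solution_exists tau : 0 <= tau -> exists r m, gas_solution tau%:E r m.
Proof.
move=> tau0; have U0 := tr_bd_gt0 tau0; have b0 := up_bd_ge0 tau.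
have [r [m [r00 m00 rC mC]]] := truncated_solution fT N e K0 alpha0 eps01 b0 (ltW U0) r0C m0C.
have tT : (tau%:E < +oo)%E by rewrite ltry.
have rp := trunc_pos b0 tau0 (lexx _) rC tT r00.
have rb s x : 0 <= s <= tau -> r s x <= up_bd tau.
  move=> st; apply: le_trans (apriori_upper eps01 e01 b0 U0 rC tT _ R01 x st) _.
    by move=> y; rewrite r00.
  rewrite /up_bd ler_wpM2l // ?(le_trans ler01) // ler_expR ler_wpM2l //; last by case/andP: st.
  have /andP[p0 _] := eps01.
  by rewrite addr_ge0 // mulr_ge0 // mulr_ge0 // ?invr_ge0 ltW.
have mV := trunc_momentum b0 tau0 (lexx _) rC mC tT (lexx _) r00 m00 _ rb.
have Is s : time_interval tau%:E s -> 0 <= s <= tau.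
  by move=> [s0]; rewrite lte_fin => /ltW ->; rewrite s0.
exists r, m; split.
- apply: C1_map_eq rC => // [s [s0 _]|s /Is st]; first by split=> //; rewrite ltry.
  apply: admissible_rhs => x; first by rewrite ltW ?rp //= rb.
  apply: le_trans (mV s x st) _; rewrite ler_wpM2r // ?(ltW (rp _ _ st)) // /tr_bd lerDl //.
- apply: C1_map_eq mC => // [s [s0 _]|s /Is st]; first by split=> //; rewrite ltry.
  apply: admissible_rhs => x; first by rewrite ltW ?rp //= rb.
  apply: le_trans (mV s x st) _; rewrite ler_wpM2r // ?(ltW (rp _ _ st)) // /tr_bd lerDl //.
- by split=> //; split=> // s /Is st x; exact: rp.
Qed.

(** Gronwall in the form of [positivity]: both solutions solve the same truncated system, and the
    differences of either sign, for both components at all points, form one family with [A = 0] and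
    [B = L]. *)
Lemma gas_solution_unique tau r m r' m' : gas_solution tau%:E r m -> gas_solution tau%:E r' m' ->
  forall s x, 0 <= s < tau -> r s x = r' s x /\ m s x = m' s x.
Proof.
move=> S S' s x /andP[s0 st]; have tau0 : 0 <= tau := ltW (le_lt_trans s0 st).
have U0 := tr_bd_gt0 tau0; have b0 := up_bd_ge0 tau.
have bd rr mm : gas_solution tau%:E rr mm -> forall s, 0 <= s < tau -> forall x,
    rr s x <= up_bd tau /\ `|mm s x| <= tr_bd tau * rr s x.
  move=> SS u ut y; have [h1 h2 h3 _] := gas_solution_bounds SS y ut; split=> //.
  apply: le_trans h3 _; rewrite ler_wpM2r //; first exact: le_trans (ltW (low_bd_gt0 tau0)) h1.
  by rewrite /tr_bd lerDl.
have [rC mC] := gas_solution_trunc (lexx _) S (bd _ _ S).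
have [rC' mC'] := gas_solution_trunc (lexx _) S' (bd _ _ S').
have sT : (s%:E < tau%:E)%E by rewrite lte_fin.
have [D1 D10 HD1] := C1_bounded rC sT; have [D2 D20 HD2] := C1_bounded mC sT.
have [D3 D30 HD3] := C1_bounded rC' sT; have [D4 D40 HD4] := C1_bounded mC' sT.
have [L L0 HL] := trunc_rhs_lip fT N e K0 alpha0 eps01 b0 (ltW U0).
pose sg (k : bool) : R := if k then 1 else -1.
pose f k u y := if k then r u y else m u y.
pose f' k u y := if k then r' u y else m' u y.
pose df k u y := trunc_rhs phi K alpha N e (up_bd tau) (tr_bd tau) eps k (r u) (m u) y.
pose df' k u y := trunc_rhs phi K alpha N e (up_bd tau) (tr_bd tau) eps k (r' u) (m' u) y.
pose z (u : R) (i : bool * (bool * R)) := sg i.1 * (f i.2.1 u i.2.2 + -1 * f' i.2.1 u i.2.2).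
pose dz (u : R) (i : bool * (bool * R)) := sg i.1 * (df i.2.1 u i.2.2 + -1 * df' i.2.1 u i.2.2).
have zd i : diff_on (z ^~ i) (dz ^~ i) s.
  case: i => k1 [k2 y]; apply: diff_onZ; apply: diff_onD; last apply: diff_onZ.
    by case: k2; [exact: C1_diff_on rC sT|exact: C1_diff_on mC sT].
  by case: k2; [exact: C1_diff_on rC' sT|exact: C1_diff_on mC' sT].
have ss : 0 <= s <= s by rewrite s0 lexx.
suff H : forall u i, 0 <= u <= s -> 0 <= z u i.
  have E k : f k s x = f' k s x.
    have := H s (true, (k, x)) ss; have := H s (false, (k, x)) ss.
    by rewrite /z /sg /= => h1 h2; apply/le_anti/andP; split; lra.
  by split; [exact: (E true)|exact: (E false)].
apply: (positivity (A := 0) (B := L) (C0 := D1 + D2 + D3 + D4) (lexx _) L0 _ zd).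
- by rewrite !addr_ge0.
- move=> u [k1 [k2 y]] us.
  have h1 := HD1 u us y; have h2 := HD2 u us y; have h3 := HD3 u us y; have h4 := HD4 u us y.
  rewrite !ler_norml in h1 h2 h3 h4.
  case/andP: h1 => *; case/andP: h2 => *; case/andP: h3 => *; case/andP: h4 => *.
  by rewrite /z /sg /f /f' /=; case: k1; case: k2; lra.
- move=> [k1 [k2 y]]; rewrite /z /f /f' /=.
  have [_ _ [-> [-> _]]] := S; have [_ _ [-> [-> _]]] := S'.
  by case: k2; rewrite mulN1r subrr mulr0.
move=> u c /andP[u0 us] c0 zc [k1 [k2 y]].
have fc k w : `|f k u w - f' k u w| <= c.
  have := zc (true, (k, w)); have := zc (false, (k, w)).
  by rewrite /z /sg /= ler_norml => *; apply/andP; split; lra.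
have Iu : time_interval tau%:E u by split; [exact: ltW|rewrite lte_fin (lt_trans us)].
have [rt _] : continuous_torus (r u) /\ True by case/C1_mapP: rC => /(_ u Iu)[].
have [mt _] : continuous_torus (m u) /\ True by case/C1_mapP: mC => /(_ u Iu)[].
have [rt' _] : continuous_torus (r' u) /\ True by case/C1_mapP: rC' => /(_ u Iu)[].
have [mt' _] : continuous_torus (m' u) /\ True by case/C1_mapP: mC' => /(_ u Iu)[].
have := HL _ _ _ _ c rt mt rt' mt' c0 (fc true) (fc false) k2 y.
rewrite -/(df k2 u y) -/(df' k2 u y) ler_norml => /andP[h1 h2].
by rewrite /dz /sg /=; case: k1; lra.
Qed.

Theorem global_gas_solution : exists r m, gas_solution +oo%E r m.
Proof.
have H (n : nat) : exists p : (R -> R -> R) * (R -> R -> R), gas_solution (n.+1%:R)%:E p.1 p.2.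
  by have [r [m S]] := @gas_solution_exists n.+1%:R (ler0n _ _); exists (r, m).
have [p pS] := choice H.
(* At time [t], the solution on [[0, n + 1[] with [n] the integer part of [t]; uniqueness makes the
   pieces agree. *)
pose r t := (p (Num.truncn t)).1 t; pose m t := (p (Num.truncn t)).2 t.
have E n t : 0 <= t < n.+1%:R -> r t = (p n).1 t /\ m t = (p n).2 t.
  move=> /andP[t0 tn].
  have t1 : t < (Num.truncn t).+1%:R by exact: truncnS_gt.
  have kn : ((Num.truncn t).+1%:R <= n.+1%:R :> R).
    rewrite ler_nat ltnS; rewrite -ltnS -(ltr_nat R); apply: le_lt_trans tn.
    by rewrite truncn_le.
  have S' : gas_solution ((Num.truncn t).+1%:R)%:E (p n).1 (p n).2.
    have [rC mC [a [b c]]] := pS n.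
    have JI : time_interval ((Num.truncn t).+1%:R : R)%:E `<=` time_interval (n.+1%:R : R)%:E.
      by move=> s [s0]; rewrite lte_fin => st; split=> //; rewrite lte_fin (lt_le_trans st).
    split; [exact: C1_map_eq rC|exact: C1_map_eq mC|split=> //; split=> // s Js].
    exact: c (JI s Js).
  have tt : 0 <= t < (Num.truncn t).+1%:R by rewrite t0.
  by split; apply/funext => x; case: (gas_solution_unique (pS _) S' x tt).
have I n t : time_interval (n.+1%:R : R)%:E t -> 0 <= t < n.+1%:R.
  by move=> [t0]; rewrite lte_fin t0.
exists r, m; split.
- apply: C1_map_local => t t0; exists (Num.truncn t).+1%:R; first exact: truncnS_gt.
  have [rC _ _] := pS (Num.truncn t).
  by apply: C1_map_eq rC => // s /I /E [rE mE]; rewrite ?rE ?mE.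
- apply: C1_map_local => t t0; exists (Num.truncn t).+1%:R; first exact: truncnS_gt.
  have [_ mC _] := pS (Num.truncn t).
  by apply: C1_map_eq mC => // s /I /E [rE mE]; rewrite ?rE ?mE.
- have [_ _ [a [b _]]] := pS 0%N.
  have z0 : 0 <= (0 : R) < 1 by rewrite lexx ltr01.
  have [-> ->] := E 0%N 0 z0; split=> //; split=> // t [t0 _] x.
  have [_ _ [_ [_ c]]] := pS (Num.truncn t); apply: c; split=> //.
  by rewrite lte_fin truncnS_gt.
Qed.

End TrueSystem.

(** * Consistency estimates at fixed epsilon *)

Section WeakEstimates.
Context {R : realType}.
Local Notation mu := (@lebesgue_measure R).
Implicit Types (f h : R -> R) (a b c d x y t s : R).

(* As functions of the upper bound [b], both sides have the same derivative. *)
Lemma integral_swap (g : R -> R) (h : R -> R -> R) (L a b c d : R) : continuous g ->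
  (forall x x' y, `|h x y - h x' y| <= L * `|x - x'|) ->
  (forall x y y', `|h x y - h x y'| <= L * `|y - y'|) -> a <= b -> c <= d ->
  \int[mu]_(x in `[a, b]) (\int[mu]_(y in `[c, d]) (g y * h x y)) =
  \int[mu]_(y in `[c, d]) (g y * \int[mu]_(x in `[a, b]) h x y).
Proof.
move=> cg hx hy ab cd.
have chx y : continuous (h ^~ y) by apply: (@continuous_of_lip _ _ L) => x x'; exact: hx.
have chy x : continuous (h x) by apply: (@continuous_of_lip _ _ L) => y y'; exact: hy.
have L0 : 0 <= L by have := le_trans (normr_ge0 _) (hx 1 0 0); rewrite subr0 normr1 mulr1.
pose J := \int[mu]_(y in `[c, d]) `|g y|.
have cG x : continuous (fun y => g y * h x y) by apply: cont_mul.
pose I x := \int[mu]_(y in `[c, d]) (g y * h x y).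
have bnd (k k' : R -> R) (D : R) : continuous k -> continuous k' -> (forall y, `|k y - k' y| <= D * `|g y|) ->
    `|\int[mu]_(y in `[c, d]) k y - \int[mu]_(y in `[c, d]) k' y| <= D * J.
  move=> ck ck' kk; rewrite -intB // -intZ; last exact: cont_norm.
  apply: le_trans (int_norm _ _ (cont_sub ck ck')) _.
  apply: int_le; [exact: cont_norm (cont_sub ck ck')| |by move=> y _; exact: kk].
  by apply: cont_mul; [exact: cont_cst|exact: cont_norm].
have cI : continuous I.
  apply: (@continuous_of_lip _ _ (L * J)) => x x'.
  rewrite mulrAC; apply: bnd => // y.
  by rewrite -mulrBr normrM mulrC ler_wpM2r.
have [PI [dPI PIE]] := ex_primitive cI.
have /choice[P HP] : forall y, exists F : R -> R, (forall x, is_derive x 1 F (h x y)) /\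
  (forall a b, a <= b -> \int[mu]_(x in `[a, b]) h x y = F b - F a).
  by move=> y; exact: ex_primitive (chx y).
have cH t : continuous (fun y => P y t - P y a).
  apply: (@continuous_of_lip _ _ (L * `|t - a|)) => y y'.
  rewrite mulrAC (_ : _ - _ = (P y t - P y' t) - (P y a - P y' a)); last ring.
  apply: (@lip_of_derive _ (fun s => P y s - P y' s) (fun s => h s y - h s y') (L * `|y - y'|)) => s.
    exact: (is_deriveB ((HP y).1 s) ((HP y').1 s)).
  exact: hy.
have cgH t : continuous (fun y => g y * (P y t - P y a)) by exact: cont_mul.
pose T t := \int[mu]_(y in `[c, d]) (g y * (P y t - P y a)).
have dT t : is_derive t 1 T (I t).
  apply: is_derive_eps => e e0.
  have J0 : 0 <= J by apply: int_ge0.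
  have LJ : 0 < L * J + 1 by rewrite ltr_wpDl // mulr_ge0.
  exists (e / (L * J + 1)) => [|s]; first exact: divr_gt0.
  rewrite ltr_pdivlMr // => st.
  have cst : continuous (fun y => (s - t) * (g y * h t y)).
    by apply: cont_mul => //; exact: cont_cst.
  rewrite /T /I -intZ // -intB //.
  apply: le_trans (bnd _ _ (L * (s - t) ^+ 2) (cont_sub (cgH s) (cgH t)) cst _) _.
    move=> y.
    rewrite (_ : _ - _ = (P y (t + (s - t)) - P y t - (s - t) * h t y) * g y); last first.
      by rewrite [t + _]addrC subrK; ring.
    rewrite normrM ler_wpM2r //.
    by apply: (taylor_of_lip (HP y).1) => // x _; exact: hx.
  rewrite -(real_normK (num_real (s - t))) expr2 (_ : _ * J = L * J * `|s - t| * `|s - t|); last ring.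
  by rewrite ler_wpM2r //; have := normr_ge0 (s - t); nra.
have H x : is_derive x (1 : R) (T - PI) 0.
  by rewrite -(subrr (I x)); exact: (is_deriveB (dT x) (dPI x)).
have := is_derive_0_is_cst b a H; rewrite /= !fctE.
have -> : T a = 0.
  rewrite /T; under eq_Rintegral do rewrite subrr mulr0.
  by rewrite int_cst // mul0r.
rewrite PIE // sub0r => TE.
transitivity (T b); first by lra.
by apply: eq_Rintegral => y _; rewrite (HP y).2.
Qed.

Variables (psi psi' : R -> R) (A C : R) (pT : test_fun psi psi' A C).

Lemma out_window B x : A <= B -> ~~ (- B <= x <= B) -> psi x = 0 /\ psi' x = 0.
Proof.
move=> AB; rewrite -ler_norml -ltNge => Bx; have Ax := le_lt_trans AB Bx.
by rewrite (tf_supp pT) // (tf_supp' pT).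
Qed.

(** With [p] and [q] the fluxes to the right and to the left, moving the shifts onto [psi] leaves
    [p] and [q] multiplied by Taylor remainders of order [eps], and [p - q] is the exact flux. The
    remainder is integrated against [c * r], so only the mass enters; [c] will be the velocity bound
    for the density and its square for the momentum. *)
Lemma weak_upwind k b U r m eps c : 0 < eps < 1 -> 0 <= U -> admissible b U r m ->
  continuous_torus r -> continuous_torus m ->
  (forall x, `|sel k r m x * velocity r m x| <= c * r x) -> 0 <= c ->
  `|\int[mu]_x (upwind eps (sel k r m) (velocity r m) x * psi x) -
    \int[mu]_x (sel k r m x * velocity r m x * psi' x)| <=
  C * eps * c * (2 * (Num.truncn ((A + 1) / period)).+1%:R) * \int[mu]_(x in `[0, period]) r x.
Proof.
move=> /andP[e0 e1] U0 a cr cm gc c0; have A0 := tf_A pT; have C0 := tf_C pT.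
have cpsi := tf_cont pT; have cpsi' := tf_cont' pT.
pose p x := sel k r m x * Num.max (velocity r m x) 0.
pose q x := sel k r m x * Num.max (- velocity r m x) 0.
have cp : continuous p by apply: (flux_continuous lip1_pos U0 a cr.1 cm.1).
have cq : continuous q by apply: (flux_continuous lip1_neg U0 a cr.1 cm.1).
(* Contains the supports of [psi] and of its shifts by [eps < 1]. *)
pose B := A + 1.
have AB : A <= B by rewrite /B; lra.
have BB : - B <= B by rewrite /B; lra.
have psi0 x : ~~ (- B <= x <= B) -> psi x = 0 by move=> /(out_window AB)[].
have psi'0 x : ~~ (- B <= x <= B) -> psi' x = 0 by move=> /(out_window AB)[].
have psie0 x d : `|d| <= 1 -> ~~ (- B <= x <= B) -> psi (x + d) = 0.
  move=> d1; rewrite -ler_norml -ltNge => Bx; apply: (tf_supp pT).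
  have := ler_normB (x + d) d; rewrite addrK /B in Bx *; lra.
have cs d : continuous (fun x => psi (x + d)) by exact: continuous_shift.
have ee : `|eps| <= 1 /\ `|- eps| <= 1 by rewrite normrN ger0_norm ltW.
have sh f d : `|d| <= 1 -> continuous f ->
    \int[mu]_x (f (x - d) * psi x) = \int[mu]_(x in `[- B, B]) (f x * psi (x + d)).
  move=> d1 cf.
  have h0 x : ~~ (- B <= x <= B) -> f x * psi (x + d) = 0.
    by move=> xB; rewrite psie0 // mulr0.
  rewrite -(intT h0) -(intT_shift (- d) BB (cont_mul cf (cs d)) h0).
  by apply: eq_Rintegral => x _; rewrite subrK.
have W f : \int[mu]_x (f x * psi x) = \int[mu]_(x in `[- B, B]) (f x * psi x).
  by apply: intT => x xB; rewrite psi0 // mulr0.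
have W' f : \int[mu]_x (f x * psi' x) = \int[mu]_(x in `[- B, B]) (f x * psi' x).
  by apply: intT => x xB; rewrite psi'0 // mulr0.
have pq x : sel k r m x * `|velocity r m x| = p x + q x.
  by rewrite /p /q; have [-> _] := pos_part_split (velocity r m x); ring.
have pmq x : sel k r m x * velocity r m x = p x - q x.
  by rewrite /p /q; have [_ {1}->] := pos_part_split (velocity r m x); ring.
have cpe : continuous (fun x => p (x - eps)) := @continuous_shift R p (- eps) cp.
have cqe : continuous (fun x => q (x + eps)) := @continuous_shift R q eps cq.
have E1 : \int[mu]_x (upwind eps (sel k r m) (velocity r m) x * psi x) =
    \int[mu]_(x in `[- B, B]) (eps^-1 * (p x * psi (x + eps) - (p x + q x) * psi x + q x * psi (x - eps))).
  have d1 := cont_mul cpe cpsi; have d2 := cont_mul (cont_add cp cq) cpsi.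
  have d3 := cont_mul cqe cpsi.
  have c1 := cont_mul cp (cs eps); have c3 := cont_mul cq (cs (- eps)).
  rewrite W; transitivity (\int[mu]_(x in `[- B, B])
      (eps^-1 * (p (x - eps) * psi x - (p x + q x) * psi x + q (x + eps) * psi x))).
    by apply: eq_Rintegral => x _; rewrite /upwind pq /p /q /funrpos /funrneg; ring.
  rewrite (intZ _ _ _ (cont_add (cont_sub d1 d2) d3)) (intZ _ _ _ (cont_add (cont_sub c1 d2) c3)).
  rewrite (intD _ _ (cont_sub d1 d2) d3) (intD _ _ (cont_sub c1 d2) c3).
  rewrite (intB _ _ d1 d2) (intB _ _ c1 d2).
  rewrite -(W (fun x => p (x - eps))) -(W (fun x => q (x + eps))) (sh p eps ee.1 cp).
  by have := sh q (- eps) ee.2 cq; rewrite opprK => ->.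
have E2 : \int[mu]_x (sel k r m x * velocity r m x * psi' x) =
    \int[mu]_(x in `[- B, B]) ((p x - q x) * psi' x).
  by rewrite W'; apply: eq_Rintegral => x _; rewrite pmq.
rewrite E1 E2.
have c1 : continuous (fun x => eps^-1 * (p x * psi (x + eps) - (p x + q x) * psi x + q x * psi (x - eps))).
  exact: (cont_mul (@cont_cst R eps^-1) (cont_add (cont_sub (cont_mul cp (cs eps))
    (cont_mul (cont_add cp cq) cpsi)) (cont_mul cq (cs (- eps))))).
have c2 : continuous (fun x => (p x - q x) * psi' x) by exact: (cont_mul (cont_sub cp cq) cpsi').
rewrite -intB //; apply: le_trans (int_norm _ _ (cont_sub c1 c2)) _.
have cr1 : continuous (fun x => C * eps * c * r x) by apply: cont_mul; [exact: cont_cst|case: cr].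
apply: (@le_trans _ _ (\int[mu]_(x in `[- B, B]) (C * eps * c * r x))); last first.
  rewrite intZ; last by case: cr.
  rewrite -[leRHS]mulrA ler_wpM2l ?mulr_ge0 ?(ltW e0) //.
  by apply: int_window => // x; case: (a x) => /andP[].
apply: int_le => //; first exact: cont_norm (cont_sub c1 c2).
move=> x _.
have t1 := tf_taylor pT x eps; have t2 := tf_taylor pT x (- eps).
rewrite (_ : _ - _ = p x * (eps^-1 * (psi (x + eps) - psi x - eps * psi' x)) +
   q x * (eps^-1 * (psi (x - eps) - psi x - - eps * psi' x))); last by field; rewrite gt_eqF.
have i0 : 0 <= eps^-1 by rewrite invr_ge0 ltW.
have ie d : `|d| <= C * eps ^+ 2 -> `|eps^-1 * d| <= C * eps.
  move=> dC; rewrite normrM ger0_norm //; apply: le_trans (ler_wpM2l i0 dC) _.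
  by rewrite (_ : eps^-1 * _ = C * eps) //; field; rewrite gt_eqF.
rewrite sqrrN in t2.
have npq : `|p x| + `|q x| <= c * r x.
  apply: le_trans (gc x); rewrite /p /q; move: (velocity r m x) => v.
  have h1 : 0 <= Num.max v 0 by rewrite le_max lexx orbT.
  have h2 : 0 <= Num.max (- v) 0 by rewrite le_max lexx orbT.
  rewrite !normrM -mulrDr ler_wpM2l // (ger0_norm h1) (ger0_norm h2).
  by have [-> _] := pos_part_split v.
apply: le_trans (ler_normD _ _) _; rewrite [`|p x * _|]normrM [`|q x * _|]normrM.
apply: (@le_trans _ _ (`|p x| * (C * eps) + `|q x| * (C * eps))).
  by apply: lerD; rewrite ler_wpM2l //; apply: ie.
by rewrite -mulrDl mulrC -[leRHS]mulrA ler_wpM2l // mulr_ge0 // ltW.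
Qed.

End WeakEstimates.

(** * The state law against test functions *)

Section WeakPotential.
Context {R : realType}.
Local Notation mu := (@lebesgue_measure R).
Implicit Types (x y t s : R).

Variables (phi : R -> R) (A C : R) (fT : test_fun phi (derive1 phi) A C).
Hypotheses (phi_ge0 : forall x, 0 <= phi x) (phi_int1 : \int[mu]_x phi x = 1).
Variables (psi psi' : R -> R) (A' C' : R) (pT : test_fun psi psi' A' C').

Lemma int_mollifier m : 0 < m -> \int[mu]_(x in `[- (A * m), A * m]) mollifier phi m x = 1.
Proof.
move=> m0; have A0 := tf_A fT; have cphi := tf_cont fT.
have [F [dF FE]] := ex_primitive cphi.
have dG x : is_derive x 1 (fun y => F (y / m)) (mollifier phi m x).
  rewrite /mollifier mulrC; apply: (@is_derive1_comp R F (fun x => x / m)) => //.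
  have -> : (fun x => x / m) = m^-1 \*: (@id R) by apply/funext => y; rewrite mulrC.
  by rewrite -[X in is_derive _ _ _ X]mulr1; exact: is_deriveZ.
have AA : - A <= A by lra.
have AAm : - (A * m) <= A * m by have := mulr_gt0 A0 m0; lra.
rewrite (intE dG) //; last exact: continuous_scale.
rewrite mulNr !mulfK ?gt_eqF // -FE // -phi_int1; apply/esym/intT => x.
by rewrite -ler_norml -ltNge; exact: (tf_supp fT).
Qed.

(** The kernel is nonnegative with integral [1] and lives within distance [A * m] of its centre [y],
    where [psi] departs from [psi y] by at most [C' * (A * m)]. *)
Lemma mollified_test_fun m y : 0 < m <= 1 ->
  `|\int[mu]_(x in `[- A', A']) (mollifier phi m (x - y) * psi x) - psi y| <= C' * (A * m).
Proof.
move=> m01; have /andP[m0 m1] := m01; have A0 := tf_A fT; have C'0 := tf_C pT; have A'0 := tf_A pT.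
have cpsi := tf_cont pT; set f := mollifier phi m.
have cf : continuous f := tf_cont (mollifier_test fT m01).
have f0 x : A * m < `|x| -> f x = 0 by move=> /(mollifier_supp fT m0)[].
have Am0 := mulr_gt0 A0 m0.
have cpy : continuous (fun x => psi (x + y)) := @continuous_shift R psi y cpsi.
have cF : continuous (fun z => f z * psi (z + y)) := cont_mul cf cpy.
have F0 x : ~~ (- (A * m) <= x <= A * m) -> f x * psi (x + y) = 0.
  by rewrite -ler_norml -ltNge => /f0 ->; rewrite mul0r.
have -> : \int[mu]_(x in `[- A', A']) (f (x - y) * psi x) =
    \int[mu]_(z in `[- (A * m), A * m]) (f z * psi (z + y)).
  rewrite -(intT F0) -(intT_shift (- y) _ cF F0); last lra.
  rewrite -(@intT _ _ (- A') A'); last first.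
    by move=> x; rewrite -ler_norml -ltNge => /(tf_supp pT) ->; rewrite mulr0.
  by apply: eq_Rintegral => x _; rewrite subrK.
have {1}-> : psi y = \int[mu]_(z in `[- (A * m), A * m]) (psi y * f z).
  by rewrite intZ // int_mollifier // mulr1.
have cy : continuous (fun z => psi y * f z) := cont_mul (@cont_cst R (psi y)) cf.
rewrite -intB //; apply: le_trans (int_norm _ _ (cont_sub cF cy)) _.
have -> : C' * (A * m) = \int[mu]_(z in `[- (A * m), A * m]) (C' * (A * m) * f z).
  by rewrite intZ // int_mollifier // mulr1.
apply: int_le; first exact: cont_norm (cont_sub cF cy).
  exact: (cont_mul (@cont_cst R (C' * (A * m))) cf).
move=> z; rewrite -ler_norml => zA.
have fz : 0 <= f z by rewrite mulr_ge0 // invr_ge0 ltW.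
rewrite [psi y * _]mulrC -mulrBr normrM ger0_norm // mulrC ler_wpM2r //.
apply: le_trans (tf_lip pT _ _) _; rewrite addrK; exact: ler_wpM2l.
Qed.

(** Exchanging the integrals puts the mollification on [psi], which is Lipschitz, so that [g] enters
    through the integral of [|g|] only. For the logarithm of the density this is the only control
    uniform enough in [eps]. *)
Lemma weak_convolution (g : R -> R) m : continuous g -> 0 < m <= 1 ->
  `|\int[mu]_x (convolution g (mollifier phi m) x * psi x) - \int[mu]_x (g x * psi x)| <=
  C' * (A * m) * \int[mu]_(y in `[- (A' + A), A' + A]) `|g y|.
Proof.
move=> cg m01; have /andP[m0 m1] := m01; have A0 := tf_A fT; have C'0 := tf_C pT; have A'0 := tf_A pT.
have T := mollifier_test fT m01; set f := mollifier phi m in T *; set D := _ * C in T.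
have D0 := tf_C T; have cf := tf_cont T; have cpsi := tf_cont pT.
pose B := A' + A; rewrite -/B.
have cfx y : continuous (fun x => f (x - y)) := @continuous_shift R f (- y) cf.
have -> : \int[mu]_x (convolution g f x * psi x) =
    \int[mu]_(x in `[- A', A']) (\int[mu]_(y in `[- B, B]) (g y * (f (x - y) * psi x))).
  rewrite (@intT _ _ (- A') A'); last first.
    by move=> x; rewrite -ler_norml -ltNge => /(tf_supp pT) ->; rewrite mulr0.
  apply: eq_Rintegral => x; rewrite inE /= in_itv /= => /andP[x1 x2].
  rewrite (conv_window (a := - B) (b := B) g (tf_supp T)); try (rewrite /B; lra).
  rewrite mulrC -intZ; last by apply: cont_mul => //; exact: cont_refl.
  by apply: eq_Rintegral => y _; ring.
rewrite (@integral_swap R g (fun x y => f (x - y) * psi x) (2 * (D * C'))) //; try (rewrite /B; lra).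
- have -> : \int[mu]_x (g x * psi x) = \int[mu]_(x in `[- B, B]) (g x * psi x).
    apply: intT => x; rewrite -ler_norml -ltNge => xB; rewrite (tf_supp pT) ?mulr0 //.
    by apply: le_lt_trans xB; rewrite /B; lra.
  pose k y := \int[mu]_(x in `[- A', A']) (f (x - y) * psi x).
  have ck : continuous k.
    apply: (@continuous_of_lip _ _ (D * C' * (A' - - A'))) => y y'.
    rewrite /k -intB; try exact: (cont_mul (cfx _) cpsi).
    rewrite mulrAC.
    apply: int_norm_le; first lra.
      exact: (cont_sub (cont_mul (cfx y) cpsi) (cont_mul (cfx y') cpsi)).
    move=> x _; rewrite -mulrBl normrM mulrAC; apply: ler_pM => //; last exact: (tf_bd pT).
    apply: le_trans (tf_lip T _ _) _.
    by rewrite (_ : x - y - (x - y') = - (y - y')) ?normrN //; ring.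
  have c1 := cont_mul cg ck; have c2 := cont_mul cg cpsi.
  rewrite -intB // -intZ; last exact: cont_norm.
  apply: le_trans (int_norm _ _ (cont_sub c1 c2)) _; apply: int_le.
  + exact: cont_norm (cont_sub c1 c2).
  + exact: (cont_mul (@cont_cst R (C' * (A * m))) (cont_norm cg)).
  + by move=> y _; rewrite -mulrBr normrM mulrC ler_wpM2r //; exact: mollified_test_fun.
- move=> x x' y.
  rewrite (_ : _ - _ = (f (x - y) - f (x' - y)) * psi x + f (x' - y) * (psi x - psi x')); last ring.
  apply: le_trans (ler_normD _ _) _.
  rewrite [`|_ * psi x|]normrM [`|_ * (psi x - _)|]normrM.
  have h1 : `|f (x - y) - f (x' - y)| * `|psi x| <= D * `|x - x'| * C'.
    apply: ler_pM => //; last exact: (tf_bd pT).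
    by apply: le_trans (tf_lip T _ _) _; rewrite opprD addrACA subrr addr0.
  have h2 : `|f (x' - y)| * `|psi x - psi x'| <= D * (C' * `|x - x'|).
    by apply: ler_pM => //; [exact: (tf_bd T)|exact: (tf_lip pT)].
  lra.
- move=> x y y'; rewrite -mulrBl normrM.
  have h1 : `|f (x - y) - f (x - y')| * `|psi x| <= D * `|y - y'| * C'.
    apply: ler_pM => //; last exact: (tf_bd pT).
    apply: le_trans (tf_lip T _ _) _.
    by rewrite (_ : x - y - (x - y') = - (y - y')) ?normrN //; ring.
  have := mulr_ge0 (mulr_ge0 D0 (normr_ge0 (y - y'))) C'0; lra.
Qed.

Lemma log_density_window N eps rho p a : 0 < eps < 1 -> 0 < N -> 0 < p -> 0 <= a ->
  continuous_torus rho -> (forall x, 0 <= rho x) ->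
  \int[mu]_(y in `[- a, a]) `|log_density N eps rho y| <=
  2 * (Num.truncn (a / period)).+1%:R * \int[mu]_(x in `[0, period]) rho x +
  (1 + N / p) * eps `^ (- p) * (2 * a).
Proof.
move=> e01 N0 p0 a0 cr r0; have [cg _] := log_density_torus N (proj1 (andP e01)) cr r0.
apply: (@le_trans _ _ (\int[mu]_(y in `[- a, a]) (rho y + (fun=> (1 + N / p) * eps `^ (- p)) y))).
  apply: int_le; first exact: cont_norm.
    exact: (cont_add cr.1 (@cont_cst R ((1 + N / p) * eps `^ (- p)))).
  by move=> y _; exact: log_density_bound.
rewrite (intD _ _ cr.1 (@cont_cst R _)) int_cst; last lra.
apply: lerD; first exact: int_window.
by rewrite opprK (_ : a + a = 2 * a) //; ring.
Qed.

Variables (K alpha N : R).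
Hypotheses (K0 : 0 <= K) (alpha0 : 0 < alpha) (N0 : 0 < N).

Lemma weak_potential eps rho l : 0 < eps < 1 -> continuous_torus rho -> 0 < l -> (forall x, l <= rho x) ->
  `|\int[mu]_x (potential K alpha N phi eps rho x * psi x) - \int[mu]_x (K * ln (rho x) * psi x)| <=
  K * (C' * (A * eps `^ alpha) * (2 * (Num.truncn ((A' + A) / period)).+1%:R *
         \int[mu]_(x in `[0, period]) rho x +
       (1 + N / (alpha / 2)) * eps `^ (- (alpha / 2)) * (2 * (A' + A))) +
     eps `^ N / l * C' * (2 * (A' + A))).
Proof.
move=> e01 cr l0 rl; have k0 := K0; have A0 := tf_A fT; have C'0 := tf_C pT; have A'0 := tf_A pT.
have r0 x : 0 <= rho x by apply: le_trans (rl x); exact: ltW.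
have e0 := proj1 (andP e01).
have [cg pg] := log_density_torus N e0 cr r0.
have m01 := powR_alpha alpha0 e01; have T := mollifier_test fT m01.
set f := mollifier phi _ in T; set lg := log_density N eps rho in cg pg *.
have cc : continuous (convolution lg f).
  exact: (conv_continuous (tf_A T) (tf_C T) (tf_cont T) (tf_supp T) (tf_lip T)).
have cl : continuous (fun x => ln (rho x)).
  move=> x; apply: (@continuous_comp _ _ _ rho (@ln R)); first by case: cr => + _; apply.
  by apply: continuous_ln; apply: lt_le_trans (rl x).
have cpsi := tf_cont pT.
pose B := A' + A; rewrite -/B; have B0 : 0 <= B by rewrite /B; lra.
have BB : - B <= B by lra.
have W (u : R -> R) : \int[mu]_x (u x * psi x) = \int[mu]_(x in `[- B, B]) (u x * psi x).
  apply: intT => x; rewrite -ler_norml -ltNge => xB; rewrite (tf_supp pT) ?mulr0 //.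
  by apply: le_lt_trans xB; rewrite /B; lra.
have pull (u : R -> R) : continuous u ->
    \int[mu]_x (K * u x * psi x) = K * \int[mu]_x (u x * psi x).
  move=> cu; rewrite !W -(intZ K); last exact: (cont_mul cu cpsi).
  by apply: eq_Rintegral => x _; rewrite mulrA.
rewrite (pull _ cc) (pull _ cl) -mulrBr normrM (ger0_norm k0) ler_wpM2l //.
have h1 := weak_convolution cg m01; rewrite -/f -/B in h1.
have h2 := log_density_window e01 N0 (divr_gt0 alpha0 (ltr0n _ 2)) B0 cr r0; rewrite -/lg in h2.
(* Removing the floor [eps^N]: above [l] the logarithm is Lipschitz with constant [1 / l]. *)
have h3 : `|\int[mu]_x (lg x * psi x) - \int[mu]_x (ln (rho x) * psi x)| <=
    eps `^ N / l * C' * (2 * B).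
  have c1 := cont_mul cg cpsi; have c2 := cont_mul cl cpsi.
  rewrite !W -intB // (_ : 2 * B = B - - B); last ring.
  apply: int_norm_le => //; first exact: (cont_sub c1 c2).
  move=> x _; rewrite -mulrBl normrM; apply: ler_pM => //; last exact: (tf_bd pT).
  apply: le_trans (ln_lip l0 _ _) _ => //; first by apply: le_trans (rl x) _; rewrite lerDl powR_ge0.
  by rewrite addrAC subrr add0r ger0_norm ?powR_ge0.
rewrite (_ : _ - _ = (\int[mu]_x (convolution lg f x * psi x) - \int[mu]_x (lg x * psi x)) +
   (\int[mu]_x (lg x * psi x) - \int[mu]_x (ln (rho x) * psi x))); last first.
  by rewrite addrA subrK.
apply: le_trans (ler_normD _ _) _; apply: lerD => //.
apply: le_trans h1 _; apply: ler_wpM2l h2.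
by have /andP[m0 _] := m01; rewrite mulr_ge0 // mulr_ge0 // ltW.
Qed.

End WeakPotential.

(** * Passage to the limit *)

Section Data.
Context {R : realType}.
Local Notation mu := (@lebesgue_measure R).

(** The set where [f > c] is open; were it nonempty, a null set would contain an interval of
    positive length. *)
Lemma ae_continuous_le (f : R -> R) (c : R) : continuous f ->
  {ae mu, forall x, f x <= c} -> forall x : R, f x <= c.
Proof.
move=> cf [Z [mZ Z0 fZ]] x; rewrite leNgt; apply/negP => cx.
have H0 : \forall y \near nbhs x, c < f y.
  have e0 : 0 < f x - c by rewrite subr_gt0.
  have /cvgrPdist_lt/(_ _ e0) := cf x; apply: filterS => y.
  by move=> /(le_lt_trans (ler_norm _)); lra.
have [d /= d0 H] := (nbhs_ballP _ _).1 H0.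
have sub : `]x - d, x + d[%classic `<=` Z.
  move=> y; rewrite /= in_itv /= => /andP[y1 y2]; apply: fZ => /= fc.
  suff : c < f y by rewrite ltNge fc.
  by apply: H; rewrite /ball /= ltr_norml; apply/andP; split; lra.
have : (mu (`](x - d)%R, (x + d)%R[%classic : set R) <= mu Z)%E by apply: le_measure => //; rewrite inE.
rewrite Z0 lebesgue_measure_itv /= lte_fin.
have -> : x - d < x + d by lra.
by rewrite EFinN -EFinD lee_fin; lra.
Qed.

Lemma cvge0_le1 (F : R -> \bar R) : F eps @[eps --> 0^'+] --> 0%E ->
  \forall eps \near 0^'+, (F eps < 1)%E.
Proof. by move=> H; exact: (H [set y | (y < 1)%E] (@nbhs_open_ereal_lt R 0 (fun=> 1) ltr01)). Qed.

Lemma mass_data (rho0 : R -> R) (rho0e : R -> R -> R) : L1_torus rho0 ->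
  (forall eps, 0 < eps < 1 -> continuous_torus (rho0e eps)) ->
  L1norm_torus (rho0 \- rho0e eps) @[eps --> 0^'+] --> 0%E ->
  exists2 M : R, 0 <= M & \forall eps \near 0^'+, \int[mu]_(x in `[0, period]) rho0e eps x <= M.
Proof.
move=> [_ i0] rC H.
exists (\int[mu]_(x in `[0, period]) `|rho0 x| + 1); first by rewrite addr_ge0 // Rintegral_ge0.
near=> eps.
have e01 : 0 < eps < 1.
  by apply/andP; split; near: eps; [exact: nbhs_right_gt|exact: nbhs_right_lt].
have h : (L1norm_torus (rho0 \- rho0e eps)%R < 1)%E by near: eps; exact: cvge0_le1.
have [ce _] := rC eps e01.
have ie : mu.-integrable `[0, period] (EFin \o rho0e eps) by exact: continuous_integrable.
have id : mu.-integrable `[0, period] (EFin \o (rho0 \- rho0e eps)).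
  by apply: (integrableB _ i0 ie); exact: measurable_itv.
have ind : mu.-integrable `[0, period] (EFin \o (fun x => `|rho0 x - rho0e eps x|)).
  exact: integrable_norm id.
have in0 : mu.-integrable `[0, period] (EFin \o (fun x => `|rho0 x|)) by exact: integrable_norm i0.
have h1 : \int[mu]_(x in `[0, period]) `|rho0 x - rho0e eps x| <= 1.
  rewrite -lee_fin /Rintegral fineK; first exact: ltW.
  exact: integrable_fin_num.
apply: (@le_trans _ _ (\int[mu]_(x in `[0, period]) (`|rho0 x| + `|rho0 x - rho0e eps x|))).
  apply: le_Rintegral => //; first by apply: (integrableD _ in0 ind); exact: measurable_itv.
  move=> x _; have := ler_norm (rho0 x); have := ler_norm (- (rho0 x - rho0e eps x)).
  rewrite normrN; lra.
by rewrite RintegralD // lerD2l.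
Unshelve. all: by end_near.
Qed.

Lemma velocity_data (u0 : R -> R) (u0e : R -> R -> R) : Linfty_torus u0 ->
  (forall eps, 0 < eps < 1 -> continuous_torus (u0e eps)) ->
  Linftynorm_torus (u0 \- u0e eps) @[eps --> 0^'+] --> 0%E ->
  exists2 V : R, 0 <= V & \forall eps \near 0^'+, forall x, `|u0e eps x| <= V.
Proof.
move=> [_ /andP[_]]; rewrite inE /= => fu0 uC H.
(* The norm of exponent [+oo] unfolds to the essential supremum only when the whole space has
   positive measure. *)
have muT : (0%R < mu [set: R])%E.
  apply: (@lt_le_trans _ _ (mu `]0, 1[%classic)).
    by rewrite lebesgue_measure_itv /= lte_fin ltr01 sube0 lte_fin ltr01.
  by apply: le_measure; rewrite ?inE.
have LE f : Lnorm mu +oo%E f = ess_sup_inf.ess_sup mu (abse \o f) by rewrite Lnorm.unlock muT.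
rewrite /finite_norm LE in fu0.
have [c hc] : exists c : R, (ess_sup_inf.ess_sup mu (abse \o (EFin \o u0)) <= c%:E)%E.
  move: fu0; case: (ess_sup_inf.ess_sup _ _) => [c _| //|_]; first by exists c.
  by exists 0; rewrite leNye.
have /ess_sup_inf.ess_supP aec := hc.
exists (`|c| + 1); first by rewrite addr_ge0.
near=> eps.
have e01 : 0 < eps < 1.
  by apply/andP; split; near: eps; [exact: nbhs_right_gt|exact: nbhs_right_lt].
have h : (Linftynorm_torus (u0 \- u0e eps)%R < 1)%E by near: eps; exact: cvge0_le1.
rewrite /Linftynorm_torus LE in h.
have /ess_sup_inf.ess_supP aed := ltW h.
have [ce _] := uC eps e01.
apply: ae_continuous_le; first exact: cont_norm.
apply: filterS2 aec aed => x /=; rewrite !lee_fin => h1 h2.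
rewrite (_ : u0e eps x = u0 x - (u0 x - u0e eps x)); last ring.
by apply: le_trans (ler_normB _ _) _; rewrite lerD // (le_trans h1) // ler_norm.
Unshelve. all: by end_near.
Qed.

Lemma cvg0_of_powR (F : R -> R) (c1 p1 c2 p2 : R) : 0 < p1 -> 0 < p2 ->
  (\forall eps \near 0^'+, `|F eps| <= c1 * eps `^ p1 + c2 * eps `^ p2) ->
  F eps @[eps --> 0^'+] --> (0 : R).
Proof.
move=> p10 p20 H; apply/norm_cvg0P.
apply: (@squeeze_cvgr _ _ _ _ (fun=> 0) (fun eps => c1 * eps `^ p1 + c2 * eps `^ p2)).
- by near=> eps; rewrite normr_ge0 /=; near: eps.
- exact: cvg_cst.
- have E : c1 * 0 + c2 * 0 = 0 :> R by rewrite !mulr0 addr0.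
  rewrite -[X in _ --> X]E.
  by apply: cvgD; apply: cvgM; try exact: cvg_cst; exact: powR_cvg0.
Unshelve. all: by end_near.
Qed.

End Data.

(** * Existence and uniqueness for the original system *)

Section Existence.
Context {R : realType}.
Local Notation mu := (@lebesgue_measure R).
Variables (phi : R -> R) (A C : R) (fT : test_fun phi (derive1 phi) A C).
Variables (K alpha beta N : R).
Hypotheses (K0 : 0 <= K) (alpha0 : 0 < alpha) (beta0 : 0 < beta) (N0 : 0 < N).

(** [0 < T] makes [0] a time of the interval; otherwise the initial condition is vacuous. *)
Lemma solution_gas (eps : R) (r0 u0 : R -> R) (T : \bar R) r m : 0 < eps < 1 -> (0%R < T)%E ->
  solution K alpha beta N phi eps r0 u0 T r m ->
  gas_solution phi K alpha N (eps `^ beta) eps r0 (fun x => r0 x * u0 x) T r m.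
Proof.
move=> e01 T0 [[dr [dm [rC mC E]]] rp ini].
have I0 : time_interval T 0 by split.
have rt t : time_interval T t -> continuous_torus (r t) by case/C1_mapP: rC => + _ _ => /(_ t) H /H[].
split.
- apply: C1_map_eq rC => // t It; apply/funext => x; by have [-> _] := E t It x.
- apply: C1_map_eq mC => // t It; apply/funext => x; have [_ ->] := E t It x.
  by rewrite (derive1_potential fT) //; [exact: rt|move=> y; rewrite ltW // rp].
- by split; [apply/funext => x; case: (ini I0 x)|split; [apply/funext => x; case: (ini I0 x)|]].
Qed.

Lemma gas_solution_sol (eps : R) (r0 u0 : R -> R) (T : \bar R) r m : 0 < eps < 1 ->
  gas_solution phi K alpha N (eps `^ beta) eps r0 (fun x => r0 x * u0 x) T r m ->
  solution K alpha beta N phi eps r0 u0 T r m.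
Proof.
move=> e01 [rC mC [r00 [m00 rp]]].
have rt t : time_interval T t -> continuous_torus (r t) by case/C1_mapP: rC => + _ _ => /(_ t) H /H[].
split=> //; last by move=> _ x; rewrite r00 m00.
exists (fun t => rhs phi K alpha N (eps `^ beta) eps true (r t) (m t)),
  (fun t => rhs phi K alpha N (eps `^ beta) eps false (r t) (m t)); split=> // t It x.
split=> //; rewrite (derive1_potential fT) //; first exact: rt.
by move=> y; rewrite ltW // rp.
Qed.

Lemma gas_solution_le (eps e : R) (r0 m0 : R -> R) (T T' : \bar R) r m : (T' <= T)%E ->
  gas_solution phi K alpha N e eps r0 m0 T r m -> gas_solution phi K alpha N e eps r0 m0 T' r m.
Proof.
move=> TT [rC mC [a [b c]]].
have JI : time_interval T' `<=` time_interval T.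
  by move=> t [t0 tT]; split=> //; exact: lt_le_trans tT TT.
split; [exact: C1_map_eq rC|exact: C1_map_eq mC|split=> //; split=> // s Js].
exact: c (JI s Js).
Qed.

Lemma existence_uniqueness (eps : R) (r0 u0 : R -> R) : 0 < eps < 1 ->
  continuous_torus r0 -> continuous_torus u0 -> (forall x, eps <= r0 x) ->
  exists r m, solution K alpha beta N phi eps r0 u0 +oo%E r m /\
    forall (T : \bar R) r' m', solution K alpha beta N phi eps r0 u0 T r' m' ->
    forall t, time_interval T t -> forall x, r' t x = r t x /\ m' t x = m t x.
Proof.
move=> e01 rC uC re; have e0 := proj1 (andP e01).
have [R0 R00 rR] := continuous_torus_bounded rC.
have [V V0 uV] := continuous_torus_bounded uC.
have [G G0 HG] := dpotential_mass fT K0 alpha0 N0.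
have ee : 0 < eps `^ beta <= 1 by rewrite powR_gt0 //= powR_le1 // ltW.
have g0 : 0 <= G * eps `^ (- (3 * alpha)) by rewrite mulr_ge0 // powR_ge0.
have Pm rho M : continuous_torus rho -> (forall x, 0 <= rho x) ->
    \int[mu]_(x in `[0, period]) rho x <= M ->
    forall x, `|dpotential phi K alpha N eps rho x| <= G * eps `^ (- (3 * alpha)) * (1 + M).
  by move=> c1 c2 c3 x; rewrite mulrAC; exact: HG.
have R1 : 1 <= R0 + 1 by rewrite lerDr.
have rR' x : r0 x <= R0 + 1 by apply: le_trans (ler_norm _) (le_trans (rR x) _); rewrite lerDl.
have mV x : `|r0 x * u0 x| <= V * r0 x.
  have r00 : 0 <= r0 x := le_trans (ltW e0) (re x).
  by rewrite normrM mulrC (ger0_norm r00) ler_wpM2r.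
have mC := torus_mul rC uC.
have [r [m S]] := global_gas_solution fT K0 alpha0 e01 ee g0 Pm rC mC re rR' R1 V0 mV (lexx _).
exists r, m; split; first exact: gas_solution_sol.
move=> T r' m' S' t It x; have [t0 tT] := It.
have T0 : (0%R < T)%E by apply: le_lt_trans tT; rewrite lee_fin.
(* Uniqueness is available on bounded horizons: [tau] is [T] itself if finite, and [t + 1]
   otherwise. *)
have [tau tt tauT] : exists2 tau : R, t < tau & (tau%:E <= T)%E.
  case: T tT {S' It T0} => [c| |] //; last by exists (t + 1); rewrite ?ltrDl ?leey.
  by rewrite lte_fin => tc; exists c.
have S1 := gas_solution_le tauT (solution_gas e01 T0 S').
have S2 : gas_solution phi K alpha N (eps `^ beta) eps r0 (fun x => r0 x * u0 x) tau%:E r m.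
  by apply: gas_solution_le S; rewrite leey.
by apply: (gas_solution_unique fT K0 alpha0 e01 ee g0 Pm re rR' R1 V0 mV (lexx _) S1 S2); rewrite t0.
Qed.

End Existence.

(** * Bounds uniform in epsilon and weak limits *)

Section Limit.
Context {R : realType}.
Local Notation mu := (@lebesgue_measure R).
Variables (phi : R -> R) (A C : R) (fT : test_fun phi (derive1 phi) A C).
Hypotheses (phi_ge0 : forall x, 0 <= phi x) (phi_int1 : \int[mu]_x phi x = 1).
Variables (K alpha beta N : R).
Hypotheses (K0 : 0 <= K) (alpha0 : 0 < alpha) (alpha_lt : alpha < 6^-1) (beta0 : 0 < beta)
  (N0 : 0 < N) (abN : 3 * alpha + beta < N - 1).
Variables (rho0 u0 : R -> R) (rho0e u0e : R -> R -> R).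
Hypotheses (rho0_L1 : L1_torus rho0) (u0_Linfty : Linfty_torus u0)
  (rho0e_C : forall eps, 0 < eps < 1 -> continuous_torus (rho0e eps))
  (u0e_C : forall eps, 0 < eps < 1 -> continuous_torus (u0e eps))
  (rho0e_ge : forall eps, 0 < eps < 1 -> forall x, eps <= rho0e eps x)
  (rho0e_cvg : L1norm_torus (rho0 \- rho0e eps) @[eps --> 0^'+] --> 0%E)
  (u0e_cvg : Linftynorm_torus (u0 \- u0e eps) @[eps --> 0^'+] --> 0%E).
Variables (rho m : R -> R -> R -> R).
Hypothesis sol : forall eps, 0 < eps < 1 ->
  solution K alpha beta N phi eps (rho0e eps) (u0e eps) +oo%E (rho eps) (m eps).

Let gas eps (e01 : 0 < eps < 1) := solution_gas fT alpha0 e01 (ltry 0) (sol e01).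

Lemma solution_torus eps t : 0 < eps < 1 -> 0 <= t ->
  continuous_torus (rho eps t) /\ continuous_torus (m eps t).
Proof.
move=> e01 t0; have It : time_interval +oo%E t by split; rewrite ?ltry.
have [rC mC _] := gas e01.
split; [case/C1_mapP: rC|case/C1_mapP: mC] => + _ _ => /(_ t It); by case.
Qed.

(** [D] and [M] do not depend on [eps]: the convergences bound the mass and velocity of the data for
    small [eps], and the force constant [G] is uniform. The bound [R0] on the initial density
    depends on [eps], but enters only the upper density bound, which is discarded. *)
Lemma solution_uniform_bounds t : 0 < t -> exists D M : R, [/\ 1 <= D, 0 <= M &
  \forall eps \near 0^'+, [/\ 0 < eps < 1,
    forall x, D^-1 * eps `^ (1 + beta + 3 * alpha) <= rho eps t x,
    forall x, `|m eps t x| <= D * eps `^ (- (3 * alpha)) * rho eps t x &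
    \int[mu]_(x in `[0, period]) rho eps t x <= M]].
Proof.
move=> t0; have [M M0 HM] := mass_data rho0_L1 rho0e_C rho0e_cvg.
have [V V0 HV] := velocity_data u0_Linfty u0e_C u0e_cvg.
have [G G0 HG] := dpotential_mass fT K0 alpha0 N0.
have a0 := alpha0; have b0 := beta0.
(* The bounds hold strictly before the horizon, which is therefore taken beyond [t]. *)
pose tau := t + 1; have tau0 : 0 <= tau by rewrite /tau; lra.
have mb0 : 0 <= mass_bd M tau by rewrite addr_ge0 // mulr_ge0 // ltW // period_gt0.
have Gt : 0 <= G * (1 + mass_bd M tau) * tau by rewrite !mulr_ge0 // addr_ge0.
pose D := V + G * (1 + mass_bd M tau) * tau + 1.
have D1 : 1 <= D by rewrite lerDr addr_ge0.
exists D, (mass_bd M tau); split=> //.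
near=> eps.
have e01 : 0 < eps < 1.
  by apply/andP; split; near: eps; [exact: nbhs_right_gt|exact: nbhs_right_lt].
have e0 := proj1 (andP e01).
have rM : \int[mu]_(x in `[0, period]) rho0e eps x <= M by near: eps.
have uV : forall x, `|u0e eps x| <= V by near: eps.
have ee : 0 < eps `^ beta <= 1 by rewrite powR_gt0 //= powR_le1 // ltW.
set E := eps `^ (- (3 * alpha)).
have E1 : 1 <= E by apply: powR_ge1 => //; lra.
have E0 : 0 <= E by lra.
have g0 : 0 <= G * E by rewrite mulr_ge0.
have Pm r M' : continuous_torus r -> (forall x, 0 <= r x) ->
    \int[mu]_(x in `[0, period]) r x <= M' ->
    forall x, `|dpotential phi K alpha N eps r x| <= G * E * (1 + M').
  by move=> c1 c2 c3 x; rewrite mulrAC; exact: HG.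
have re := rho0e_ge e01.
have [R0 R00 rR] := continuous_torus_bounded (rho0e_C e01).
have R1 : 1 <= R0 + 1 by rewrite lerDr.
have rR' x : rho0e eps x <= R0 + 1 by apply: le_trans (ler_norm _) (le_trans (rR x) _); rewrite lerDl.
have mV x : `|rho0e eps x * u0e eps x| <= V * rho0e eps x.
  have r00 : 0 <= rho0e eps x := le_trans (ltW e0) (re x).
  by rewrite normrM mulrC (ger0_norm r00) ler_wpM2r.
have S : gas_solution phi K alpha N (eps `^ beta) eps (rho0e eps)
    (fun x => rho0e eps x * u0e eps x) tau%:E (rho eps) (m eps).
  by apply: gas_solution_le (gas e01); rewrite leey.
have tt : 0 <= t < tau by rewrite ltW //= /tau ltrDl.
have B x := gas_solution_bounds e01 ee g0 Pm re rR' R1 V0 mV rM S x tt.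
have vD : vel_bd (G * E) V M tau + 1 <= D * E.
  rewrite /vel_bd /D.
  have -> : G * E * (1 + mass_bd M tau) * tau = G * (1 + mass_bd M tau) * tau * E by ring.
  nra.
split=> //.
- move=> x; have [low _ _ _] := B x; apply: le_trans low; rewrite /low_bd le_min.
  have U0 : 0 < tr_bd (G * E) V M tau.
    rewrite /tr_bd /vel_bd ltr_wpDl // addr_ge0 // !mulr_ge0 // addr_ge0 //.
  have D0 : 0 < D by lra.
  (* Origin of the exponent: the floor is [eps * eps^beta] divided by a slope of order
     [eps^(-3 alpha)]. *)
  have sp : eps `^ (1 + beta + 3 * alpha) * E = eps * eps `^ beta.
    rewrite /E -powRD; last by apply/implyP => _; rewrite gt_eqF.
    by rewrite addrK powRD ?powRr1 ?(ltW e0) //; apply/implyP => _; rewrite gt_eqF.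
  have h2 : D^-1 * eps `^ (1 + beta + 3 * alpha) <= eps * eps `^ beta / tr_bd (G * E) V M tau.
    rewrite ler_pdivlMr // -sp -mulrA mulrC ler_pdivrMr // -[leRHS]mulrA.
    by rewrite ler_wpM2l ?powR_ge0 // [E * D]mulrC.
  rewrite h2 andbT; apply: (@le_trans _ _ (eps `^ (1 + beta + 3 * alpha))).
    by rewrite ler_piMl ?powR_ge0 // invf_le1.
  rewrite -[leRHS]powRr1 ?(ltW e0) //; apply: ger_powR; last lra.
  by case/andP: e01 => -> /ltW ->.
- move=> x; have [low _ mb _] := B x; apply: le_trans mb _.
  have r0 : 0 <= rho eps t x.
    have [_ _ [_ [_ rp]]] := S; rewrite ltW // rp //.
    by case/andP: tt => t1 t2; split=> //; rewrite lte_fin.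
  rewrite ler_wpM2r //; lra.
- by have [] := B 0.
Unshelve. all: by end_near.
Qed.

Variables (psi : R -> R) (A' C' : R) (pT : test_fun psi (derive1 psi) A' C').

Lemma int_add_cst (f : R -> R) (c : R) : continuous f ->
  \int[mu]_x ((f x + c) * psi x) = \int[mu]_x (f x * psi x) + c * \int[mu]_x psi x.
Proof.
move=> cf; have cpsi := tf_cont pT.
have W (u : R -> R) : \int[mu]_x (u x * psi x) = \int[mu]_(x in `[- A', A']) (u x * psi x).
  by apply: intT => x; rewrite -ler_norml -ltNge => /(tf_supp pT) ->; rewrite mulr0.
have W1 : \int[mu]_x psi x = \int[mu]_(x in `[- A', A']) psi x.
  by apply: intT => x; rewrite -ler_norml -ltNge => /(tf_supp pT) ->.
rewrite !W W1 -intZ // -intD; last 2 first.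
- exact: (cont_mul cf cpsi).
- exact: (cont_mul (@cont_cst R c) cpsi).
by apply: eq_Rintegral => x _; rewrite mulrDl.
Qed.

Let n : R := 2 * (Num.truncn ((A' + 1) / period)).+1%:R.

Section fixed.
Variables (t eps D M : R).
Hypotheses (t0 : 0 < t) (D1 : 1 <= D) (M0 : 0 <= M) (e01 : 0 < eps < 1)
  (rlow : forall x, D^-1 * eps `^ (1 + beta + 3 * alpha) <= rho eps t x)
  (mU : forall x, `|m eps t x| <= D * eps `^ (- (3 * alpha)) * rho eps t x)
  (rM : \int[mu]_(x in `[0, period]) rho eps t x <= M).
Let e0 : 0 < eps. Proof. by case/andP: e01. Qed.
Let U := D * eps `^ (- (3 * alpha)).
Let U0 : 0 <= U. Proof. by rewrite mulr_ge0 ?powR_ge0 // (le_trans ler01). Qed.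
Let l0 : 0 < D^-1 * eps `^ (1 + beta + 3 * alpha).
Proof. by rewrite mulr_gt0 ?powR_gt0 // invr_gt0 (lt_le_trans ltr01). Qed.
Let rp x : 0 < rho eps t x. Proof. exact: lt_le_trans (rlow x). Qed.
Let tC := solution_torus e01 (ltW t0).
Let rC : continuous_torus (rho eps t). Proof. by case: tC. Qed.
Let mC : continuous_torus (m eps t). Proof. by case: tC. Qed.

Lemma solution_admissible : exists b, admissible b U (rho eps t) (m eps t).
Proof.
have [b b0 rb] := continuous_torus_bounded rC.
by exists b => x; split; [rewrite ltW //= (le_trans (ler_norm _))|exact: mU].
Qed.

Lemma derive1_rho x : derive1 (fun s => rho eps s x) t =
  upwind eps (rho eps t) (velocity (rho eps t) (m eps t)) x + eps `^ beta.
Proof.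
have [rC' _ _] := gas e01; have H := C1_is_derive x rC' t0 (ltry t).
by rewrite derive1E; case: H.
Qed.

Lemma derive1_m x : derive1 (fun s => m eps s x) t =
  upwind eps (m eps t) (velocity (rho eps t) (m eps t)) x -
  rho eps t x * dpotential phi K alpha N eps (rho eps t) x.
Proof.
have [_ mC' _] := gas e01; have H := C1_is_derive x mC' t0 (ltry t).
by rewrite derive1E; case: H.
Qed.

Lemma rho_velocity x : rho eps t x * velocity (rho eps t) (m eps t) x = m eps t x.
Proof. by rewrite /velocity mulrC divfK // gt_eqF. Qed.

Lemma continuity_error :
  `|\int[mu]_x (derive1 (fun s => rho eps s x) t * psi x) - \int[mu]_x (m eps t x * derive1 psi x)|
  <= C' * D * n * M * eps `^ (1 - 3 * alpha) + `|\int[mu]_x psi x| * eps `^ beta.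
Proof.
have [b ad] := solution_admissible.
have C0 := tf_C pT; have n0 : 0 <= n by rewrite mulr_ge0.
have up := upwind_torus eps true U0 ad rC mC.
under eq_Rintegral do rewrite derive1_rho.
rewrite (int_add_cst _ up.1) /= addrAC.
have -> : \int[mu]_x (m eps t x * derive1 psi x) =
    \int[mu]_x (rho eps t x * velocity (rho eps t) (m eps t) x * derive1 psi x).
  by apply: eq_Rintegral => x _; rewrite rho_velocity.
apply: le_trans (ler_normD _ _) _; apply: lerD; last first.
  by rewrite normrM mulrC (ger0_norm (powR_ge0 _ _)).
have := weak_upwind (k := true) pT e01 U0 ad rC mC (c := U) _ U0.
move=> /(_ _)/le_trans; apply; first by move=> x; rewrite /= rho_velocity; exact: mU.
rewrite -/n; apply: (@le_trans _ _ (C' * eps * U * n * M)).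
  exact: ler_wpM2l (mulr_ge0 (mulr_ge0 (mulr_ge0 C0 (ltW e0)) U0) n0) _ _ rM.
rewrite /U powRD; last by apply/implyP => _; rewrite gt_eqF.
by rewrite powRr1 ?(ltW e0) // [leRHS](_ : _ = C' * eps * (D * eps `^ (- (3 * alpha))) * n * M) //; ring.
Qed.

Lemma momentum_error :
  `|\int[mu]_x (derive1 (fun s => m eps s x) t * psi x)
    - \int[mu]_x (rho eps t x * velocity (rho eps t) (m eps t) x ^+ 2 * derive1 psi x)
    + \int[mu]_x (rho eps t x * derive1 (potential K alpha N phi eps (rho eps t)) x * psi x)|
  <= C' * D ^+ 2 * n * M * eps `^ (1 - 6 * alpha).
Proof.
have [b ad] := solution_admissible.
have C0 := tf_C pT; have n0 : 0 <= n by rewrite mulr_ge0.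
have up := upwind_torus eps false U0 ad rC mC.
have r0 x : 0 <= rho eps t x by exact: ltW.
rewrite (derive1_potential fT) //.
have dP := dpotential_torus fT K N alpha0 e01 rC r0.
have cpsi := tf_cont pT.
set P := dpotential _ _ _ _ _ _ in dP *.
have cP : continuous (fun x => rho eps t x * P x) := cont_mul rC.1 dP.1.
have W (u : R -> R) : \int[mu]_x (u x * psi x) = \int[mu]_(x in `[- A', A']) (u x * psi x).
  by apply: intT => x; rewrite -ler_norml -ltNge => /(tf_supp pT) ->; rewrite mulr0.
have -> : \int[mu]_x (derive1 (fun s => m eps s x) t * psi x) =
   \int[mu]_x (upwind eps (m eps t) (velocity (rho eps t) (m eps t)) x * psi x) -
   \int[mu]_x (rho eps t x * P x * psi x).
  rewrite !W -intB; [|exact: (cont_mul up.1 cpsi)|exact: (cont_mul cP cpsi)].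
  by apply: eq_Rintegral => x _; rewrite derive1_m mulrBl.
rewrite addrAC subrK.
have -> : \int[mu]_x (rho eps t x * velocity (rho eps t) (m eps t) x ^+ 2 * derive1 psi x) =
    \int[mu]_x (m eps t x * velocity (rho eps t) (m eps t) x * derive1 psi x).
  by apply: eq_Rintegral => x _; rewrite expr2 mulrA rho_velocity.
have UU : 0 <= U ^+ 2 by rewrite exprn_ge0.
(* The momentum flux is at most [U^2] times the density, which costs [eps^(-6 alpha)] against the
   gain [eps]. *)
have := weak_upwind (k := false) pT e01 U0 ad rC mC (c := U ^+ 2) _ UU.
move=> /(_ _)/le_trans; apply.
  move=> x /=; have [v1 _] := quot_bound U0 (r0 x) (mU x).
  rewrite normrM expr2 mulrAC; apply: ler_pM => //; exact: mU.
rewrite -/n; apply: (@le_trans _ _ (C' * eps * U ^+ 2 * n * M)).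
  exact: ler_wpM2l (mulr_ge0 (mulr_ge0 (mulr_ge0 C0 (ltW e0)) UU) n0) _ _ rM.
rewrite /U (_ : 1 - 6 * alpha = 1 + (- (3 * alpha) + - (3 * alpha))); last ring.
have ne (p q : R) : (p + q == 0) ==> (eps != 0) by apply/implyP => _; rewrite gt_eqF.
rewrite !powRD // powRr1 ?(ltW e0) //.
by rewrite [leRHS](_ : _ = C' * eps * (D * eps `^ (- (3 * alpha))) ^+ 2 * n * M) //; ring.
Qed.

Let n' : R := 2 * (Num.truncn ((A' + A) / period)).+1%:R.

(** [eps^alpha] splits as [F * F]: one factor cancels the growth [E = eps^(- alpha / 2)] of the
    logarithm, the other tends to [0]. *)
Lemma potential_error :
  `|\int[mu]_x (potential K alpha N phi eps (rho eps t) x * psi x) -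
    \int[mu]_x (K * ln (rho eps t x) * psi x)|
  <= K * (C' * A * (n' * M + (1 + N / (alpha / 2)) * (2 * (A' + A)))) * eps `^ (alpha / 2) +
     K * (D * C' * (2 * (A' + A))) * eps `^ (N - (1 + beta + 3 * alpha)).
Proof.
have C0 := tf_C pT; have A0 := tf_A fT; have A'0 := tf_A pT; have k0 := K0; have a0 := alpha0.
have n0 : 0 <= n' by rewrite mulr_ge0.
have q0 : 0 <= 1 + N / (alpha / 2) by rewrite addr_ge0 // !divr_ge0 // ltW.
apply: le_trans (weak_potential fT phi_ge0 phi_int1 pT K0 alpha0 N0 e01 rC l0 rlow) _.
have IM := rM; rewrite -/n'; move: (\int[mu]_(x in `[0, period]) rho eps t x) IM => I IM.
have ne (p q : R) : (p + q == 0) ==> (eps != 0) by apply/implyP => _; rewrite gt_eqF.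
set q := 1 + _ in q0 *; set w := 2 * (A' + A).
have w0 : 0 <= w by rewrite /w; lra.
set E := eps `^ (- (alpha / 2)); set F := eps `^ (alpha / 2).
set G := eps `^ (N - _).
have E1 : 1 <= E by apply: powR_ge1 => //; lra.
have F0 : 0 <= F by exact: powR_ge0.
have aF : eps `^ alpha = F * F by rewrite /F -powRD //; congr (_ `^ _); field.
have FE : F * E = 1 by rewrite /F /E -powRD // subrr powRr0.
have F1 : F <= 1 by apply: powR_le1 => //; lra.
have g2 : eps `^ N / (D^-1 * eps `^ (1 + beta + 3 * alpha)) = D * G.
  have D0 : D != 0 by rewrite gt_eqF // (lt_le_trans ltr01).
  have X0 : eps `^ (1 + beta + 3 * alpha) != 0 by rewrite gt_eqF // powR_gt0.
  rewrite /G powRB; last by apply/implyP => _; rewrite gt_eqF.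
  by move: (eps `^ (1 + beta + 3 * alpha)) X0 => X X0; field; rewrite D0 X0.
move: (n') n0 => nn n0.
have h : F * (nn * I) <= nn * M.
  have : nn * I <= nn * M by rewrite ler_wpM2l.
  have : 0 <= nn * M by rewrite mulr_ge0.
  nra.
have g1 : C' * (A * eps `^ alpha) * (nn * I + q * E * w) <= C' * A * (nn * M + q * w) * F.
  rewrite aF.
  have -> : C' * (A * (F * F)) * (nn * I + q * E * w) =
    C' * A * (F * (nn * I) + q * w * (F * E)) * F by ring.
  by rewrite FE mulr1 ler_wpM2r // ler_wpM2l ?mulr_ge0 ?(ltW A0) // lerD2r.
rewrite g2 -[K * (C' * A * _) * F]mulrA -[K * (D * C' * w) * G]mulrA -mulrDr ler_wpM2l //.
by apply: lerD => //; rewrite le_eqVlt; apply/orP; left; apply/eqP; ring.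
Qed.

End fixed.

Lemma weak_limits t : 0 < t ->
  [/\ (\int[mu]_x (derive1 (fun s => rho eps s x) t * psi x)
       - \int[mu]_x (m eps t x * derive1 psi x)) @[eps --> 0^'+] --> (0 : R),
      (\int[mu]_x (derive1 (fun s => m eps s x) t * psi x)
       - \int[mu]_x (rho eps t x * velocity (rho eps t) (m eps t) x ^+ 2 * derive1 psi x)
       + \int[mu]_x (rho eps t x * derive1 (potential K alpha N phi eps (rho eps t)) x * psi x))
        @[eps --> 0^'+] --> (0 : R)
    & (\int[mu]_x (potential K alpha N phi eps (rho eps t) x * psi x)
       - \int[mu]_x (K * ln (rho eps t x) * psi x)) @[eps --> 0^'+] --> (0 : R)].
Proof.
move=> t0; have [D [M [D1 M0 H]]] := solution_uniform_bounds t0.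
have a0 := alpha0; have al := alpha_lt; have ab := abN.
split.
- apply: (cvg0_of_powR (p1 := 1 - 3 * alpha) (p2 := beta) _ beta0); first lra.
  apply: filterS H => eps [e01 h1 h2 h3].
  exact: (@continuity_error t eps D M t0 D1 e01 h1 h2 h3).
(* [1 - 6 * alpha > 0] is the condition [alpha < 6^-1]; the second power is a dummy with coefficient
   [0]. *)
- apply: (cvg0_of_powR (p1 := 1 - 6 * alpha) (p2 := 1) (c2 := 0) _ ltr01); first lra.
  apply: filterS H => eps [e01 h1 h2 h3]; rewrite mul0r addr0.
  exact: (@momentum_error t eps D M t0 D1 e01 h1 h2 h3).
(* The second exponent is positive exactly when [3 * alpha + beta < N - 1]. *)
- apply: (cvg0_of_powR (p1 := alpha / 2) (p2 := N - (1 + beta + 3 * alpha))); [lra|lra|].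
  apply: filterS H => eps [e01 h1 h2 h3].
  exact: (@potential_error t eps D M t0 D1 M0 e01 h1 h3).
Qed.

End Limit.

Theorem theorem1 (R : realType) (phi : R -> R)
  (phi_Cc : Cc_infty phi)
  (phi_ge0 : forall x, 0 <= phi x)
  (phi_even : forall x, phi (- x) = phi x)
  (phi_int1 : \int[@lebesgue_measure R]_x phi x = 1)
  (K alpha beta N : R)
  (K_ge0 : 0 <= K) (alpha_gt0 : 0 < alpha) (alpha_lt : alpha < 6^-1)
  (beta_gt0 : 0 < beta) (N_gt0 : 0 < N) (abN : 3 * alpha + beta < N - 1)
  (rho0 u0 : R -> R)
  (rho0_L1 : L1_torus rho0)
  (rho0_ge0 : {ae (@lebesgue_measure R), forall x, 0 <= rho0 x})
  (u0_Linfty : Linfty_torus u0)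
  (rho0e u0e : R -> R -> R)
  (rho0e_C : forall eps, 0 < eps < 1 -> continuous_torus (rho0e eps))
  (u0e_C : forall eps, 0 < eps < 1 -> continuous_torus (u0e eps))
  (rho0e_ge : forall eps, 0 < eps < 1 -> forall x, eps <= rho0e eps x)
  (rho0e_cvg : L1norm_torus (rho0 \- rho0e eps) @[eps --> 0^'+] --> 0%E)
  (u0e_cvg : Linftynorm_torus (u0 \- u0e eps) @[eps --> 0^'+] --> 0%E) :
  (* existence of a global solution, and uniqueness on every [0, T[ *)
  (forall eps, 0 < eps < 1 ->
    exists rho m : R -> R -> R,
      solution K alpha beta N phi eps (rho0e eps) (u0e eps) +oo%E rho m /\
      forall (T : \bar R) (rho' m' : R -> R -> R),
        solution K alpha beta N phi eps (rho0e eps) (u0e eps) T rho' m' ->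
        forall t, time_interval T t -> forall x,
          rho' t x = rho t x /\ m' t x = m t x) /\
  (forall rho m : R -> R -> R -> R,
    (forall eps, 0 < eps < 1 ->
      solution K alpha beta N phi eps (rho0e eps) (u0e eps) +oo%E
        (rho eps) (m eps)) ->
    weak_asymptotic_solution K rho m
      (fun eps t => potential K alpha N phi eps (rho eps t))).
Proof.
have [A [C fT]] := Cc_infty_test_fun phi_Cc.
split=> [eps e01|rho m sol t psi t0 /Cc_infty_test_fun[A' [C' pT]]].
  by apply: (existence_uniqueness fT); [..|exact: rho0e_C|exact: u0e_C|exact: rho0e_ge].
exact: (weak_limits fT phi_ge0 phi_int1 K_ge0 alpha_gt0 alpha_lt beta_gt0 N_gt0 abN
  rho0_L1 u0_Linfty rho0e_C u0e_C rho0e_ge rho0e_cvg u0e_cvg sol pT).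
Qed.
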